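(* For each $c>1$ the set $\mathbb{G}_c=\{(s,p)\in\mathbb{G}: c|s^2-4p|+|s|^2<2(1+|p|^2),\ |p|^2+\mathrm{Im}(\overline{s}p+\overline{s})<1\}$ is open, its holomorphic automorphism group satisfies $\mathrm{Aut}(\mathbb{G}_c)=\mathrm{Aut}(\mathbb{G})\simeq\mathrm{Aut}(\mathbb{D})$, and $\mathbb{G}=\bigcup_{c>1}\mathbb{G}_c$.
   Context: $\mathbb{D}$ is the open unit disc and $\mathrm{Aut}(\mathbb{D})$ its holomorphic automorphism group. $\mathbb{G}=\{(z_1+z_2,z_1z_2):z_1,z_2\in\mathbb{D}\}$ with $\mathrm{Aut}(\mathbb{G})=\{H_\varphi:\varphi\in\mathrm{Aut}(\mathbb{D})\}$, $H_\varphi(z_1+z_2,z_1z_2)=(\varphi(z_1)+\varphi(z_2),\varphi(z_1)\varphi(z_2))$; the equality $\mathrm{Aut}(\mathbb{G}_c)=\mathrm{Aut}(\mathbb{G})$ means that the automorphisms of $\mathbb{G}_c$ are exactly the restrictions of the $H_\varphi$ to $\mathbb{G}_c$. *)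

(* Defs.v *)
From HB Require Import structures.
From mathcomp Require Import all_boot all_order all_algebra.
From mathcomp Require Import complex.
From mathcomp Require Import all_classical all_reals all_analysis.
Import Order.TTheory GRing.Theory Num.Theory.
Import numFieldNormedType.Exports.

Set Implicit Arguments.
Unset Strict Implicit.
Unset Printing Implicit Defensive.

Local Open Scope ring_scope.
Local Open Scope classical_set_scope.

(* The complex plane C = R[i], seen as a normed module over itself, so that
   [differentiable] below means complex (C-linear) Frechet differentiability. *)
Notation Cx R := ((complex R)^o).
Notation Cx2 R := ((Cx R) * (Cx R))%type.

(* Holomorphic on U: complex differentiable at every point of U
   (the derivative is C-linear since the scalar field is C). *)
Definition holo_on (K : numFieldType) (V W : normedModType K)
  (U : set V) (f : V -> W) : Prop :=
  forall x, U x -> differentiable f x.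

(* f is a holomorphic automorphism of U: a holomorphic self-map of U with a
   holomorphic inverse self-map of U (only the values on U matter). *)
Definition is_aut (K : numFieldType) (V : normedModType K)
  (U : set V) (f : V -> V) : Prop :=
  [/\ holo_on U f, (forall x, U x -> U (f x)) &
      exists g : V -> V, [/\ holo_on U g, (forall x, U x -> U (g x)),
        (forall x, U x -> g (f x) = x) & (forall x, U x -> f (g x) = x)]].

Definition disc (R : realType) : set (Cx R) := [set z | ComplexField.Normc.normc z < 1].

Definition symbidisc (R : realType) : set (Cx2 R) :=
  [set sp | exists z1 z2 : Cx R, [/\ disc z1, disc z2 & sp = (z1 + z2, z1 * z2)]].

Definition Gc (R : realType) (c : R) : set (Cx2 R) :=
  [set sp | [/\ symbidisc sp,
     c * ComplexField.Normc.normc (sp.1 ^+ 2 - 4%:R * sp.2) + ComplexField.Normc.normc sp.1 ^+ 2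
        < 2%:R * (1 + ComplexField.Normc.normc sp.2 ^+ 2) &
     ComplexField.Normc.normc sp.2 ^+ 2 + complex.Im (conjc sp.1 * sp.2 + conjc sp.1) < 1]].

Definition agrees_with_H (R : realType) (A : set (Cx2 R))
  (phi : Cx R -> Cx R) (f : Cx2 R -> Cx2 R) : Prop :=
  forall z1 z2 : Cx R, disc z1 -> disc z2 -> A (z1 + z2, z1 * z2) ->
    f (z1 + z2, z1 * z2) = (phi z1 + phi z2, phi z1 * phi z2).

(* Main.v *)
(** Write a point of [G] as [(s, p) = (z + w, z w)] and put [u = s/2], [v = s^2/4 - p].
    The second inequality defining [G_c] holds on all of [G], and the first one reads
    [(c - 1) |z - w|^2 < 2 (1 - |z|^2) (1 - |w|^2)], which is invariant under
    automorphisms of the disc; hence every [H_phi] acts on [G_c]. With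
    [2 c r = 1 + r^2], [0 < r < 1], the domain is foliated by the images of the leaf
    [{(0, -v) : |v| < r}] under the [H_phi], each of which meets the royal disc
    [{(2z, z^2)} = {v = 0}] in one point.

    Let [f] be an automorphism. First, [f (0, 0)] cannot lie near the boundary point
    [(0, -r)] of the leaf: that point is strictly pseudoconvex, so nearby the
    infinitesimal metrics of [G_c] are asymptotic to those of a ball. The royal disc and
    the leaf, moved by [f], give two tangent vectors at [f (0, 0)], and two different
    left inverses of the royal disc, composed with the inverse of [f], give two
    covectors; applying the parallelogram law to these covectors forces
    [1 + r^2 <= 1 + o(1)]. Secondly, [f] preserves the royal disc: by the first step
    [f (2l, l^2)] is joined to the origin by a piece of bounded hyperbolic length of a
    leaf followed by a piece of the royal disc, so [v (f (2l, l^2))] tends to [0] as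
    [|l|] tends to [1] and vanishes by the maximum principle. Thirdly, composing with
    some [H_phi], we may assume that [f] fixes the royal disc pointwise. The Schwarz
    lemma then makes [f] rotate every leaf, and differentiating the equations of the
    leaves with real and with imaginary base point shows that the rotations are trivial.

    The one-variable theory is derived from complex differentiability alone: Goursat's
    theorem for rectangles in logarithmic coordinates gives the mean value property,
    hence the maximum principle and the Schwarz lemma. *)
Require Import Defs.
From HB Require Import structures.
From mathcomp Require Import all_boot all_order all_algebra.
From mathcomp Require Import complex.
From mathcomp Require Import all_classical all_reals all_analysis.
From mathcomp Require Import ring lra.
Import Order.TTheory GRing.Theory Num.Theory.
Import numFieldNormedType.Exports.
Set Implicit Arguments.
Unset Strict Implicit.
Unset Printing Implicit Defensive.
Local Open Scope ring_scope.
Local Open Scope classical_set_scope.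

(** * Goursat's theorem for rectangles *)

Section RealGoursat.
Variable R : realType.
Implicit Types (f g : R -> R) (U V : R -> R -> R).
Implicit Types (a b c d e h k l m p q s t x y : R).
Notation mu := (@lebesgue_measure R).

(** The number [r] is the smaller root of [r ^+ 2 - 2 * c * r + 1]: at [u = 0] the first inequality
    factors as [(r - |v|) * (1 - r * |v|) > 0], so the leaf is exactly [|v| < r]. The obstacle is
    that nothing is known in advance about how an automorphism moves the origin, and no boundary
    regularity is available. Comparison with a ball helps because its metric is Hermitian, and a
    Hermitian metric cannot carry the configuration at the origin: the two left inverses differ by a
    sign along the royal disc and agree along the leaf. The half difference and the half sum of
    their differentials pair to [- 1] and [- r] with vectors of length at most [1 + o(1)], so by
    Cauchy-Schwarz their squared lengths are at least [1] and [r ^+ 2] up to [o(1)], whereas the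
    parallelogram law bounds the sum by [1 + o(1)]. The excluded range depends on [c] only. It
    therefore applies to all compositions of [f] with [H_phi] at once, which gives the uniform bound
    needed on the royal disc. In the last step the rotation may vary wildly from leaf to leaf;
    equations that hold on whole leaves eliminate it. *)

Definition intR f a b : R := \int[mu]_(x in `[a, b]%classic) f x.

Definition contI f a b := forall x, a <= x <= b -> {for x, continuous f}.

Lemma contI_sub f a b a' b' : a <= a' -> b' <= b -> contI f a b -> contI f a' b'.
Proof.
move=> aa bb h x /andP[ax xb]; apply: h.
by rewrite (le_trans aa ax) (le_trans xb bb).
Qed.

Lemma contI_integrable f a b : contI f a b -> mu.-integrable `[a, b] (EFin \o f).
Proof.
move=> h; apply: continuous_compact_integrable; first exact: segment_compact.
by apply: continuous_in_subspaceT => x; rewrite inE /= in_itv /=; exact: h.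
Qed.

Lemma intR_split f a b m : contI f a b -> a <= m <= b ->
  intR f a b = intR f a m + intR f m b.
Proof.
move=> h /andP[am mb].
have := @Rintegral_itvB R f (BLeft a) (BRight b) m (contI_integrable h).
rewrite !bnd_simp => /(_ am mb) H.
rewrite /intR; apply/eqP; rewrite addrC -subr_eq; apply/eqP; rewrite H.
rewrite Rintegral_itv_obnd_cbnd //.
apply: integrableS (contI_integrable h) => //; apply: subset_itv; rewrite bnd_simp //.
Qed.

Lemma intR_B f g a b : contI f a b -> contI g a b ->
  intR (fun x => f x - g x) a b = intR f a b - intR g a b.
Proof. by move=> hf hg; rewrite /intR RintegralB //; exact: contI_integrable. Qed.

Lemma intR_cst k a b : a <= b -> intR (fun=> k) a b = k * (b - a).
Proof.
move=> ab; rewrite /intR Rintegral_cst //= lebesgue_measure_itv /= lte_fin.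
case: ltP => [//|ba].
have -> : a = b by apply/eqP; rewrite eq_le ab ba.
by rewrite subrr.
Qed.

Lemma contI_cst k a b : contI (fun=> k) a b.
Proof. move=> x _; exact: cst_continuous. Qed.

Lemma contI_B f g a b : contI f a b -> contI g a b -> contI (fun x => f x - g x) a b.
Proof. by move=> hf hg x xab; apply: continuousB; [exact: hf | exact: hg]. Qed.

Lemma intR_le f a b (M : R) : a <= b -> contI f a b -> (forall x, a <= x <= b -> f x <= M) ->
  intR f a b <= M * (b - a).
Proof.
move=> ab h hM; rewrite -(intR_cst M ab); apply: le_Rintegral => //.
- exact: contI_integrable.
- exact/contI_integrable/contI_cst.
Qed.

Lemma intR_ge f a b (M : R) : a <= b -> contI f a b -> (forall x, a <= x <= b -> M <= f x) ->
  M * (b - a) <= intR f a b.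
Proof.
move=> ab h hM; rewrite -(intR_cst M ab); apply: le_Rintegral => //.
- exact/contI_integrable/contI_cst.
- exact: contI_integrable.
Qed.

Lemma intR_near f a b (K : R) e : a <= b -> contI f a b ->
  (forall x, a <= x <= b -> `|f x - K| <= e) ->
  `|intR f a b - K * (b - a)| <= e * (b - a).
Proof.
move=> ab h hM.
have h1 : intR f a b <= (K + e) * (b - a).
  by apply: intR_le => // x /hM; rewrite ler_norml => /andP[]; lra.
have h2 : (K - e) * (b - a) <= intR f a b.
  by apply: intR_ge => // x /hM; rewrite ler_norml => /andP[]; lra.
rewrite ler_norml; apply/andP; split; lra.
Qed.

(** Total differentiability with gradient [(a, b)]. Nothing is asked of the gradient at nearby
    points, hence the bisection below in place of Green's formula. *)
Definition diffR2 U x y a b := forall e, 0 < e -> exists2 d, 0 < d &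
  forall h k, `|h| < d -> `|k| < d ->
  `|U (x + h) (y + k) - U x y - a * h - b * k| <= e * (`|h| + `|k|).

Lemma diffR2_cont U x y a b e : diffR2 U x y a b -> 0 < e -> exists2 d, 0 < d &
  forall h k, `|h| < d -> `|k| < d -> `|U (x + h) (y + k) - U x y| < e.
Proof.
move=> H e0; have [d d0 hd] := H 1 ltr01.
set K := (`|a| + `|b| + 2).
have K0 : 0 < K by rewrite /K; have := normr_ge0 a; have := normr_ge0 b; lra.
exists (Num.min d (e / (2 * K))).
  by rewrite lt_min d0 divr_gt0 // mulr_gt0.
move=> h k; rewrite !lt_min => /andP[h1 h2] /andP[k1 k2].
have := hd h k h1 k1.
set T := U _ _ - U _ _ => HT.
have : `|T| <= `|T - a * h - b * k| + `|a| * `|h| + `|b| * `|k|.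
  rewrite -!normrM.
  have -> : T = (T - a * h - b * k) + a * h + b * k by ring.
  apply: le_trans (ler_normD _ _) _; rewrite lerD2r.
  apply: le_trans (ler_normD _ _) _; rewrite lerD2r.
  by have -> : T - a * h - b * k + a * h + b * k - a * h - b * k = T - a * h - b * k by ring.
move=> HT2.
have E : e / (2 * K) * (2 * K) = e by rewrite divfK // mulf_neq0 // ?gt_eqF.
have ha := normr_ge0 a; have hb := normr_ge0 b.
have hh := normr_ge0 h; have hk := normr_ge0 k.
set q := e / (2 * K) in h2 k2 E.
have q0 : 0 < q by apply: le_lt_trans h2.
have : `|a| * `|h| <= `|a| * q by apply: ler_wpM2l => //; exact: ltW.
have : `|b| * `|k| <= `|b| * q by apply: ler_wpM2l => //; exact: ltW.
rewrite /K in E; nra.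
Qed.

Lemma diffR2_contx U x y a b : diffR2 U x y a b -> {for x, continuous (fun t => U t y)}.
Proof.
move=> H; apply/cvgrPdist_lt => e e0.
have [d d0 hd] := diffR2_cont H e0.
near=> t.
have := hd (t - x) 0; rewrite normr0 addr0 => /(_ _ d0).
rewrite (_ : x + (t - x) = t); last by ring.
move=> K; rewrite distrC; apply: K; rewrite distrC.
near: t; exact: (@cvgr_dist_lt _ _ _ (nbhs x) _ id x).
Unshelve. all: by end_near. Qed.

Lemma diffR2_conty U x y a b : diffR2 U x y a b -> {for y, continuous (U x)}.
Proof.
move=> H; apply/cvgrPdist_lt => e e0.
have [d d0 hd] := diffR2_cont H e0.
near=> t.
have := hd 0 (t - y); rewrite normr0 addr0 => /(_ d0).
rewrite (_ : y + (t - y) = t); last by ring.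
move=> K; rewrite distrC; apply: K; rewrite distrC.
near: t; exact: (@cvgr_dist_lt _ _ _ (nbhs y) _ id y).
Unshelve. all: by end_near. Qed.

(** One Cauchy-Riemann equation, [U_x = V_y]: the field [(U, - V)] has divergence zero at the
    point. *)
Definition div_free U V x y :=
  exists a b b', diffR2 U x y a b' /\ diffR2 V x y b a.

(** Outward flux of [(U, - V)] through the boundary of the rectangle. It is the imaginary part of
    the contour integral of [U + i V], so no complex integral has to be introduced. *)
Definition wR U V x1 x2 y1 y2 : R :=
  intR (fun y => U x2 y - U x1 y) y1 y2 - intR (fun x => V x y2 - V x y1) x1 x2.

Lemma wR_splitx U V x1 m x2 y1 y2 : x1 <= m <= x2 ->
  contI (U x1) y1 y2 -> contI (U m) y1 y2 -> contI (U x2) y1 y2 ->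
  contI (V^~ y1) x1 x2 -> contI (V^~ y2) x1 x2 ->
  wR U V x1 x2 y1 y2 = wR U V x1 m y1 y2 + wR U V m x2 y1 y2.
Proof.
move=> xm u1 um u2 v1 v2; rewrite /wR !intR_B //.
- by rewrite (intR_split v1 xm) (intR_split v2 xm); ring.
- by apply: contI_sub v2 => //; case/andP: xm.
- by apply: contI_sub v1 => //; case/andP: xm.
- by apply: contI_sub v2 => //; case/andP: xm.
- by apply: contI_sub v1 => //; case/andP: xm.
Qed.

Lemma wR_splity U V x1 x2 y1 m y2 : y1 <= m <= y2 ->
  contI (U x1) y1 y2 -> contI (U x2) y1 y2 ->
  contI (V^~ y1) x1 x2 -> contI (V^~ m) x1 x2 -> contI (V^~ y2) x1 x2 ->
  wR U V x1 x2 y1 y2 = wR U V x1 x2 y1 m + wR U V x1 x2 m y2.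
Proof.
move=> ym u1 u2 v1 vm v2; rewrite /wR !intR_B //.
- by rewrite (intR_split u1 ym) (intR_split u2 ym); ring.
- by apply: contI_sub u2 => //; case/andP: ym.
- by apply: contI_sub u1 => //; case/andP: ym.
- by apply: contI_sub u2 => //; case/andP: ym.
- by apply: contI_sub u1 => //; case/andP: ym.
Qed.

Lemma wR_split4 U V x1 (xm : R) x2 y1 (ym : R) y2 : x1 <= xm <= x2 -> y1 <= ym <= y2 ->
  (forall x, x1 <= x <= x2 -> contI (U x) y1 y2) ->
  (forall y, y1 <= y <= y2 -> contI (V^~ y) x1 x2) ->
  wR U V x1 x2 y1 y2 =
    (wR U V x1 xm y1 ym + wR U V x1 xm ym y2) +
    (wR U V xm x2 y1 ym + wR U V xm x2 ym y2).
Proof.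
move=> hx hy cU cV; have /andP[x1m xm2] := hx; have /andP[y1m ym2] := hy.
have x12 := le_trans x1m xm2; have y12 := le_trans y1m ym2.
have cU1 : contI (U x1) y1 y2 by apply: cU; rewrite lexx x12.
have cUm : contI (U xm) y1 y2 by apply: cU.
have cU2 : contI (U x2) y1 y2 by apply: cU; rewrite x12 lexx.
have cVl y : y1 <= y <= y2 -> contI (V^~ y) x1 xm.
  by move=> /cV h; exact: contI_sub h.
have cVr y : y1 <= y <= y2 -> contI (V^~ y) xm x2.
  by move=> /cV h; exact: contI_sub h.
have hy1 : y1 <= y1 <= y2 by rewrite lexx.
have hy2 : y1 <= y2 <= y2 by rewrite lexx y12.
rewrite (wR_splitx hx cU1 cUm cU2 (cV _ hy1) (cV _ hy2)).
by rewrite (wR_splity hy cU1 cUm (cVl _ hy1) (cVl _ hy) (cVl _ hy2))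
           (wR_splity hy cUm cU2 (cVr _ hy1) (cVr _ hy) (cVr _ hy2)).
Qed.

Lemma half_pow_small (L d : R) : 0 < d -> exists n, L / 2 ^+ n < d.
Proof.
move=> d0; exists (Num.bound (L / d)).
rewrite ltr_pdivrMr ?exprn_gt0 // mulrC -ltr_pdivrMr //.
exact: upper_nthrootP.
Qed.

(** Here [(a, c)] is the lower left corner of a rectangle with sides [L / 2 ^+ n] and [M / 2 ^+ n],
    and each step selects one of its quarters. The corner coordinates increase, and their suprema
    lie in every rectangle. *)
Lemma nested_squares (P : nat -> R -> R -> Prop) (L M a0 c0 : R) :
  0 < L -> 0 < M -> P 0%N a0 c0 ->
  (forall n a c, P n a c -> exists i j : bool,
     P n.+1 (a + i%:R * (L / 2 ^+ n.+1)) (c + j%:R * (M / 2 ^+ n.+1))) ->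
  exists x y, [/\ a0 <= x <= a0 + L, c0 <= y <= c0 + M &
    forall n, exists a c, [/\ P n a c, a <= x <= a + L / 2 ^+ n &
                            c <= y <= c + M / 2 ^+ n]].
Proof.
move=> L0 M0 P0 step.
(* [choice] needs a total relation, so triples outside [P] get an arbitrary quarter. *)
have /choice[q hq] : forall t : nat * R * R, exists p : bool * bool,
    P t.1.1 t.1.2 t.2 -> P t.1.1.+1 (t.1.2 + p.1%:R * (L / 2 ^+ t.1.1.+1))
                                   (t.2 + p.2%:R * (M / 2 ^+ t.1.1.+1)).
  move=> t; have [Pt|nPt] := pselect (P t.1.1 t.1.2 t.2); last by exists (true, true).
  by have [i [j H]] := step _ _ _ Pt; exists (i, j).
pose nx := fun t : nat * R * R => (t.1.1.+1, t.1.2 + (q t).1%:R * (L / 2 ^+ t.1.1.+1),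
   t.2 + (q t).2%:R * (M / 2 ^+ t.1.1.+1)).
pose s n := iter n nx (0%N, a0, c0).
have sS n : s n.+1 = nx (s n) by [].
have s1 n : (s n).1.1 = n by elim: n => [//|n ih]; rewrite sS /= ih.
have sP n : P n (s n).1.2 (s n).2.
  elim: n => [//|n ih]; rewrite sS.
  by have := hq (s n); rewrite /nx /= s1 => K; exact: K ih.
have key (N : R) (g : nat -> R) : 0 < N ->
    (forall n, exists i : bool, g n.+1 = g n + i%:R * (N / 2 ^+ n.+1)) ->
    exists x, forall n, g n <= x <= g n + N / 2 ^+ n.
  move=> N0 hg.
  have hN n : N / 2 ^+ n = N / 2 ^+ n.+1 + N / 2 ^+ n.+1.
    by rewrite exprS invfM; field; rewrite expf_neq0.
  have pN n : 0 < N / 2 ^+ n by rewrite divr_gt0 // exprn_gt0.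
  have inc : {homo g : n m / (n <= m)%N >-> n <= m}.
    apply: homo_leq => [//||n]; [by move=> x y z; exact: le_trans|].
    have [i ->] := hg n; case: i; rewrite /= ?mul1r ?mul0r ?addr0 // lerDl ltW //.
  have dec : {homo (fun n => g n + N / 2 ^+ n) : n m / (n <= m)%N >-> m <= n}.
    apply: homo_leq => [//|y x z|n]; [by move=> xy yz; exact: le_trans yz xy|].
    have [i ->] := hg n; have := pN n.+1; rewrite (hN n).
    case: i => /=; rewrite ?mul1r ?mul0r ?addr0; lra.
  have bd (n m : nat) : g n <= g m + N / 2 ^+ m.
    have := inc n (maxn n m) (leq_maxl _ _); have := dec m (maxn n m) (leq_maxr _ _).
    have := pN (maxn n m); lra.
  exists (sup (range g)) => n; apply/andP; split.
    apply: ub_le_sup; last by exists n.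
    by exists (g 0%N + N / 2 ^+ 0) => _ [m _ <-].
  by apply: ge_sup; [exists (g 0%N), 0%N | move=> _ [m _ <-]].
have [x hx] := key L (fun n => (s n).1.2) L0 (fun n => ex_intro _ (q (s n)).1
   (congr1 (fun k : nat => (s n).1.2 + _ * (L / 2 ^+ k.+1)) (s1 n))).
have [y hy] := key M (fun n => (s n).2) M0 (fun n => ex_intro _ (q (s n)).2
   (congr1 (fun k : nat => (s n).2 + _ * (M / 2 ^+ k.+1)) (s1 n))).
exists x, y; split.
- by have := hx 0%N; rewrite /= expr0 divr1.
- by have := hy 0%N; rewrite /= expr0 divr1.
- by move=> n; exists (s n).1.2, (s n).2; split.
Qed.

(** Goursat's bisection: were the flux not zero, some quarter would carry at least a fourth of it,
    at every scale. Near the limit point the affine parts of [U] and [V] have flux zero, and the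
    remainder is too small. *)
Lemma goursat_rect U V x1 x2 y1 y2 : x1 < x2 -> y1 < y2 ->
  (forall x y, x1 <= x <= x2 -> y1 <= y <= y2 -> div_free U V x y) ->
  wR U V x1 x2 y1 y2 = 0.
Proof.
move=> x12 y12 good; apply/eqP; apply: contrapT => /negP w0.
set L := x2 - x1; set M := y2 - y1.
have L0 : 0 < L by rewrite /L; lra.
have M0 : 0 < M by rewrite /M; lra.
set W := wR U V x1 x2 y1 y2 in w0.
have W0 : 0 < `|W| by rewrite normr_gt0.
have cU x a c : x1 <= x <= x2 -> y1 <= a -> c <= y2 -> contI (U x) a c.
  move=> hx ha hc t /andP[t1 t2].
  have [||p [_ [p' [h _]]]] := good x t => //; last exact: (diffR2_conty h).
  by apply/andP; split; lra.
have cV y a c : y1 <= y <= y2 -> x1 <= a -> c <= x2 -> contI (V^~ y) a c.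
  move=> hx ha hc t /andP[t1 t2].
  have [||p [p' [q [_ h]]]] := good t y => //; last exact: (diffR2_contx h).
  by apply/andP; split; lra.
pose P n a c := [/\ x1 <= a, a + L / 2 ^+ n <= x2, y1 <= c, c + M / 2 ^+ n <= y2 &
  `|W| / 4 ^+ n <= `|wR U V a (a + L / 2 ^+ n) c (c + M / 2 ^+ n)|].
have P0 : P 0%N x1 y1.
  by rewrite /P !expr0 !divr1 /L /M !subrKC; split.
have step n a c : P n a c -> exists i j : bool,
     P n.+1 (a + i%:R * (L / 2 ^+ n.+1)) (c + j%:R * (M / 2 ^+ n.+1)).
  move=> [xa ax yc cy Hw].
  set l := L / 2 ^+ n.+1; set m := M / 2 ^+ n.+1.
  have l0 : 0 < l by rewrite divr_gt0 // exprn_gt0.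
  have m0 : 0 < m by rewrite divr_gt0 // exprn_gt0.
  have hl : L / 2 ^+ n = l + l.
    by rewrite /l exprS invfM; field; rewrite expf_neq0.
  have hm : M / 2 ^+ n = m + m.
    by rewrite /m exprS invfM; field; rewrite expf_neq0.
  rewrite hl hm in ax cy Hw.
  apply: contrapT => nex.
  have small (i j : bool) :
     `|wR U V (a + i%:R * l) (a + i%:R * l + l) (c + j%:R * m) (c + j%:R * m + m)|
       < `|W| / 4 ^+ n.+1.
    rewrite ltNge; apply/negP => h; apply: nex; exists i, j.
    rewrite /P -/l -/m.
    clear -h xa ax yc cy l0 m0; split; [| | | |exact: h]; case: (i); case: (j); rewrite /= ?mul1r ?mul0r; lra.
  have e4 : `|W| / 4 ^+ n = 4 * (`|W| / 4 ^+ n.+1).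
    by rewrite exprS invfM; field; rewrite expf_neq0.
  have := small false false; have := small false true.
  have := small true false; have := small true true.
  move: Hw ax cy; rewrite e4 (addrA a l l) (addrA c m m) => Hw ax cy.
  have E : wR U V a (a + l + l) c (c + m + m) =
    (wR U V a (a + l) c (c + m) + wR U V a (a + l) (c + m) (c + m + m)) +
    (wR U V (a + l) (a + l + l) c (c + m) +
     wR U V (a + l) (a + l + l) (c + m) (c + m + m)).
    clear Hw e4 small nex; apply: wR_split4; [lra|lra| |].
      by move=> x hx; apply: cU; lra.
    by move=> y hy; apply: cV; lra.
  move: Hw; rewrite E /= !mul1r !mul0r !addr0; clear.
  set q := `|W| / _.
  set w1 := wR _ _ _ _ _ _; set w2 := wR _ _ _ _ _ _; set w3 := wR _ _ _ _ _ _.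
  set w4 := wR _ _ _ _ _ _.
  have := ler_normD (w1 + w2) (w3 + w4).
  have := ler_normD w1 w2.
  have := ler_normD w3 w4.
  by move=> h1 h2 h3 h4 h5 h6 h7 h8; lra.
have [x [y [hx hy H]]] := nested_squares L0 M0 P0 step.
have [a [b [b' [dU dV]]]] : div_free U V x y by apply: good; rewrite ?subrKC // /L /M in hx hy *; lra.
(* With this [e] the final bound [2 * e * (l + m) ^+ 2] is a quarter of the lower bound for the flux
   of the [n]-th rectangle. *)
set e := `|W| / (8 * (L + M) ^+ 2).
have e0 : 0 < e by rewrite divr_gt0 // mulr_gt0 // exprn_gt0 // addr_gt0.
have [d1 d10 hd1] := dU e e0.
have [d2 d20 hd2] := dV e e0.
have dd0 : 0 < Num.min d1 d2 by rewrite lt_min d10 d20.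
have [n hn] := half_pow_small (L + M) dd0.
have [a1 [c1 [[p1 p2 p3 p4 Hw] /andP[x3 x4] /andP[y3 y4]]]] := H n.
set l := L / 2 ^+ n in p2 x4 Hw; set m := M / 2 ^+ n in p4 y4 Hw.
have l0 : 0 < l by rewrite divr_gt0 // exprn_gt0.
have m0 : 0 < m by rewrite divr_gt0 // exprn_gt0.
have lm : l + m < Num.min d1 d2 by rewrite /l /m -mulrDl.
move: lm; rewrite lt_min => /andP[lm1 lm2].
have est (F : R -> R -> R) (p p' : R) d : l + m < d ->
    (forall h k : R, `|h| < d -> `|k| < d ->
      `|F (x + h) (y + k) - F x y - p * h - p' * k| <= e * (`|h| + `|k|)) ->
    forall s t s' t', a1 <= s <= a1 + l -> c1 <= t <= c1 + m ->
       a1 <= s' <= a1 + l -> c1 <= t' <= c1 + m ->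
      `|F s t - F s' t' - p * (s - s') - p' * (t - t')| <= 2 * e * (l + m).
  move=> lmd hd s t s' t' hs ht hs' ht'.
  have b1 q : a1 <= q <= a1 + l -> `|q - x| <= l.
    by clear -x3 x4 => hq; rewrite ler_norml; lra.
  have b2 q : c1 <= q <= c1 + m -> `|q - y| <= m.
    by clear -y3 y4 => hq; rewrite ler_norml; lra.
  have := hd (s - x) (t - y); have := hd (s' - x) (t' - y).
  rewrite !subrKC.
  have B1 := b1 _ hs; have B2 := b1 _ hs'; have B3 := b2 _ ht; have B4 := b2 _ ht'.
  have ld : l < d by clear -lmd m0; lra.
  have md : m < d by clear -lmd l0; lra.
  move=> /(_ (le_lt_trans B2 ld)) /(_ (le_lt_trans B4 md)) E1.
  move=> /(_ (le_lt_trans B1 ld)) /(_ (le_lt_trans B3 md)) E2.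
  have F1 : `|F s t - F x y - p * (s - x) - p' * (t - y)| <= e * (l + m).
    by apply: le_trans E2 _; rewrite ler_pM2l // lerD.
  have F2 : `|F s' t' - F x y - p * (s' - x) - p' * (t' - y)| <= e * (l + m).
    by apply: le_trans E1 _; rewrite ler_pM2l // lerD.
  have -> : F s t - F s' t' - p * (s - s') - p' * (t - t') =
     (F s t - F x y - p * (s - x) - p' * (t - y)) -
     (F s' t' - F x y - p * (s' - x) - p' * (t' - y)) by ring.
  by apply: le_trans (ler_normB _ _) _; clear -F1 F2; lra.
have ha0 : a1 <= a1 <= a1 + l by rewrite lexx lerDl ltW.
have ha1 : a1 <= a1 + l <= a1 + l by rewrite lexx lerDl ltW.
have hc0 : c1 <= c1 <= c1 + m by rewrite lexx lerDl ltW.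
have hc1 : c1 <= c1 + m <= c1 + m by rewrite lexx lerDl ltW.
have cU' t : a1 <= t <= a1 + l -> contI (U t) c1 (c1 + m).
  case/andP=> t1 t2; apply: cU => //.
  by rewrite (le_trans p1 t1) (le_trans t2 p2).
have cV' t : c1 <= t <= c1 + m -> contI (V^~ t) a1 (a1 + l).
  case/andP=> t1 t2; apply: cV => //.
  by rewrite (le_trans p3 t1) (le_trans t2 p4).
have I1 : `|intR (fun t => U (a1 + l) t - U a1 t) c1 (c1 + m) - a * l * (c1 + m - c1)|
    <= 2 * e * (l + m) * (c1 + m - c1).
  apply: intR_near; first by case/andP: hc0.
    by apply: contI_B; exact: cU'.
  move=> t ht.
  have := est U a b' d1 lm1 hd1 (a1 + l) t a1 t.
  move=> /(_ ha1 ht ha0 ht).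
  by congr (`|_| <= _); ring.
have I2 : `|intR (fun t => V t (c1 + m) - V t c1) a1 (a1 + l) - a * m * (a1 + l - a1)|
    <= 2 * e * (l + m) * (a1 + l - a1).
  apply: intR_near; first by case/andP: ha0.
    by apply: contI_B; exact: cV'.
  move=> t ht.
  have := est V b a d2 lm2 hd2 t (c1 + m) t c1.
  move=> /(_ ht hc1 ht hc0).
  by congr (`|_| <= _); ring.
(* The main terms [a * l * m] of the two integrals cancel because [U_x = V_y]; only the errors
   survive. *)
have hw : `|wR U V a1 (a1 + l) c1 (c1 + m)| <= 2 * e * (l + m) ^+ 2.
  rewrite /wR; set i1 := intR _ _ _ in I1 *; set i2 := intR _ _ _ in I2 *.
  have -> : i1 - i2 = (i1 - a * l * (c1 + m - c1)) - (i2 - a * m * (a1 + l - a1)) by ring.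
  apply: le_trans (ler_normB _ _) _; apply: le_trans (lerD I1 I2) _.
  by rewrite le_eqVlt; apply/orP; left; apply/eqP; ring.
have : `|W| / 4 ^+ n <= 2 * e * (l + m) ^+ 2 by apply: le_trans hw.
have -> : 2 * e * (l + m) ^+ 2 = (`|W| / 4 ^+ n) / 4.
  rewrite /e /l /m -mulrDl (_ : 4 ^+ n = (2 ^+ n) ^+ 2 :> R); last first.
    by rewrite -exprM mulnC exprM; congr (_ ^+ n); ring.
  by field; rewrite expf_neq0 // gt_eqF // addr_gt0.
have : 0 < `|W| / 4 ^+ n by rewrite divr_gt0 // exprn_gt0.
by clear; set q := `|W| / _; lra.
Qed.
End RealGoursat.

Section GoursatExceptional.
Variable R : realType.
Implicit Types (f g : R -> R) (U V : R -> R -> R).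
Implicit Types (a b c d e h k l m p q s t x y : R).

(** A square of half-side [d] around [(p, q)] has flux of order [M * d], and [goursat_rect] covers
    the other pieces. The exception serves the Schwarz lemma, where the quotient [f z / z] is known
    to be continuous at [0] but not yet differentiable. *)
Lemma goursat_rect_except U V x1 x2 y1 y2 p q (M d0 : R) : x1 < p < x2 -> y1 < q < y2 ->
  (forall x y, x1 <= x <= x2 -> y1 <= y <= y2 -> (x, y) != (p, q) -> div_free U V x y) ->
  0 < d0 ->
  (forall x y, `|x - p| <= d0 -> `|y - q| <= d0 -> `|U x y| <= M /\ `|V x y| <= M) ->
  wR U V x1 x2 y1 y2 = 0.
Proof.
move=> /andP[x1p px2] /andP[y1q qy2] good d00 bd.
have M0 : 0 <= M.
  have z (x : R) : `|x - x| <= d0 by rewrite subrr normr0 ltW.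
  by have [h _] := bd p q (z p) (z q); apply: le_trans h.
have cU x : x1 <= x <= x2 -> x != p -> contI (U x) y1 y2.
  move=> hx xp t ht.
  have [|a [_ [b [h _]]]] := good x t hx ht; last exact: (diffR2_conty h).
  by apply: contra xp => /eqP[->].
have cV y : y1 <= y <= y2 -> y != q -> contI (V^~ y) x1 x2.
  move=> hy yq t ht.
  have [|a [b [_ [_ h]]]] := good t y ht hy; last exact: (diffR2_contx h).
  by apply: contra yq => /eqP[_ ->].
have small d : 0 < d -> d <= d0 -> d < p - x1 -> d < x2 - p -> d < q - y1 ->
    d < y2 - q -> `|wR U V x1 x2 y1 y2| <= 8 * M * d.
  move=> d1 d2 d3 d4 d5 d6.
  have i1 : x1 <= p - d <= x2 by clear -d1 d3 px2; lra.
  have i2 : x1 <= p + d <= x2 by clear -d1 d4 x1p; lra.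
  have i3 : p - d <= p + d <= x2 by clear -d1 d4 x1p; lra.
  have i4 : y1 <= q - d <= y2 by clear -d1 d5 qy2; lra.
  have i5 : y1 <= q + d <= y2 by clear -d1 d6 y1q; lra.
  have i6 : q - d <= q + d <= y2 by clear -d1 d6 y1q; lra.
  have x11 : x1 <= x1 <= x2 by clear -x1p px2; lra.
  have x22 : x1 <= x2 <= x2 by clear -x1p px2; lra.
  have y11 : y1 <= y1 <= y2 by clear -y1q qy2; lra.
  have y22 : y1 <= y2 <= y2 by clear -y1q qy2; lra.
  have n1 : p - d != p by clear -d1; apply/eqP; lra.
  have n2 : p + d != p by clear -d1; apply/eqP; lra.
  have n3 : q - d != q by clear -d1; apply/eqP; lra.
  have n4 : q + d != q by clear -d1; apply/eqP; lra.
  have n5 : x1 != p by rewrite lt_eqF.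
  have n6 : x2 != p by rewrite gt_eqF.
  have n7 : y1 != q by rewrite lt_eqF.
  have n8 : y2 != q by rewrite gt_eqF.
  have cVs a b y : x1 <= a -> b <= x2 -> y1 <= y <= y2 -> y != q -> contI (V^~ y) a b.
    by move=> ha hb hy yq; apply: contI_sub ha hb _; exact: cV.
  have cUs a b x : y1 <= a -> b <= y2 -> x1 <= x <= x2 -> x != p -> contI (U x) a b.
    by move=> ha hb hy yq; apply: contI_sub ha hb _; exact: cU.
  have /andP[i1a i1b] := i1; have /andP[i2a i2b] := i2.
  have /andP[i4a i4b] := i4; have /andP[i5a i5b] := i5.
  rewrite (wR_splitx i1 (cU _ x11 n5) (cU _ i1 n1) (cU _ x22 n6) (cV _ y11 n7) (cV _ y22 n8)).
  rewrite (@wR_splitx _ U V (p - d) (p + d) x2); [|exact: i3|exact: cU|exact: cU|exact: cU|exact: cVs|exact: cVs].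
  rewrite (@wR_splity _ U V (p - d) (p + d) y1 (q - d) y2); [|exact: i4|exact: cU|exact: cU|exact: cVs|exact: cVs|exact: cVs].
  rewrite (@wR_splity _ U V (p - d) (p + d) (q - d) (q + d) y2); [|exact: i6|exact: cUs|exact: cUs|exact: cVs|exact: cVs|exact: cVs].
  have good' x y : x1 <= x <= x2 -> y1 <= y <= y2 -> x != p \/ y != q -> div_free U V x y.
    move=> hx hy h; apply: good => //; apply/eqP => -[e1 e2].
    by case: h; rewrite ?e1 ?e2 eqxx.
  rewrite (@goursat_rect _ U V x1 (p - d)); first last.
  - move=> x y /andP[h1 h2] hy; apply: good' => //; [by rewrite h1 (le_trans h2)|left].
    by apply: contraTneq h2 => ->; rewrite -ltNge; clear -d1; lra.
  - by clear -y1q qy2; lra.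
  - by clear -d3; lra.
  rewrite (@goursat_rect _ U V (p + d) x2); first last.
  - move=> x y /andP[h1 h2] hy; apply: good' => //; [by rewrite h2 (le_trans i2a)|left].
    by apply: contraTneq h1 => ->; rewrite -ltNge; clear -d1; lra.
  - by clear -y1q qy2; lra.
  - by clear -d4; lra.
  rewrite (@goursat_rect _ U V (p - d) (p + d) y1); first last.
  - move=> x y /andP[h1 h2] /andP[h3 h4]; apply: good'.
    + by rewrite (le_trans i1a) // (le_trans h2).
    + by rewrite h3 (le_trans h4).
    + by right; apply: contraTneq h4 => ->; rewrite -ltNge; clear -d1; lra.
  - by clear -d5; lra.
  - by clear -d1; lra.
  rewrite (@goursat_rect _ U V (p - d) (p + d) (q + d)); first last.
  - move=> x y /andP[h1 h2] /andP[h3 h4]; apply: good'.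
    + by rewrite (le_trans i1a) // (le_trans h2).
    + by rewrite h4 (le_trans i5a).
    + by right; apply: contraTneq h3 => ->; rewrite -ltNge; clear -d1; lra.
  - by clear -d6; lra.
  - by clear -d1; lra.
  rewrite !add0r !addr0.
  have b1 t : p - d <= t <= p + d -> `|t - p| <= d0.
    by clear -d2 => h; rewrite ler_norml; lra.
  have b2 t : q - d <= t <= q + d -> `|t - q| <= d0.
    by clear -d2 => h; rewrite ler_norml; lra.
  have pd1 : p - d <= p - d <= p + d by clear -d1; lra.
  have pd2 : p - d <= p + d <= p + d by clear -d1; lra.
  have qd1 : q - d <= q - d <= q + d by clear -d1; lra.
  have qd2 : q - d <= q + d <= q + d by clear -d1; lra.
  rewrite /wR.
  have := @intR_near _ (fun y => U (p + d) y - U (p - d) y) (q - d) (q + d) 0 (2 * M).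
  case/andP: (qd1) => _ le1; move=> /(_ le1).
  have h1 : contI (fun y : R => U (p + d) y - U (p - d) y) (q - d) (q + d).
    by apply: contI_B; exact: cUs.
  move=> /(_ h1) H1.
  have := @intR_near _ (fun x => V x (q + d) - V x (q - d)) (p - d) (p + d) 0 (2 * M).
  case/andP: (pd1) => _ le2; move=> /(_ le2).
  have h2 : contI (fun x : R => V x (q + d) - V x (q - d)) (p - d) (p + d).
    by apply: contI_B; exact: cVs.
  move=> /(_ h2) H2.
  have {}H1 : `|intR (fun y : R => U (p + d) y - U (p - d) y) (q - d) (q + d) -
       0 * (q + d - (q - d))| <= 2 * M * (q + d - (q - d)).
    apply: H1 => t ht; rewrite subr0.
    have [u1 _] := bd (p + d) t (b1 _ pd2) (b2 _ ht).
    have [u2 _] := bd (p - d) t (b1 _ pd1) (b2 _ ht).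
    by apply: le_trans (ler_normB _ _) _; clear -u1 u2; lra.
  have {}H2 : `|intR (fun x : R => V x (q + d) - V x (q - d)) (p - d) (p + d) -
       0 * (p + d - (p - d))| <= 2 * M * (p + d - (p - d)).
    apply: H2 => t ht; rewrite subr0.
    have [_ u1] := bd t (q + d) (b1 _ ht) (b2 _ qd2).
    have [_ u2] := bd t (q - d) (b1 _ ht) (b2 _ qd1).
    by apply: le_trans (ler_normB _ _) _; clear -u1 u2; lra.
  rewrite !mul0r !subr0 in H1 H2.
  by apply: le_trans (ler_normB _ _) _; clear -H1 H2; lra.
apply/eqP; apply: contrapT => /negP; rewrite -normr_gt0.
set W := `|_| => W0.
set m := Num.min d0 (Num.min (Num.min (p - x1) (x2 - p)) (Num.min (q - y1) (y2 - q))).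
have m0 : 0 < m by rewrite !lt_min d00 !subr_gt0 x1p px2 y1q qy2.
(* This keeps [8 * M * d] below [W / 2]; the summand [16] keeps the denominator positive when
   [M = 0]. *)
set d := Num.min (m / 2) (W / (16 * M + 16)).
have d1 : 0 < d.
  by rewrite lt_min !divr_gt0 //; clear -M0; lra.
have dm : d < m.
  by apply: le_lt_trans (_ : _ <= m / 2) _; [rewrite ge_min lexx|clear -m0; lra].
move: (dm); rewrite !lt_min => /andP[a1 /andP[/andP[a2 a3] /andP[a4 a5]]].
have := small d d1 (ltW a1) a2 a3 a4 a5; rewrite -/W.
have : d <= W / (16 * M + 16) by rewrite ge_min lexx orbT.
rewrite ler_pdivlMr; last by clear -M0; lra.
clear -M0 W0 d1; nra.
Qed.
End GoursatExceptional.

(** * Complex derivatives *)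

Notation nrm := (@ComplexField.Normc.normc _).
Notation Re := complex.Re.
Notation Im := complex.Im.

Section Norm.
Variable R : realType.
Implicit Types (z w : R[i]) (a b : R).

Lemma nrmM z w : nrm (z * w) = nrm z * nrm w.
Proof. exact: ComplexField.Normc.normcM. Qed.
Lemma nrmV z : nrm z^-1 = (nrm z)^-1.
Proof. exact: ComplexField.Normc.normcV. Qed.
Lemma nrm0 : nrm (0 : R[i]) = 0.
Proof. exact: ComplexField.Normc.normc0. Qed.
Lemma nrm1 : nrm (1 : R[i]) = 1.
Proof. exact: ComplexField.Normc.normc1. Qed.
Lemma nrmD z w : nrm (z + w) <= nrm z + nrm w.
Proof. exact: le_normcD. Qed.
Lemma nrmN z : nrm (- z) = nrm z.
Proof. exact: normcN. Qed.
Lemma nrmB z w : nrm (z - w) <= nrm z + nrm w.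
Proof. by rewrite -(nrmN w); exact: nrmD. Qed.
Lemma nrmBC z w : nrm (z - w) = nrm (w - z).
Proof. by rewrite -nrmN opprB. Qed.
Lemma nrmX z n : nrm (z ^+ n) = nrm z ^+ n.
Proof. by elim: n => [|n ih]; rewrite ?expr0 ?nrm1 // !exprS nrmM ih. Qed.
Lemma nrm_ge0 z : 0 <= nrm z.
Proof. by case: z => a b; exact: sqrtr_ge0. Qed.
Lemma nrm_eq0 z : (nrm z == 0) = (z == 0).
Proof.
apply/eqP/eqP => [|->]; [exact: ComplexField.Normc.eq0_normc | exact: nrm0].
Qed.
Lemma nrm_gt0 z : (0 < nrm z) = (z != 0).
Proof. by rewrite lt_neqAle nrm_ge0 andbT eq_sym nrm_eq0. Qed.
Lemma nrm2 z : nrm z ^+ 2 = Re z ^+ 2 + Im z ^+ 2.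
Proof. by case: z => a b /=; rewrite sqr_sqrtr // addr_ge0 // sqr_ge0. Qed.
Lemma nrm_conj z : nrm (conjc z) = nrm z.
Proof. by case: z => a b /=; rewrite sqrrN. Qed.
Lemma nrm_real a : nrm (a%:C)%C = `|a|.
Proof. by rewrite /= expr0n /= addr0 sqrtr_sqr. Qed.
Lemma nrm_le z (M : R) : 0 <= M -> nrm z ^+ 2 <= M ^+ 2 -> nrm z <= M.
Proof. by move=> M0; rewrite ler_pXn2r // nnegrE ?nrm_ge0. Qed.
Lemma nrm_lt z (M : R) : 0 <= M -> nrm z ^+ 2 < M ^+ 2 -> nrm z < M.
Proof. by move=> M0; rewrite ltr_pXn2r // nnegrE ?nrm_ge0. Qed.
Lemma nrm_lt1 z : (nrm z < 1) = (nrm z ^+ 2 < 1).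
Proof. by rewrite expr_lt1 // nrm_ge0. Qed.
Lemma Re_le_nrm z : `|Re z| <= nrm z.
Proof.
rewrite -(@ler_pXn2r _ 2) ?nnegrE ?normr_ge0 ?nrm_ge0 // nrm2 real_normK ?num_real //.
by rewrite lerDl sqr_ge0.
Qed.
Lemma Im_le_nrm z : `|Im z| <= nrm z.
Proof.
rewrite -(@ler_pXn2r _ 2) ?nnegrE ?normr_ge0 ?nrm_ge0 // nrm2 real_normK ?num_real //.
by rewrite lerDr sqr_ge0.
Qed.
Lemma nrm_le_ReIm z : nrm z <= `|Re z| + `|Im z|.
Proof.
apply: nrm_le; first by rewrite addr_ge0.
rewrite nrm2 sqrrD !real_normK ?num_real //.
by rewrite addrAC lerDl mulrn_wge0 // mulr_ge0.
Qed.
Lemma ReD z w : Re (z + w) = Re z + Re w. Proof. by case: z w => a b []. Qed.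
Lemma ImD z w : Im (z + w) = Im z + Im w. Proof. by case: z w => a b []. Qed.
Lemma ReN z : Re (- z) = - Re z. Proof. by case: z. Qed.
Lemma ImN z : Im (- z) = - Im z. Proof. by case: z. Qed.
Lemma ReM z w : Re (z * w) = Re z * Re w - Im z * Im w.
Proof. by case: z w => a b []. Qed.
Lemma ImM z w : Im (z * w) = Re z * Im w + Im z * Re w.
Proof. by case: z w => a b []. Qed.
Lemma ReC a : Re (a%:C)%C = a. Proof. by []. Qed.
Lemma ImC a : Im (a%:C)%C = 0. Proof. by []. Qed.
Lemma Re1 : Re (1 : R[i]) = 1. Proof. by []. Qed.
Lemma Im1 : Im (1 : R[i]) = 0. Proof. by []. Qed.
Lemma Re0 : Re (0 : R[i]) = 0. Proof. by []. Qed.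
Lemma Im0 : Im (0 : R[i]) = 0. Proof. by []. Qed.
Lemma Re_conj z : Re (conjc z) = Re z. Proof. by case: z. Qed.
Lemma Im_conj z : Im (conjc z) = - Im z. Proof. by case: z. Qed.
Lemma Re_Complex a b : Re (Complex a b) = a. Proof. by []. Qed.
Lemma Im_Complex a b : Im (Complex a b) = b. Proof. by []. Qed.
Lemma complex_ext z w : Re z = Re w -> Im z = Im w -> z = w.
Proof. by case: z w => a b [c d] /= -> ->. Qed.
End Norm.

Definition reimE := (Re1, Im1, Re0, Im0, ReD, ImD, ReN, ImN, ReM, ImM, ReC, ImC, Re_conj, Im_conj).

Section CDer.
Variable R : realType.
Local Notation C := R[i].
Implicit Types (f g : C -> C) (z w d : C).

(** Complex derivative in epsilon form with real radii. The analysis is carried out in this form;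
    [differentiable_cder] and [cder_differentiable] translate from and to [differentiable]. *)
Definition cder f z d := forall e : R, 0 < e -> exists2 dl : R, 0 < dl &
  forall h : C, nrm h < dl -> nrm (f (z + h) - f z - d * h) <= e * nrm h.

Lemma cder_cst k z : cder (fun=> k) z 0.
Proof.
move=> e e0; exists 1 => // h _; rewrite subrr mul0r subrr nrm0.
by rewrite mulr_ge0 ?nrm_ge0 // ltW.
Qed.

Lemma cder_id z : cder id z 1.
Proof.
move=> e e0; exists 1 => // h _; rewrite mul1r [z + h]addrC addrK subrr nrm0.
by rewrite mulr_ge0 ?nrm_ge0 // ltW.
Qed.

Lemma cder_eqd f z d d' : cder f z d -> d = d' -> cder f z d'.
Proof. by move=> h <-. Qed.

Lemma cder_near f g z d (r : R) : 0 < r -> (forall w, nrm (w - z) < r -> f w = g w) ->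
  cder f z d -> cder g z d.
Proof.
move=> r0 fg H e e0; have [dl dl0 h] := H e e0.
exists (Num.min r dl); first by rewrite lt_min r0 dl0.
move=> k; rewrite lt_min => /andP[k1 k2].
rewrite -!fg; [exact: h|by rewrite subrr nrm0|].
by rewrite [z + k]addrC addrK.
Qed.

Lemma cderD f g z d d' : cder f z d -> cder g z d' -> cder (fun x => f x + g x) z (d + d').
Proof.
move=> H1 H2 e e0; have e2 : 0 < e / 2 by rewrite divr_gt0.
have [d1 d10 h1] := H1 _ e2; have [d2 d20 h2] := H2 _ e2.
exists (Num.min d1 d2); first by rewrite lt_min d10 d20.
move=> h; rewrite lt_min => /andP[hd1 hd2].
have -> : e * nrm h = e / 2 * nrm h + e / 2 * nrm h by field.
apply: le_trans (lerD (h1 _ hd1) (h2 _ hd2)).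
apply: le_trans (nrmD _ _); rewrite le_eqVlt; apply/orP; left; apply/eqP; congr nrm; ring.
Qed.

Lemma cder_lip f z d : cder f z d -> exists2 dl : R, 0 < dl &
  forall h : C, nrm h < dl -> nrm (f (z + h) - f z) <= (nrm d + 1) * nrm h.
Proof.
move=> H; have [dl dl0 hd] := H 1 ltr01; exists dl => // h /hd.
have -> : f (z + h) - f z = (f (z + h) - f z - d * h) + d * h by ring.
move=> k; apply: le_trans (nrmD _ _) _; rewrite nrmM.
by rewrite mulrDl addrC lerD2l; apply: le_trans k; rewrite addrK.
Qed.

Lemma cder_cont f z d (e : R) : cder f z d -> 0 < e -> exists2 dl : R, 0 < dl &
  forall h : C, nrm h < dl -> nrm (f (z + h) - f z) < e.
Proof.
move=> /cder_lip[dl dl0 hd] e0.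
have K0 : 0 < nrm d + 1 by rewrite ltr_wpDl // nrm_ge0.
exists (Num.min dl (e / (nrm d + 1))); first by rewrite lt_min dl0 divr_gt0.
move=> h; rewrite lt_min => /andP[h1 h2]; apply: le_lt_trans (hd _ h1) _.
by rewrite mulrC -ltr_pdivlMr.
Qed.

Lemma cderM f g z d d' : cder f z d -> cder g z d' ->
  cder (fun x => f x * g x) z (d * g z + f z * d').
Proof.
move=> H1 H2 e e0.
set K := nrm d + nrm (g z) + nrm (f z) + nrm d' + 3.
have K0 : 0 < K.
  by rewrite /K; have := nrm_ge0 d; have := nrm_ge0 (g z); have := nrm_ge0 (f z);
    have := nrm_ge0 d'; clear; lra.
have e2 : 0 < e / (4 * K) by rewrite divr_gt0 // mulr_gt0.
have [d1 d10 h1] := H1 _ e2; have [d2 d20 h2] := H2 _ e2.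
have [d3 d30 h3] := cder_lip H1; have [d4 d40 h4] := cder_cont H2 e2.
exists (Num.min (Num.min d1 d2) (Num.min d3 d4)).
  by rewrite !lt_min d10 d20 d30 d40.
move=> h; rewrite !lt_min => /andP[/andP[hd1 hd2] /andP[hd3 hd4]].
have := h1 _ hd1; have := h2 _ hd2; have := h3 _ hd3; have := h4 _ hd4.
set A := f (z + h) - f z; set B := g (z + h) - g z => k4 k3 k2 k1.
have -> : f (z + h) * g (z + h) - f z * g z - (d * g z + f z * d') * h =
  (A - d * h) * g z + f z * (B - d' * h) + A * B by rewrite /A /B; ring.
have t1 : nrm ((A - d * h) * g z) <= e / (4 * K) * nrm h * nrm (g z).
  by rewrite nrmM ler_wpM2r // nrm_ge0.
have t2 : nrm (f z * (B - d' * h)) <= nrm (f z) * (e / (4 * K) * nrm h).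
  by rewrite nrmM ler_wpM2l // nrm_ge0.
have t3 : nrm (A * B) <= (nrm d + 1) * nrm h * (e / (4 * K)).
  by rewrite nrmM ler_pM ?nrm_ge0 // ltW.
apply: le_trans (nrmD _ _) _; apply: le_trans (lerD (nrmD _ _) (lexx _)) _.
apply: le_trans (lerD (lerD t1 t2) t3) _.
have -> : e / (4 * K) * nrm h * nrm (g z) + nrm (f z) * (e / (4 * K) * nrm h) +
  (nrm d + 1) * nrm h * (e / (4 * K)) = e / (4 * K) * nrm h * (nrm (g z) + nrm (f z) + nrm d + 1).
  by ring.
have -> : e * nrm h = e / (4 * K) * nrm h * (4 * K).
  by field; rewrite gt_eqF.
apply: ler_wpM2l; first by rewrite mulr_ge0 ?nrm_ge0 // ltW.
rewrite /K; have := nrm_ge0 d; have := nrm_ge0 (g z); have := nrm_ge0 (f z).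
have := nrm_ge0 d'; clear; lra.
Qed.

Lemma cderN f z d : cder f z d -> cder (fun x => - f x) z (- d).
Proof.
move=> H; have := cderM (cder_cst (-1) z) H.
rewrite mul0r add0r mulN1r; apply: cder_near ltr01 _ => w _.
by rewrite mulN1r.
Qed.

Lemma cderB f g z d d' : cder f z d -> cder g z d' -> cder (fun x => f x - g x) z (d - d').
Proof. by move=> H1 H2; apply: cderD => //; exact: cderN. Qed.

Lemma cder_comp f g z d d' : cder g z d -> cder f (g z) d' ->
  cder (fun x => f (g x)) z (d' * d).
Proof.
move=> H1 H2 e e0.
set K := nrm d + nrm d' + 2.
have K0 : 0 < K by rewrite /K; have := nrm_ge0 d; have := nrm_ge0 d'; clear; lra.
have e2 : 0 < e / (2 * K) by rewrite divr_gt0 // mulr_gt0.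
have [d1 d10 h1] := H1 _ e2; have [d2 d20 h2] := H2 _ e2.
have [d3 d30 h3] := cder_lip H1; have [d4 d40 h4] := cder_cont H1 d20.
exists (Num.min d1 (Num.min d3 d4)).
  by rewrite !lt_min d10 d30 d40.
move=> h; rewrite !lt_min => /andP[hd1 /andP[hd3 hd4]].
have := h1 _ hd1; have := h2 _ (h4 _ hd4); have := h3 _ hd3.
set B := g (z + h) - g z => k3 k2 k1.
rewrite (_ : g z + B = g (z + h)) in k2; last by rewrite /B; ring.
have -> : f (g (z + h)) - f (g z) - d' * d * h =
  (f (g (z + h)) - f (g z) - d' * B) + d' * (B - d * h) by ring.
apply: le_trans (nrmD _ _) _; rewrite nrmM.
have t1 : nrm d' * nrm (B - d * h) <= nrm d' * (e / (2 * K) * nrm h).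
  by rewrite ler_wpM2l // nrm_ge0.
have t2 : e / (2 * K) * nrm B <= e / (2 * K) * ((nrm d + 1) * nrm h).
  by rewrite ler_wpM2l // ltW.
apply: le_trans (lerD (le_trans k2 t2) t1) _.
have -> : e / (2 * K) * ((nrm d + 1) * nrm h) + nrm d' * (e / (2 * K) * nrm h) =
  e / (2 * K) * nrm h * (nrm d + 1 + nrm d') by ring.
have -> : e * nrm h = e / (2 * K) * nrm h * (2 * K).
  by field; rewrite gt_eqF.
apply: ler_wpM2l; first by rewrite mulr_ge0 ?nrm_ge0 // ltW.
rewrite /K; have := nrm_ge0 d; have := nrm_ge0 d'; clear; lra.
Qed.

Lemma cder_inv z : z != 0 -> cder (fun x => x^-1) z (- (z ^+ 2)^-1).
Proof.
move=> z0 e e0; have nz : 0 < nrm z by rewrite nrm_gt0.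
exists (Num.min (nrm z / 2) (e * nrm z ^+ 3 / 2)).
  by rewrite lt_min !divr_gt0 // mulr_gt0 // exprn_gt0.
move=> h; rewrite lt_min => /andP[h1 h2].
have nzh : nrm z / 2 <= nrm (z + h).
  have := nrmB (z + h) h; rewrite addrK => k.
  by clear -k h1; lra.
have zh0 : z + h != 0.
  by rewrite -nrm_gt0; apply: lt_le_trans nzh; rewrite divr_gt0.
have -> : (z + h)^-1 - z^-1 - - (z ^+ 2)^-1 * h = h * h / (z ^+ 2 * (z + h)).
  by field; rewrite zh0 z0.
rewrite !nrmM nrmV nrmM nrmX -mulrA [e * _]mulrC; apply: ler_wpM2l; first exact: nrm_ge0.
rewrite ler_pdivrMr; last by rewrite mulr_gt0 ?exprn_gt0 // nrm_gt0.
apply: le_trans (ltW h2) _.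
have -> : e * nrm z ^+ 3 / 2 = nrm z ^+ 2 * (nrm z / 2) * e by field.
by rewrite [leRHS]mulrC ler_pM2r // ler_pM2l ?exprn_gt0.
Qed.

Lemma cderV f z d : cder f z d -> f z != 0 -> cder (fun x => (f x)^-1) z (- d / f z ^+ 2).
Proof.
move=> H fz; apply: cder_eqd (cder_comp H (cder_inv fz)) _.
by rewrite mulNr mulrC mulNr.
Qed.

Lemma cder_uniq f z d d' : cder f z d -> cder f z d' -> d = d'.
Proof.
move=> H1 H2; apply/eqP; rewrite -subr_eq0 -nrm_eq0; apply: contrapT => /negP k.
have n0 : 0 < nrm (d - d') by rewrite lt_neqAle eq_sym k nrm_ge0.
have e0 : 0 < nrm (d - d') / 4 by rewrite divr_gt0.
have [d1 d10 h1] := H1 _ e0; have [d2 d20 h2] := H2 _ e0.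
set m := Num.min d1 d2 / 2.
have m0 : 0 < m by rewrite divr_gt0 // lt_min d10 d20.
have mm : m < Num.min d1 d2 by clear -m0; rewrite /m in m0 *; lra.
have nm : nrm (m%:C)%C = m by rewrite nrm_real gtr0_norm.
move: (mm); rewrite lt_min => /andP[m1 m2].
have := h1 (m%:C)%C; have := h2 (m%:C)%C; rewrite nm => /(_ m2) k2 /(_ m1) k1.
have : nrm ((d - d') * (m%:C)%C) <= nrm (d - d') / 4 * m + nrm (d - d') / 4 * m.
  apply: le_trans (lerD k2 k1); apply: le_trans (nrmB _ _).
  by rewrite le_eqVlt; apply/orP; left; apply/eqP; congr nrm; ring.
rewrite nrmM nm; clear -n0 m0; nra.
Qed.
End CDer.

(** * The maximum principle *)

Section Polar.
Variable R : realType.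
Local Notation C := R[i].
Implicit Types (f g : C -> C) (z w d : C).

Lemma is_derive_eps (f : R -> R) (x d : R) : is_derive x 1 f d ->
  forall e : R, 0 < e -> exists2 dl : R, 0 < dl &
    forall h : R, `|h| < dl -> `|f (x + h) - f x - d * h| <= e * `|h|.
Proof.
move=> [/cvg_ex[/= l Hl] df] e e0.
have ld : l = d by rewrite -df; apply/esym/cvg_lim.
rewrite ld in Hl; move/cvgrPdist_le : Hl => /(_ e e0).
rewrite /dnbhs /within /= => /nbhs_ballP[dl /= dl0 H].
exists dl => // h hd; have [->|h0] := eqVneq h 0.
  by rewrite addr0 subrr mulr0 subrr normr0 mulr0.
have := H h; rewrite /ball /= sub0r normrN => /(_ hd h0).
rewrite /shift /= -ler_pdivrMr ?normr_gt0 // distrC => k.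
apply: le_trans k; rewrite -normfV -normrM le_eqVlt; apply/orP; left; apply/eqP.
by congr `|_|; rewrite /GRing.scale /= mulr1 (addrC h x); field.
Qed.

(** The exponential of [x + i y]: [x] is the logarithm of the modulus and [y] an argument. *)
Definition polE (x y : R) : C := Complex (expR x * cos y) (expR x * sin y).

Lemma Re_polE (x y : R) : Re (polE x y) = expR x * cos y. Proof. by []. Qed.
Lemma Im_polE (x y : R) : Im (polE x y) = expR x * sin y. Proof. by []. Qed.

Lemma polE_add (x y h k : R) : polE (x + h) (y + k) = polE x y * polE h k.
Proof.
by apply: complex_ext; rewrite !(reimE, Re_polE, Im_polE) expRD ?cosD ?sinD; ring.
Qed.

Lemma nrm_polE (x y : R) : nrm (polE x y) = expR x.
Proof.
rewrite /= !exprMn -mulrDr cos2Dsin2 mulr1 sqrtr_sqr ger0_norm //.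
Qed.

Lemma polE_neq0 (x y : R) : polE x y != 0.
Proof. by rewrite -nrm_gt0 nrm_polE expR_gt0. Qed.

(** The exponential has derivative [1] at [0]; [polE_add] carries this to every point. *)
Lemma polE_small (e : R) : 0 < e -> exists2 dl : R, 0 < dl &
  forall h k : R, `|h| < dl -> `|k| < dl ->
    nrm (polE h k - 1 - Complex h k) <= e * (`|h| + `|k|).
Proof.
move=> e0.
have [e1 [e10 e11 e1e]] : exists e1 : R, [/\ 0 < e1, e1 <= 1 & e1 <= e / 8].
  by exists (Num.min 1 (e / 8)); rewrite lt_min ltr01 divr_gt0 // !ge_min !lexx orbT.
have [d1 d10 h1] := is_derive_eps (is_derive_expR 0) e10.
have [d2 d20 h2] := is_derive_eps (is_derive_cos 0) e10.
have [d3 d30 h3] := is_derive_eps (is_derive_sin 0) e10.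
exists (Num.min (Num.min d1 d2) (Num.min d3 e1)).
  by rewrite !lt_min d10 d20 d30 e10.
move=> h k; rewrite !lt_min => /andP[/andP[hd1 hd2] /andP[hd3 hd4]].
move=> /andP[/andP[kd1 kd2] /andP[kd3 kd4]].
have := h1 _ hd1; have := h2 _ kd2; have := h3 _ kd3.
rewrite !add0r expR0 cos0 sin0 mul1r oppr0 mul0r !subr0 addr0 mul1r.
set E := expR h; set c := cos k; set s := sin k => H3 H2 H1.
apply: le_trans (nrm_le_ReIm _) _; rewrite !(reimE, Re_polE, Im_polE) !(Re_Complex, Im_Complex) -/E -/c -/s.
rewrite (_ : E * c - 1 - h = (E - 1 - h) + E * (c - 1)); last by ring.
rewrite (_ : E * s - 0 - k = (s - k) + (E - 1) * s); last by ring.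
have nh := normr_ge0 h; have nk := normr_ge0 k.
have E1 : `|E - 1| <= 2 * `|h|.
  rewrite (_ : E - 1 = (E - 1 - h) + h); last by ring.
  apply: le_trans (ler_normD _ _) _; have K := ler_piMl nh e11; clear -H1 K; lra.
have s1 : `|s| <= 2 * `|k|.
  rewrite (_ : s = (s - k) + k); last by ring.
  apply: le_trans (ler_normD _ _) _; have K := ler_piMl nk e11; clear -H3 K; lra.
have E2 : `|E| <= 3.
  rewrite (_ : E = (E - 1) + 1); last by ring.
  apply: le_trans (ler_normD _ _) _; rewrite normr1.
  apply: le_trans (lerD E1 (lexx _)) _; clear -hd4 e11; lra.
have t1 : `|E - 1 - h + E * (c - 1)| <= e1 * `|h| + 3 * (e1 * `|k|).
  apply: le_trans (ler_normD _ _) _; rewrite normrM lerD //.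
  by apply: ler_pM.
have t2 : `|s - k + (E - 1) * s| <= e1 * `|k| + 2 * `|h| * (2 * `|k|).
  apply: le_trans (ler_normD _ _) _; rewrite normrM lerD //.
  by apply: ler_pM.
apply: le_trans (lerD t1 t2) _.
have q1 : `|h| * `|k| <= e1 * `|k| by rewrite ler_wpM2r // ltW.
have q2 : e1 * `|k| <= e / 8 * `|k| by rewrite ler_wpM2r.
have q3 : e1 * `|h| <= e / 8 * `|h| by rewrite ler_wpM2r.
have q4 : 0 <= e * `|h| by rewrite mulr_ge0 // ltW.
clear -q1 q2 q3 q4; lra.
Qed.

Lemma Complex_nrm_le (h k : R) : nrm (Complex h k) <= `|h| + `|k|.
Proof. exact: nrm_le_ReIm (Complex h k). Qed.

(** By the chain rule [p] is the derivative of [g] in logarithmic coordinates, and the two gradients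
    are its Cauchy-Riemann equations. They provide [div_free]. *)
Lemma cder_polE g (x y : R) d (p := d * polE x y) : cder g (polE x y) d ->
  diffR2 (fun a b => Re (g (polE a b))) x y (Re p) (- Im p) /\
  diffR2 (fun a b => Im (g (polE a b))) x y (Im p) (Re p).
Proof.
move=> H.
suff key (e : R) : 0 < e -> exists2 dl : R, 0 < dl & forall h k : R, `|h| < dl -> `|k| < dl ->
    nrm (g (polE (x + h) (y + k)) - g (polE x y) - p * Complex h k) <= e * (`|h| + `|k|).
  split=> e e0; have [dl dl0 hd] := key e e0; exists dl => // h k h1 k1;
    apply: le_trans (hd h k h1 k1).
    apply: le_trans (Re_le_nrm _); rewrite !reimE [Re (Complex _ _)]/= [Im (Complex _ _)]/=.
    by rewrite le_eqVlt; apply/orP; left; apply/eqP; congr `|_|; ring.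
  apply: le_trans (Im_le_nrm _); rewrite !reimE [Re (Complex _ _)]/= [Im (Complex _ _)]/=.
  by rewrite le_eqVlt; apply/orP; left; apply/eqP; congr `|_|; ring.
move=> e0.
set E := polE x y in p H *.
set K := nrm E + nrm p + 1.
have K0 : 0 < K by rewrite /K; have := nrm_ge0 E; have := nrm_ge0 p; clear; lra.
have e1 : 0 < e / (4 * K) by rewrite divr_gt0 // mulr_gt0.
have [d1 d10 h1] := H _ e1.
have e2 : 0 < Num.min 1 (e / (4 * K)) by rewrite lt_min ltr01.
have [d2 d20 h2] := polE_small e2.
exists (Num.min d2 (d1 / (4 * K))).
  by rewrite lt_min d20 divr_gt0 // mulr_gt0.
move=> h k; rewrite !lt_min => /andP[hd1 hd2] /andP[kd1 kd2].
have := h2 _ _ hd1 kd1.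
set r := polE h k - 1 - Complex h k => Hr.
have nh := normr_ge0 h; have nk := normr_ge0 k.
have hk0 : 0 <= `|h| + `|k| by rewrite addr_ge0.
have Hr1 : nrm r <= `|h| + `|k|.
  by apply: le_trans Hr _; rewrite -[leRHS]mul1r ler_wpM2r // ge_min lexx.
have Hr2 : nrm r <= e / (4 * K) * (`|h| + `|k|).
  by apply: le_trans Hr _; rewrite ler_wpM2r // ge_min lexx orbT.
set H' := E * (Complex h k + r).
have eH : polE (x + h) (y + k) = E + H'.
  by rewrite polE_add -/E /H' /r; ring.
have nH : nrm H' <= nrm E * (2 * (`|h| + `|k|)).
  rewrite /H' nrmM ler_wpM2l ?nrm_ge0 //; apply: le_trans (nrmD _ _) _.
  have := Complex_nrm_le h k; clear -Hr1; lra.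
have nH1 : nrm H' < d1.
  apply: le_lt_trans nH _.
  have E0 := nrm_ge0 E.
  have : nrm E * (2 * (`|h| + `|k|)) <= K * (2 * (`|h| + `|k|)).
    apply: ler_wpM2r; first by rewrite mulr_ge0.
    by rewrite /K; have := nrm_ge0 p; clear; lra.
  move/le_lt_trans; apply.
  rewrite mulrA mulrC -ltr_pdivlMr; last by rewrite mulr_gt0.
  have -> : d1 / (K * 2) = d1 / (4 * K) + d1 / (4 * K) by field; rewrite gt_eqF.
  by rewrite ltrD.
have := h1 _ nH1; rewrite eH.
set T := g (E + H') - g E => HT.
have -> : T - p * Complex h k = (T - d * H') + p * r by rewrite /H' /p; ring.
apply: le_trans (nrmD _ _) _; rewrite nrmM.
have t1 : e / (4 * K) * nrm H' <= e / (4 * K) * (nrm E * (2 * (`|h| + `|k|))).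
  by rewrite ler_wpM2l // ltW.
have t2 : nrm p * nrm r <= nrm p * (e / (4 * K) * (`|h| + `|k|)).
  by rewrite ler_wpM2l // nrm_ge0.
apply: le_trans (lerD (le_trans HT t1) t2) _.
have -> : e / (4 * K) * (nrm E * (2 * (`|h| + `|k|))) + nrm p * (e / (4 * K) * (`|h| + `|k|)) =
  e / (4 * K) * (`|h| + `|k|) * (2 * nrm E + nrm p) by ring.
have -> : e * (`|h| + `|k|) = e / (4 * K) * (`|h| + `|k|) * (4 * K).
  by field; rewrite gt_eqF.
apply: ler_wpM2l; first by rewrite mulr_ge0 // ltW.
rewrite /K; have := nrm_ge0 E; have := nrm_ge0 p; clear; lra.
Qed.

Lemma polE_surj z : z != 0 -> exists x y : R, polE x y = z /\ - pi <= y <= pi.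
Proof.
move=> z0; have n0 : 0 < nrm z by rewrite nrm_gt0.
set a := Re z / nrm z; set b := Im z / nrm z.
have ab : a ^+ 2 + b ^+ 2 = 1.
  rewrite /a /b !exprMn -mulrDl -nrm2 exprVn mulfV //.
  by rewrite expf_neq0 // gt_eqF.
have a1 : -1 <= a <= 1.
  by rewrite -ler_norml -(@ler_pXn2r _ 2) ?nnegrE // real_normK ?num_real // expr1n -ab lerDl sqr_ge0.
have sb : sin (acos a) = `|b|.
  by rewrite sin_acos // -ab addrAC subrr add0r sqrtr_sqr.
have ca : cos (acos a) = a by have [] := acos_def a1.
have /andP[ac0 acpi] := proj1 (acos_def a1).
have pi0 := pi_ge0 R.
have lnz : expR (ln (nrm z)) = nrm z by rewrite lnK // posrE.
have [b0|b0] := leP 0 b.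
  exists (ln (nrm z)), (acos a); rewrite /polE lnz sb ca ger0_norm //.
  split; last by rewrite acpi andbT (le_trans _ ac0) // oppr_le0.
  by apply: complex_ext => /=; rewrite /a /b mulrC divfK // gt_eqF.
exists (ln (nrm z)), (- acos a); rewrite /polE lnz cosN sinN sb ca ltr0_norm // opprK.
split; last by rewrite lerN2 acpi /= (le_trans _ pi0) // oppr_le0.
by apply: complex_ext => /=; rewrite /a /b mulrC divfK // gt_eqF.
Qed.

Lemma polE_inj (x y a b : R) : `|y - b| <= pi -> polE x y = polE a b -> x = a /\ y = b.
Proof.
move=> yb E.
have xa : x = a by apply: expR_inj; rewrite -(nrm_polE x y) E nrm_polE.
split=> //; subst a.
have E1 : polE 0 (y - b) = 1.
  apply: (mulfI (polE_neq0 x b)); rewrite mulr1 -polE_add addr0 -E.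
  by congr polE; ring.
have c1 : cos (y - b) = 1 by have /(congr1 (fun z : C => Re z)) := E1; rewrite Re_polE expR0 mul1r.
have c2 : cos `|y - b| = cos 0.
  by rewrite cos0; case: ger0P; rewrite ?cosN.
have : `|y - b| = 0.
  apply: cos_inj => //; rewrite in_itv /= ?normr_ge0 ?yb //.
  by rewrite lexx pi_ge0.
by move/eqP; rewrite normr_eq0 subr_eq0 => /eqP.
Qed.
End Polar.

Section MaxPrinciple.
Variable R : realType.
Local Notation C := R[i].
Implicit Types (f g : C -> C) (z w d : C).

Definition ccont g z := forall e : R, 0 < e -> exists2 dl : R, 0 < dl &
  forall w, nrm (w - z) < dl -> nrm (g w - g z) < e.

Lemma cder_ccont g z d : cder g z d -> ccont g z.
Proof.
move=> H e e0; have [dl dl0 h] := cder_cont H e0; exists dl => // w /h.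
by rewrite subrKC.
Qed.

Lemma polE_cont (p q e : R) : 0 < e -> exists2 dl : R, 0 < dl &
  forall x y : R, `|x - p| <= dl -> `|y - q| <= dl -> nrm (polE x y - polE p q) < e.
Proof.
move=> e0; have [d1 d10 h1] := polE_small (@ltr01 R).
have E0 : 0 < nrm (polE p q) by rewrite nrm_gt0 polE_neq0.
have [d2 [d20 d2d1 d2e]] : exists d2 : R, [/\ 0 < d2, d2 < d1 & d2 * (nrm (polE p q) * 8) <= e].
  exists (Num.min (d1 / 2) (e / (nrm (polE p q) * 8))); split.
  - by rewrite lt_min !divr_gt0 // mulr_gt0.
  - by rewrite gt_min; apply/orP; left; clear -d10; lra.
  - by rewrite -ler_pdivlMr ?mulr_gt0 // ge_min lexx orbT.
exists d2 => // x y hx hy.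
have -> : polE x y = polE p q * polE (x - p) (y - q) by rewrite -polE_add !subrKC.
have -> : polE p q * polE (x - p) (y - q) - polE p q =
   polE p q * (polE (x - p) (y - q) - 1) by ring.
rewrite nrmM; set W := polE _ _ - 1.
have : nrm W <= 4 * d2.
  have := h1 (x - p) (y - q) (le_lt_trans hx d2d1) (le_lt_trans hy d2d1).
  rewrite mul1r -/W => k.
  have -> : W = (W - Complex (x - p) (y - q)) + Complex (x - p) (y - q) by ring.
  apply: le_trans (nrmD _ _) _; have k2 := Complex_nrm_le (x - p) (y - q).
  apply: le_trans (lerD k k2) _; have := lerD hx hy; set T := _ + _; clear; lra.
move=> hW; apply: le_lt_trans (_ : nrm (polE p q) * (4 * d2) < e).
  by rewrite ler_pM2l.
by clear -d2e e0; lra.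
Qed.

(* In logarithmic coordinates [0] is at infinity; [t] centres the angular window at the
   argument of the exceptional point [z0], making it interior to the rectangle. *)
Lemma mean_value g z0 (r : R) : 0 < r -> nrm z0 < r ->
  (forall z, nrm z <= r -> z != 0 -> z != z0 -> exists d, cder g z d) ->
  ccont g 0 -> ccont g z0 ->
  exists t : R, [/\ z0 = 0 -> t = 0,
    contI (fun y => Re (g (polE (ln r) y))) (t - pi) (t + pi) &
    intR (fun y => Re (g (polE (ln r) y))) (t - pi) (t + pi) = Re (g 0) * (pi + pi)].
Proof.
move=> r0 z0r hg cg0 cgz.
pose U x y := Re (g (polE x y)); pose V x y := Im (g (polE x y)).
set x2 := ln r.
have ex2 : expR x2 = r by rewrite lnK // posrE.
have pi0 := pi_gt0 R.
have good x y : x <= x2 -> polE x y != z0 -> div_free U V x y.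
  move=> hx hz; have [||d /cder_polE[h1 h2]] := hg (polE x y) _ _ hz.
  - by rewrite nrm_polE -ex2 ler_expR.
  - exact: polE_neq0.
  by exists (Re (d * polE x y)), (Im (d * polE x y)), (- Im (d * polE x y)).
have [p [t [t0 px2 wz cx1]]] : exists p t : R, [/\ z0 = 0 -> t = 0, p < x2,
   (forall x1, x1 < p -> wR U V x1 x2 (t - pi) (t + pi) = 0) &
   (forall x, x < p \/ x = x2 -> forall y, polE x y != z0)].
  (* For [z0 = 0] the exceptional point is at infinity, so [goursat_rect] suffices and [p] may be
     any number below [x2]. *)
  have [z00|z00] := eqVneq z0 0.
    exists (x2 - 1), 0; split => //; first by clear; lra.
      move=> x1 hx1; apply: goursat_rect; [clear -hx1; lra|clear -pi0; lra|].
      move=> x y /andP[_ hx] _; apply: good => //; rewrite z00; exact: polE_neq0.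
    by move=> x _ y; rewrite z00 polE_neq0.
  have [p [t [E _]]] := polE_surj z00.
  have px2 : p < x2 by rewrite -ltr_expR ex2 -(nrm_polE p t) E.
  exists p, t; split => //; [by move=> h; rewrite h eqxx in z00| |]; last first.
    move=> x hx y; apply/eqP => h.
    have : x = p by apply: expR_inj; rewrite -(nrm_polE x y) h -E nrm_polE.
    case: hx => [h1 h2|-> h2]; first by rewrite h2 ltxx in h1.
    by rewrite h2 ltxx in px2.
  move=> x1 hx1.
  have [dl dl0 hdl] := cgz 1 ltr01.
  have [d0 d00 hd0] := polE_cont p t dl0.
  apply: (@goursat_rect_except _ U V x1 x2 (t - pi) (t + pi) p t (nrm (g z0) + 1) d0) => //.
  - by rewrite hx1.
  - by clear -pi0; lra.
  - move=> x y /andP[_ hx] hy nz; apply: good => //; apply/eqP; rewrite -E => h.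
    have yt : `|y - t| <= pi by clear -hy; rewrite ler_norml; lra.
    have [e1 e2] := polE_inj yt h.
    by move: nz; rewrite e1 e2 eqxx.
  move=> x y hx hy; have := hdl (polE x y); rewrite -{1}E => /(_ (hd0 _ _ hx hy)) k.
  have {k} : nrm (g (polE x y)) <= nrm (g z0) + 1.
    have -> : g (polE x y) = g z0 + (g (polE x y) - g z0) by ring.
    by apply: le_trans (nrmD _ _) _; rewrite lerD2l ltW.
  by move=> k; split; apply: le_trans k; [exact: Re_le_nrm | exact: Im_le_nrm].
have cU x : x < p \/ x = x2 -> contI (U x) (t - pi) (t + pi).
  move=> hx y _; have [||a [_ [b [h _]]]] := good x y; last exact: (diffR2_conty h).
    by case: hx => [h|->//]; apply: ltW; exact: lt_trans h px2.
  exact: cx1.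
(* The horizontal sides cancel by periodicity, so zero flux says that the angular integral is the
   same over both circles. *)
have int_eq x1 : x1 < p -> intR (U x2) (t - pi) (t + pi) = intR (U x1) (t - pi) (t + pi).
  move=> hx1; have := wz _ hx1; rewrite /wR intR_B; [|by apply: cU; right|by apply: cU; left].
  have -> : (fun x => V x (t + pi) - V x (t - pi)) = (fun=> 0).
    apply/funext => x; rewrite /V.
    have -> : polE x (t + pi) = polE x (t - pi).
      have -> : t + pi = (t - pi) + pi *+ 2 by rewrite mulr2n; ring.
      by rewrite /polE cosD2pi sinD2pi.
    by rewrite subrr.
  rewrite intR_cst ?mul0r ?subr0; last by have := lt_trans hx1 px2; exact: ltW.
  by move/eqP; rewrite subr_eq0 => /eqP.
exists t; split => //; first by apply: cU; right.
apply/eqP; rewrite -subr_eq0 -normr_eq0; apply/eqP/le_anti; rewrite normr_ge0 andbT.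
apply/ler_addgt0Pr => e1 e10; rewrite add0r.
have pp : 0 < pi + pi :> R by rewrite addr_gt0.
have [e e0 ->] : exists2 e : R, 0 < e & e1 = e * (pi + pi).
  by exists (e1 / (pi + pi)); rewrite ?divr_gt0 // divfK // gt_eqF.
have [dl dl0 hdl] := cg0 e e0.
(* A circle so small that [g] is within [e] of [g 0] on it, and that it lies inside the one through
   the exceptional point. *)
pose x1 := Num.min (p - 1) (ln dl - 1).
have x1p : x1 < p by rewrite gt_min; apply/orP; left; clear; lra.
have x1d : expR x1 < dl.
  have Ed : expR (ln dl) = dl by rewrite lnK // posrE.
  by rewrite -[X in _ < X]Ed ltr_expR gt_min; apply/orP; right; clear; lra.
have tp : t - pi <= t + pi by clear -pi0; lra.
have -> : pi + pi = t + pi - (t - pi) :> R by ring.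
rewrite (int_eq _ x1p); apply: intR_near => // [|y _]; first by apply: cU; left.
have := hdl (polE x1 y); rewrite subr0 nrm_polE => /(_ x1d) k.
by have := le_lt_trans (Re_le_nrm _) k; rewrite reimE ReN => /ltW.
Qed.

Lemma weak_max g z0 (r M : R) : 0 < r -> nrm z0 < r ->
  (forall z, nrm z <= r -> z != 0 -> z != z0 -> exists d, cder g z d) ->
  ccont g 0 -> ccont g z0 -> (forall z, nrm z = r -> Re (g z) <= M) ->
  Re (g 0) <= M.
Proof.
move=> r0 z0r hg cg0 cgz gM; have pi0 := pi_gt0 R.
have [t [_ ct It]] := mean_value r0 z0r hg cg0 cgz.
have pp : 0 < pi + pi :> R by rewrite addr_gt0.
rewrite -(ler_pM2r pp) -It.
have -> : pi + pi = t + pi - (t - pi) :> R by ring.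
apply: intR_le => // [|y _]; first by clear -pi0; lra.
by apply: gM; rewrite nrm_polE lnK // posrE.
Qed.

(** If [f] stayed below [M - e] on an interval of length [2 * d], the integral would lose at least
    [2 * e * d]. *)
Lemma intR_eq_max (f : R -> R) (a b M : R) : contI f a b ->
  (forall x, a <= x <= b -> f x <= M) -> M * (b - a) <= intR f a b ->
  forall x, a < x < b -> f x = M.
Proof.
move=> cf fM I x /andP[ax xb].
have hx : a <= x <= b by rewrite !ltW.
apply/eqP; rewrite eq_le fM //= leNgt; apply/negP => fx.
pose e := (M - f x) / 2.
have e0 : 0 < e by rewrite divr_gt0 // subr_gt0.
have := cf x hx; move/cvgrPdist_lt => /(_ e e0) /nbhs_ballP[dl /= dl0 hdl].
have [d [d0 ddl dx db]] : exists d : R, [/\ 0 < d, d < dl, a <= x - d & x + d <= b].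
  exists (Num.min (dl / 2) (Num.min (x - a) (b - x))); split.
  - by rewrite !lt_min !subr_gt0 ax xb divr_gt0.
  - by rewrite gt_min; apply/orP; left; clear -dl0; rewrite /= in dl0; lra.
  - by rewrite lerBrDr -lerBrDl !ge_min lexx /= orbT.
  - by rewrite -lerBrDl !ge_min lexx /= !orbT.
have fd y : x - d <= y <= x + d -> f y <= M - e.
  move=> /andP[y1 y2]; have := hdl y; rewrite /ball /= => /(_ _) k.
  have {}k : `|f x - f y| < e.
    by apply: k; apply: le_lt_trans ddl; rewrite ler_norml; clear -y1 y2; lra.
  by move: k; rewrite ltr_norml /e => /andP[k1 k2]; clear -k1; lra.
have i1 : a <= x - d <= b by rewrite dx /=; clear -d0 xb; lra.
have i2 : x - d <= x + d <= b by rewrite db andbT; clear -d0; lra.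
have /andP[i1a i1b] := i1; have /andP[i2a _] := i2.
have cfb : contI f (x - d) b by apply: contI_sub cf.
have := intR_split cf i1; rewrite (intR_split cfb i2) => E.
have j1 : intR f a (x - d) <= M * (x - d - a).
  apply: intR_le => //; first by apply: contI_sub cf.
  by move=> y /andP[y1 y2]; apply: fM; rewrite y1 (le_trans y2).
have j2 : intR f (x - d) (x + d) <= (M - e) * (x + d - (x - d)).
  by apply: intR_le => //; apply: contI_sub cf.
have j3 : intR f (x + d) b <= M * (b - (x + d)).
  apply: intR_le => //; first by apply: contI_sub cf => //; rewrite (le_trans i1a).
  by move=> y /andP[y1 y2]; apply: fM; rewrite y2 (le_trans _ y1) // (le_trans i1a).
have ed : 0 < e * d by rewrite mulr_gt0.
by rewrite E in I; clear -j1 j2 j3 I ed; lra.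
Qed.

(** The mean value property and [intR_eq_max] give equality for arguments strictly between [- pi]
    and [pi]; [Im z != 0] keeps [z] off the cut along the negative real axis. *)
Lemma strong_max g (r M : R) : 0 < r ->
  (forall z, nrm z <= r -> z != 0 -> exists d, cder g z d) ->
  ccont g 0 -> (forall z, nrm z = r -> Re (g z) <= M) ->
  Re (g 0) = M -> forall z, nrm z = r -> Im z != 0 -> Re (g z) = M.
Proof.
move=> r0 hg cg0 gM g0M z zr z0.
have pi0 := pi_gt0 R.
have nr : nrm (0 : C) < r by rewrite nrm0.
have hg' w : nrm w <= r -> w != 0 -> w != 0 -> exists d, cder g w d.
  by move=> w1 w2 _; exact: hg.
have [t [/(_ erefl) -> ct It]] := mean_value r0 nr hg' cg0 cg0.
have zn0 : z != 0 by rewrite -nrm_gt0 zr.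
have [x [y [E hy]]] := polE_surj zn0.
have xr : x = ln r by apply: expR_inj; rewrite -(nrm_polE x y) E zr lnK // posrE.
rewrite -E xr; apply: (intR_eq_max ct) => //.
- by move=> s _; apply: gM; rewrite nrm_polE lnK // posrE.
- by rewrite It g0M (_ : 0 + pi - (0 - pi) = pi + pi) //; ring.
have /andP[h1 h2] := hy.
suff [n1 n2] : y != pi /\ y != - pi.
  by rewrite sub0r add0r !lt_neqAle h1 h2 n1 eq_sym n2.
by split; apply: contra z0 => /eqP h; rewrite -E Im_polE h ?sinN sinpi ?oppr0 ?mulr0.
Qed.

(** Multiplication by [conjc (g 0)] makes the value at [0] real and nonnegative, which reduces the
    modulus to the real part. *)
Lemma weak_max_nrm g z0 (r M : R) : 0 < r -> 0 <= M -> nrm z0 < r ->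
  (forall z, nrm z <= r -> z != 0 -> z != z0 -> exists d, cder g z d) ->
  ccont g 0 -> ccont g z0 -> (forall z, nrm z = r -> nrm (g z) <= M) ->
  nrm (g 0) <= M.
Proof.
move=> r0 M0 z0r hg c0 cz hM.
have [->|g0] := eqVneq (g 0) 0; first by rewrite nrm0.
have n0 : 0 < nrm (g 0) by rewrite nrm_gt0.
have cc z : ccont g z -> ccont (fun x => conjc (g 0) * g x) z.
  move=> H e e0; have e1 : 0 < e / nrm (g 0) by rewrite divr_gt0.
  have [dl dl0 h] := H _ e1; exists dl => // w /h k.
  by rewrite -mulrBr nrmM nrm_conj mulrC -ltr_pdivlMr.
have := @weak_max (fun x => conjc (g 0) * g x) z0 r (nrm (g 0) * M) r0 z0r.
have -> : Re (conjc (g 0) * g 0) = nrm (g 0) * nrm (g 0).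
  by rewrite -expr2 nrm2 !reimE; ring.
rewrite ler_pM2l //; apply => //; try exact: cc.
- move=> z z1 z2 z3; have [d hd] := hg z z1 z2 z3.
  by eexists; apply: cderM (cder_cst _ _) hd.
- move=> z /hM k; apply: le_trans (ler_norm _) _; apply: le_trans (Re_le_nrm _) _.
  by rewrite nrmM nrm_conj ler_pM2l.
Qed.
End MaxPrinciple.

(** * The Schwarz lemma *)

Section Schwarz.
Variable R : realType.
Local Notation C := R[i].
Implicit Types (f g : C -> C) (a z w d : C).

Definition mob a z : C := (z + a) / (1 + conjc a * z).

Definition holD f := forall z, nrm z < 1 -> exists d, cder f z d.

Lemma mob_den a z : nrm a < 1 -> nrm z <= 1 -> 1 + conjc a * z != 0.
Proof.
move=> a1 z1; rewrite -nrm_gt0.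
have h : nrm (conjc a * z) < 1.
  rewrite nrmM nrm_conj; apply: le_lt_trans a1.
  by rewrite ler_piMr // nrm_ge0.
have := nrmB (1 + conjc a * z) (conjc a * z); rewrite addrK nrm1; clear -h; lra.
Qed.

Lemma mob_den_num a z : nrm (1 + conjc a * z) ^+ 2 - nrm (z + a) ^+ 2 =
  (1 - nrm a ^+ 2) * (1 - nrm z ^+ 2).
Proof. by rewrite !nrm2 !reimE; ring. Qed.

Lemma mob_nrm a z : nrm a < 1 -> nrm z <= 1 ->
  1 - nrm (mob a z) ^+ 2 = (1 - nrm a ^+ 2) * (1 - nrm z ^+ 2) / nrm (1 + conjc a * z) ^+ 2.
Proof.
move=> a1 z1; have d0 := mob_den a1 z1.
rewrite /mob nrmM nrmV exprMn exprVn -mob_den_num.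
by rewrite mulrBl divff // expf_neq0 // nrm_eq0.
Qed.

Lemma mob_disc a z : nrm a < 1 -> nrm z < 1 -> nrm (mob a z) < 1.
Proof.
move=> a1 z1; rewrite nrm_lt1 -subr_gt0 mob_nrm ?ltW //.
apply: divr_gt0; first by apply: mulr_gt0; rewrite subr_gt0 -nrm_lt1.
by rewrite exprn_gt0 // nrm_gt0 mob_den // ltW.
Qed.

Lemma mob0 a : mob a 0 = a.
Proof. by rewrite /mob mulr0 addr0 add0r divr1. Qed.

Lemma mobN a : mob a (- a) = 0.
Proof. by rewrite /mob addNr mul0r. Qed.

Lemma mulc_conj a : a * conjc a = ((nrm a ^+ 2)%:C)%C.
Proof.
by apply: complex_ext; rewrite !reimE ?nrm2; ring.
Qed.

Lemma mob_den2 a : nrm a < 1 -> 1 - a * conjc a != 0.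
Proof.
move=> a1; have : 1 + conjc a * (- a) != 0 by apply: mob_den => //; rewrite nrmN ltW.
by rewrite mulrN mulrC.
Qed.

Lemma mobK a z : nrm a < 1 -> nrm z < 1 -> mob (- a) (mob a z) = z.
Proof.
move=> a1 z1; have d0 := mob_den a1 (ltW z1); have d1 := mob_den2 a1.
rewrite /mob rmorphN.
field; apply/andP; split; first exact: d0.
have E : 1 + conjc a * z + - conjc a * (z + a) = 1 - a * conjc a by ring.
by move: d1; rewrite -E.
Qed.

Lemma mobNK a z : nrm a < 1 -> nrm z < 1 -> mob a (mob (- a) z) = z.
Proof. by move=> a1 z1; rewrite -{1}(opprK a) mobK // nrmN. Qed.

Lemma cder_mob a z : nrm a < 1 -> nrm z <= 1 ->
  cder (mob a) z ((1 - a * conjc a) / (1 + conjc a * z) ^+ 2).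
Proof.
move=> a1 z1; have d0 := mob_den a1 z1.
have h1 := cderD (cder_id z) (cder_cst a z).
have h2 := cderD (cder_cst 1 z) (cderM (cder_cst (conjc a) z) (cder_id z)).
apply: cder_eqd (cderM h1 (cderV h2 d0)) _.
by field.
Qed.

Lemma ccont_comp f g z d : cder g z d -> ccont f (g z) -> ccont (fun x => f (g x)) z.
Proof.
move=> /cder_ccont H1 H2 e e0; have [d2 d20 h2] := H2 e e0.
by have [d1 d10 h1] := H1 _ d20; exists d1 => // w /h1 /h2.
Qed.

(** A Moebius map distorts the distance to the unit circle by a bounded factor. Hence circles of
    radius near [1] go into a thin annulus, as [max_boundary] requires. *)
Lemma mob_nrm_low a z : nrm a < 1 -> nrm z <= 1 ->
  1 - nrm (mob a z) ^+ 2 <= (1 + nrm a) / (1 - nrm a) * (1 - nrm z ^+ 2).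
Proof.
move=> a1 z1; rewrite mob_nrm // mulrAC.
apply: ler_wpM2r; first by rewrite subr_ge0 expr_le1 // nrm_ge0.
have d0 := mob_den a1 z1.
rewrite ler_pdivrMr ?exprn_gt0 ?nrm_gt0 //.
have h : 1 - nrm a <= nrm (1 + conjc a * z).
  have := nrmB (1 + conjc a * z) (conjc a * z); rewrite addrK nrm1 nrmM nrm_conj.
  have : nrm a * nrm z <= nrm a by rewrite ler_piMr // nrm_ge0.
  by clear; lra.
have p : 0 < 1 - nrm a by rewrite subr_gt0.
rewrite -mulrA (_ : 1 - nrm a ^+ 2 = (1 + nrm a) * (1 - nrm a)); last by ring.
rewrite ler_pM2l; last by have := nrm_ge0 a; clear; lra.
rewrite mulrC ler_pdivlMr // -expr2 ler_pXn2r ?nnegrE ?nrm_ge0 // ltW //.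
Qed.

(** The mean value property is available at [0] only; composing with [mob a] moves the value at [a]
    there. *)
Lemma max_boundary f w0 (r1 K : R) : nrm w0 < 1 -> 0 <= K -> 0 < r1 < 1 ->
  (forall z, nrm z < 1 -> z != w0 -> exists d, cder f z d) -> ccont f w0 ->
  (forall z, r1 < nrm z < 1 -> nrm (f z) <= K) ->
  forall z, nrm z < 1 -> nrm (f z) <= K.
Proof.
move=> w01 K0 /andP[r10 r11] hf cf hK a a1.
have cf' z : nrm z < 1 -> ccont f z.
  by move=> z1; have [->//|zw] := eqVneq z w0; have [d /cder_ccont] := hf z z1 zw.
have na : nrm (- a) < 1 by rewrite nrmN.
pose z0 := mob (- a) w0.
have z01 : nrm z0 < 1 by apply: mob_disc.
set k := (1 + nrm a) / (1 - nrm a).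
have k0 : 0 < k by rewrite divr_gt0 ?subr_gt0 // ltr_pwDl // nrm_ge0.
(* The circle of radius [r] must surround [z0], and its image under [mob a] must lie in the annulus
   where the bound is known. For [r = 1 - e] the latter follows from
   [k * (1 - r ^+ 2) <= 2 * k * e]. *)
have [r [r0 rl z0r kr]] : exists r : R, [/\ 0 < r, r < 1, nrm z0 < r & k * (1 - r ^+ 2) < 1 - r1 ^+ 2].
  pose e := Num.min ((1 - nrm z0) / 2) (Num.min (1 / 2) ((1 - r1 ^+ 2) / (4 * k))).
  have q0 : 0 < 1 - r1 ^+ 2 by rewrite subr_gt0 expr_lt1 // ltW.
  have e0 : 0 < e.
    rewrite !lt_min; apply/and3P; split; first by rewrite divr_gt0 // subr_gt0.
      by rewrite divr_gt0.
    by apply: divr_gt0 => //; rewrite mulr_gt0.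
  have e1 : e <= (1 - nrm z0) / 2 by rewrite ge_min lexx.
  have e2 : e <= 1 / 2 by rewrite !ge_min lexx /= orbT.
  have e3 : e <= (1 - r1 ^+ 2) / (4 * k) by rewrite !ge_min lexx /= !orbT.
  clearbody e; exists (1 - e); split; [clear -e2; lra|clear -e0; lra|clear -e1 e0 z01; lra|].
  have e4 : e * (4 * k) <= 1 - r1 ^+ 2 by rewrite -ler_pdivlMr // mulr_gt0.
  have ke : 0 < k * e by rewrite mulr_gt0.
  have kee : 0 <= k * e * e by rewrite mulr_ge0 // ltW.
  rewrite (_ : k * (1 - (1 - e) ^+ 2) = 2 * (k * e) - k * e * e); last by ring.
  by clear -q0 ke kee e4; lra.
rewrite -(mob0 a); apply: (@weak_max_nrm _ (fun z => f (mob a z)) z0 r K) => //.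
- move=> z zr _ zz0; have z1 : nrm z < 1 by apply: le_lt_trans rl.
  have [|d hd] := hf (mob a z) (mob_disc a1 z1).
    by apply: contra zz0 => /eqP h; rewrite /z0 -h mobK.
  by eexists; apply: cder_comp (cder_mob a1 (ltW z1)) hd.
- have n0 : nrm (0 : C) < 1 by rewrite nrm0.
  by apply: ccont_comp (cder_mob a1 (ltW n0)) (cf' _ (mob_disc a1 n0)).
- by apply: ccont_comp (cder_mob a1 (ltW z01)) (cf' _ (mob_disc a1 z01)).
move=> z zr; have z1 : nrm z < 1 by rewrite zr.
apply: hK; rewrite mob_disc // andbT.
have := mob_nrm_low a1 (ltW z1); rewrite zr -/k => h.
rewrite ltNge; apply/negP => h2.
have : nrm (mob a z) ^+ 2 <= r1 ^+ 2 by rewrite ler_pXn2r // nnegrE ?nrm_ge0 // ltW.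
by clear -h kr; lra.
Qed.

Definition quot f d z : C := if z == 0 then d else f z / z.

Lemma cder_quot f z d d' : z != 0 -> cder f z d' -> exists e, cder (quot f d) z e.
Proof.
move=> z0 H; have h := cderM H (cder_inv z0).
eexists; apply: cder_near h; first by rewrite -nrm_gt0 in z0; exact: z0.
move=> w wz; rewrite /quot; case: eqP wz => [->|//].
by rewrite sub0r nrmN ltxx.
Qed.

Lemma ccont_quot f d : f 0 = 0 -> cder f 0 d -> ccont (quot f d) 0.
Proof.
move=> f0 H e e0; have e2 : 0 < e / 2 by rewrite divr_gt0.
have [dl dl0 hd] := H _ e2; exists dl => // w; rewrite subr0 => /hd.
rewrite /quot eqxx; have [->|w0] := eqVneq w 0; first by rewrite subrr nrm0.
rewrite add0r f0 subr0 => h.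
have nw : 0 < nrm w by rewrite nrm_gt0.
have -> : f w / w - d = (f w - d * w) / w by field.
rewrite nrmM nrmV ltr_pdivrMr //; apply: le_lt_trans h _.
by rewrite ltr_pM2r //; clear -e0; lra.
Qed.

(** On the annulus [r < |z| < 1] the quotient is bounded by [r^-1], hence on the whole disc; then
    [r] tends to [1]. *)
Lemma schwarz_quot f d : holD f -> f 0 = 0 -> cder f 0 d ->
  (forall z, nrm z < 1 -> nrm (f z) <= 1) ->
  forall z, nrm z < 1 -> nrm (quot f d z) <= 1.
Proof.
move=> hf f0 fd f1 z z1.
have n0 : nrm (0 : C) < 1 by rewrite nrm0.
have key (r : R) : 0 < r < 1 -> nrm (quot f d z) <= r^-1.
  move=> /andP[r0 r1].
  apply: (@max_boundary _ 0 r r^-1) => //; first by rewrite invr_ge0 ltW.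
  - by rewrite r0.
  - by move=> w w1 w0; have [d' hd'] := hf w w1; apply: cder_quot hd'.
  - exact: ccont_quot.
  move=> w /andP[rw w1]; have nw : 0 < nrm w by apply: lt_trans rw.
  rewrite /quot -nrm_eq0 gt_eqF // nrmM nrmV.
  apply: le_trans (_ : 1 * (nrm w)^-1 <= _).
    by rewrite ler_pM2r ?invr_gt0 // f1.
  by rewrite mul1r lef_pV2 ?posrE // ltW.
rewrite leNgt; apply/negP => h.
have [r [hr hr2]] : exists r : R, 0 < r < 1 /\ r^-1 < nrm (quot f d z).
  set T := nrm _ in h *; have T0 : 0 < T by apply: lt_trans h.
  (* Chosen so that [r^-1] is the midpoint of [1] and [T]. *)
  exists (2 / (1 + T)); split.
    by rewrite divr_gt0 ?addr_gt0 //= ltr_pdivrMr ?addr_gt0 // mul1r; clear -h; lra.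
  by rewrite invf_div; clear -h; lra.
by have := key r hr; rewrite leNgt hr2.
Qed.

Lemma schwarz f : holD f -> f 0 = 0 -> (forall z, nrm z < 1 -> nrm (f z) <= 1) ->
  forall z, nrm z < 1 -> nrm (f z) <= nrm z.
Proof.
move=> hf f0 f1 z z1; have n0 : nrm (0 : C) < 1 by rewrite nrm0.
have [d hd] := hf 0 n0; have := schwarz_quot hf f0 hd f1 z1; rewrite /quot; case: eqP => [->|/eqP z0].
  by rewrite f0 nrm0.
by rewrite nrmM nrmV ler_pdivrMr ?nrm_gt0 // mul1r.
Qed.

Lemma schwarz_der f d : holD f -> f 0 = 0 -> cder f 0 d ->
  (forall z, nrm z < 1 -> nrm (f z) <= 1) -> nrm d <= 1.
Proof.
move=> hf f0 hd f1; have n0 : nrm (0 : C) < 1 by rewrite nrm0.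
by have := schwarz_quot hf f0 hd f1 n0; rewrite /quot eqxx.
Qed.

(** The real part of [conjc d * quot f d] attains its maximum [1] at [0], so by [strong_max] the
    function is [1] off the real axis. Real points are reached by applying this to
    [x |-> f (i * x)]. *)
Lemma schwarz_rot f d : holD f -> f 0 = 0 -> cder f 0 d ->
  (forall z, nrm z < 1 -> nrm (f z) <= 1) -> nrm d = 1 ->
  forall z, nrm z < 1 -> f z = d * z.
Proof.
move=> hf f0 hd f1 d1.
have dd : d * conjc d = 1 by rewrite mulc_conj d1 expr1n.
have n0 : nrm (0 : C) < 1 by rewrite nrm0.
suff gen g e : holD g -> g 0 = 0 -> cder g 0 e -> (forall z, nrm z < 1 -> nrm (g z) <= 1) ->
    nrm e = 1 -> forall z, nrm z < 1 -> Im z != 0 -> g z = e * z.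
  move=> z z1; have [iz|iz] := eqVneq (Im z) 0; last exact: gen.
  have [->|z0] := eqVneq z 0; first by rewrite f0 mulr0.
  pose i : C := Complex 0 1.
  have ii : i * i = -1 by apply: complex_ext; rewrite !reimE /i /=; ring.
  have ni : nrm i = 1 by rewrite /i /= expr0n expr1n add0r sqrtr1.
  have hi w : cder (fun x => i * x) w i.
    by apply: cder_eqd (cderM (cder_cst i w) (cder_id w)) _; ring.
  have := gen (fun x => f (i * x)) (d * i) _ _ _ _ _ (- i * z).
  rewrite mulrA (_ : i * - i * z = z); last by rewrite mulrN ii opprK mul1r.
  move=> -> //.
  - by rewrite mulrA -(mulrA d) mulrN ii opprK mulr1.
  - by move=> w w1; have [|e he] := hf (i * w); [by rewrite nrmM ni mul1r|exists (e * i); exact: cder_comp he].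
  - by rewrite mulr0.
  - by apply: cder_comp; [exact: hi|rewrite mulr0].
  - by move=> w w1; apply: f1; rewrite nrmM ni mul1r.
  - by rewrite nrmM d1 ni mulr1.
  - by rewrite nrmM nrmN ni mul1r.
  - by rewrite !reimE /i /= !(oppr0, mul0r, add0r) mulN1r oppr_eq0; apply: contra z0 => /eqP h; apply/eqP/complex_ext.
move=> hg g0 ge g1 e1 z z1 iz.
have ee : e * conjc e = 1 by rewrite mulc_conj e1 expr1n.
have z0 : z != 0 by apply: contra iz => /eqP ->.
have nz : 0 < nrm z by rewrite nrm_gt0.
have bq w : nrm w < 1 -> nrm (conjc e * quot g e w) <= 1.
  by move=> w1; rewrite nrmM nrm_conj e1 mul1r; apply: schwarz_quot.
have E : Re (conjc e * quot g e z) = 1.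
  apply: (@strong_max _ (fun w => conjc e * quot g e w) (nrm z)) => //.
  - move=> w wz w0; have [d' hd'] := hg w (le_lt_trans wz z1).
    by have [q hq] := cder_quot e w0 hd'; eexists; apply: cderM (cder_cst _ _) hq.
  - move=> r r0; have [dl dl0 h] := ccont_quot g0 ge r0.
    by exists dl => // w /h k; rewrite -mulrBr nrmM nrm_conj e1 mul1r.
  - move=> w wz; apply: le_trans (ler_norm _) _; apply: le_trans (Re_le_nrm _) _.
    by apply: bq; rewrite wz.
  - by rewrite /quot eqxx mulrC ee.
have E2 : conjc e * quot g e z = 1.
  set W := conjc e * _ in E *.
  have : nrm W ^+ 2 <= 1 by rewrite expr_le1 ?nrm_ge0 // bq.
  rewrite nrm2 E expr1n gerDl => h.
  apply: complex_ext; first by rewrite E.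
  by apply/eqP; rewrite -sqrf_eq0 eq_le h sqr_ge0.
have : e * (conjc e * quot g e z) = e by rewrite E2 mulr1.
by rewrite mulrA ee mul1r /quot (negbTE z0) => <-; rewrite divfK.
Qed.

Lemma schwarz_pick f z w : holD f -> (forall z, nrm z < 1 -> nrm (f z) < 1) ->
  nrm z < 1 -> nrm w < 1 -> nrm (mob (- f w) (f z)) <= nrm (mob (- w) z).
Proof.
move=> hf f1 z1 w1.
pose g x := mob (- f w) (f (mob w x)).
have fw : nrm (- f w) < 1 by rewrite nrmN f1.
have -> : mob (- f w) (f z) = g (mob (- w) z) by rewrite /g mobNK.
apply: schwarz.
- move=> x x1; have m1 := mob_disc w1 x1; have [d hd] := hf _ m1.
  have h := cder_comp (cder_mob w1 (ltW x1)) hd.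
  by eexists; apply: cder_comp h (cder_mob fw (ltW (f1 _ m1))).
- by rewrite /g mob0 /mob subrr mul0r.
- by move=> x x1; apply: ltW; apply: mob_disc => //; apply: f1; exact: mob_disc.
- by apply: mob_disc; rewrite ?nrmN.
Qed.
End Schwarz.

(** * Holomorphic maps of two variables *)

Section ComplexDerivatives.
Variable R : realType.
Local Notation C := R[i].

Definition cder2 (F : C * C -> C) (x : C * C) (a b : C) :=
  forall e : R, 0 < e -> exists2 dl : R, 0 < dl &
  forall h k : C, nrm h < dl -> nrm k < dl ->
    nrm (F (x.1 + h, x.2 + k) - F x - a * h - b * k) <= e * (nrm h + nrm k).

Lemma normCx (z : Cx R) : `|z| = (nrm z)%:C%C.
Proof. by []. Qed.

Lemma normCx2 (x : Cx2 R) : `|x| = (Num.max (nrm x.1) (nrm x.2))%:C%C.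
Proof.
rewrite prod_normE !normCx /Order.max ltcR.
by case: ifP.
Qed.

(** The norm on [Cx R] has values in [R[i]], where a positive number has zero imaginary part;
    neighbourhoods thus reduce to balls of real radius. *)
Lemma nbhsCP (P : Cx R -> Prop) (x : Cx R) :
  (\forall y \near x, P y) <-> exists2 d : R, 0 < d & forall y : C, nrm (y - x) < d -> P y.
Proof.
split=> [|[d d0 H]].
  move/nbhs_normP => [[d d'] /= d0 H].
  have /andP[/eqP d'0 {}d0] : (d' == 0) && (0 < d) by move: d0; rewrite ltcE.
  exists d => // y hy; apply: H; rewrite /= distrC normCx d'0.
  by rewrite ltcR.
apply/nbhs_normP; exists (d%:C)%C => /=; first by rewrite ltcR.
by move=> y /=; rewrite distrC normCx ltcR; exact: H.
Qed.

Lemma nbhsC2P (P : Cx2 R -> Prop) (x : Cx2 R) :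
  (\forall y \near x, P y) <-> exists2 d : R, 0 < d &
    forall h k : C, nrm h < d -> nrm k < d -> P (x.1 + h, x.2 + k).
Proof.
split=> [|[d d0 H]].
  move/nbhs_normP => [[d d'] /= d0 H].
  have /andP[/eqP d'0 {}d0] : (d' == 0) && (0 < d) by move: d0; rewrite ltcE.
  exists d => // h k hh hk; apply: H; rewrite /= distrC.
  rewrite d'0 normCx2 ltcR gt_max /= addrAC subrr add0r.
  by rewrite addrAC subrr add0r hh hk.
apply/nbhs_normP; exists (d%:C)%C => /=; first by rewrite ltcR.
move=> [y1 y2] /=; rewrite distrC; case: x H => x1 x2 /= H.
rewrite normCx2 ltcR gt_max /= => /andP[h1 h2].
by have := H _ _ h1 h2; rewrite !subrKC.
Qed.

Lemma differentiable_cder (f : Cx R -> Cx R) (z : Cx R) :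
  differentiable f z -> exists d, cder f z d.
Proof.
move=> /diff_locallyP[_ /eqaddoP H].
exists ('d f z 1) => e e0.
have e0' : 0 < (e%:C)%C by rewrite ltcR.
have /nbhsCP[d d0 hd] := H _ e0'; exists d => // h hh.
have h0 : nrm (h - 0) < d by rewrite subr0.
have K : `|f (h + z) - (f z + 'd f z h)| <= e%:C%C * `|h| := hd h h0.
have E : 'd f z h = h * 'd f z 1.
  by have := linearZ_LR ('d f z) h 1; rewrite /GRing.scale /= mulr1.
have -> : f (z + h) - f z - 'd f z 1 * h = f (h + z) - (f z + 'd f z h).
  by rewrite E (addrC h z); ring.
rewrite -lecR; apply: le_trans K _.
by rewrite rmorphM.
Qed.

Lemma differentiable_cder2 (f : Cx2 R -> Cx2 R) (x : Cx2 R) :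
  differentiable f x -> exists a b a' b',
    cder2 (fun y => (f y).1) x a b /\ cder2 (fun y => (f y).2) x a' b'.
Proof.
move=> /diff_locallyP[_ /eqaddoP H].
set D := 'd f x in H.
have DE (h k : C) : D (h, k) = (h * (D (1, 0)).1 + k * (D (0, 1)).1,
    h * (D (1, 0)).2 + k * (D (0, 1)).2).
  have -> : ((h, k) : Cx2 R) = h *: ((1, 0) : Cx2 R) + k *: ((0, 1) : Cx2 R).
    transitivity ((h * 1 + k * 0, h * 0 + k * 1) : C * C); last by [].
    by rewrite !mulr1 !mulr0 addr0 add0r.
  by rewrite linearD !linearZ.
have key (e : R) : 0 < e -> exists2 d : R, 0 < d & forall h k : C, nrm h < d -> nrm k < d ->
    Num.max (nrm ((f (x.1 + h, x.2 + k)).1 - ((f x).1 + (D (h, k)).1)))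
            (nrm ((f (x.1 + h, x.2 + k)).2 - ((f x).2 + (D (h, k)).2)))
     <= e * Num.max (nrm h) (nrm k).
  move=> e0.
  have e0' : 0 < (e%:C)%C by rewrite ltcR.
  have /nbhsC2P[d d0 hd] := H _ e0'; exists d => // h k hh hk.
  have := hd h k hh hk.
  have -> : ((0 : Cx2 R).1 + h, (0 : Cx2 R).2 + k) = (h, k) by rewrite /= !add0r.
  rewrite !normCx2 -[_ * _]rmorphM lecR => K.
  apply: le_trans K.
  have -> : (x.1 + h, x.2 + k) = (h, k) + x.
    by case: (x) => x1 x2; rewrite (addrC _ h) (addrC _ k).
  by [].
exists (D (1, 0)).1, (D (0, 1)).1, (D (1, 0)).2, (D (0, 1)).2.
split => e e0; have [d d0 hd] := key e e0; exists d => // h k hh hk;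
  have := hd h k hh hk; rewrite ge_max => /andP[h1 h2].
- apply: le_trans (le_trans h1 _).
    by rewrite DE /= le_eqVlt; apply/orP; left; apply/eqP; congr nrm; ring.
  apply: ler_wpM2l; first exact: ltW.
  by rewrite ge_max lerDl lerDr !nrm_ge0.
- apply: le_trans (le_trans h2 _).
    by rewrite DE /= le_eqVlt; apply/orP; left; apply/eqP; congr nrm; ring.
  apply: ler_wpM2l; first exact: ltW.
  by rewrite ge_max lerDl lerDr !nrm_ge0.
Qed.
End ComplexDerivatives.

Section HolomorphicMaps.
Variable R : realType.
Local Notation C := R[i].

Lemma differentiable_of_littleo (K : numFieldType) (V W : normedModType K) (f : V -> W)
  (df : {linear V -> W}) (x : V) :
  continuous df -> f \o shift x = cst (f x) + df +o_ 0 id -> differentiable f x.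
Proof.
move=> dfc H; have E := diff_unique dfc H.
by apply/diff_locallyP; rewrite E.
Qed.

Lemma cder_differentiable (f : Cx R -> Cx R) (z : Cx R) d :
  cder f z d -> differentiable f z.
Proof.
move=> H; apply: (@differentiable_of_littleo _ _ _ f (GRing.scale (d : C) : {linear Cx R -> Cx R})).
  exact: scaler_continuous.
apply/eqaddoP => -[e e'] /=; rewrite ltcE => /andP[/eqP /= -> e0].
have [dl dl0 h] := H e e0.
apply/nbhsCP; exists dl => // k; rewrite subr0 => /h K.
have -> : (Complex e 0) = (e%:C)%C by [].
rewrite !normCx -[_ * _]rmorphM lecR; apply: le_trans K.
rewrite le_eqVlt; apply/orP; left; apply/eqP; congr nrm.
rewrite /= -[LHS]/(f (k + z) - (f z + d * k)) (addrC z k); ring.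
Qed.

Definition lin2 (a b a' b' : C) (x : Cx2 R) : Cx2 R := (a * x.1 + b * x.2, a' * x.1 + b' * x.2).

Fact lin2_is_linear a b a' b' : linear (lin2 a b a' b').
Proof.
move=> k [x1 x2] [y1 y2].
transitivity ((a * (k * x1 + y1) + b * (k * x2 + y2), a' * (k * x1 + y1) + b' * (k * x2 + y2)) : C * C).
  by [].
transitivity ((k * (a * x1 + b * x2) + (a * y1 + b * y2),
   k * (a' * x1 + b' * x2) + (a' * y1 + b' * y2)) : C * C).
  by congr pair; ring.
by [].
Qed.

HB.instance Definition _ a b a' b' := GRing.isLinear.Build C (Cx2 R) (Cx2 R) _ (lin2 a b a' b')
  (lin2_is_linear a b a' b').

Lemma lin2_continuous a b a' b' : continuous (lin2 a b a' b').
Proof.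
move=> x A /nbhsC2P[d d0 hd]; apply/nbhsC2P.
pose K := nrm a + nrm b + nrm a' + nrm b' + 1.
have [[[na nb] na'] nb'] := (nrm_ge0 a, nrm_ge0 b, nrm_ge0 a', nrm_ge0 b').
have K0 : 0 < K by rewrite /K; clear -na nb na' nb'; lra.
exists (d / K); first by rewrite divr_gt0.
move=> h k hh hk.
have hh' : K * nrm h < d by rewrite mulrC -ltr_pdivlMr.
have hk' : K * nrm k < d by rewrite mulrC -ltr_pdivlMr.
have key (p q : C) : nrm p + nrm q <= K -> nrm (p * h + q * k) < d.
  move=> pq; set m := Num.max (nrm h) (nrm k).
  have m0 : 0 <= m by rewrite le_max nrm_ge0.
  apply: le_lt_trans (nrmD _ _) _; rewrite !nrmM.
  have h1 : nrm p * nrm h <= nrm p * m by rewrite ler_wpM2l ?nrm_ge0 // le_max lexx.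
  have h2 : nrm q * nrm k <= nrm q * m by rewrite ler_wpM2l ?nrm_ge0 // le_max lexx orbT.
  apply: le_lt_trans (lerD h1 h2) _; rewrite -mulrDl.
  apply: le_lt_trans (ler_wpM2r m0 pq) _.
  by rewrite /m /Num.max; case: ifP.
suff : A (lin2 a b a' b' (x.1 + h, x.2 + k)) by [].
have -> : lin2 a b a' b' (x.1 + h, x.2 + k) =
  ((lin2 a b a' b' x).1 + (a * h + b * k), (lin2 a b a' b' x).2 + (a' * h + b' * k)).
  by rewrite /lin2 /=; congr pair; ring.
by apply: hd; apply: key; rewrite /K; clear -na nb na' nb'; lra.
Qed.

Lemma cder2_differentiable (f : Cx2 R -> Cx2 R) (x : Cx2 R) a b a' b' :
  cder2 (fun y => (f y).1) x a b -> cder2 (fun y => (f y).2) x a' b' ->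
  differentiable f x.
Proof.
move=> H1 H2; apply: (@differentiable_of_littleo _ _ _ f (lin2 a b a' b' : {linear Cx2 R -> Cx2 R})).
  exact: lin2_continuous.
apply/eqaddoP => -[e e'] /=; rewrite ltcE => /andP[/eqP /= -> e0].
have e2 : 0 < e / 2 by rewrite divr_gt0.
have [d1 d10 h1] := H1 _ e2; have [d2 d20 h2] := H2 _ e2.
apply/nbhsC2P; exists (Num.min d1 d2); first by rewrite lt_min d10 d20.
move=> h k; rewrite !lt_min => /andP[hh1 hh2] /andP[hk1 hk2].
have -> : (Complex e 0) = (e%:C)%C by [].
have -> : ((0 : Cx2 R).1 + h, (0 : Cx2 R).2 + k) = (h, k) by rewrite /= !add0r.
rewrite !normCx2 -[_ * _]rmorphM lecR.
have Em (t : R) : t <= e / 2 * (nrm h + nrm k) -> t <= e * Num.max (nrm h) (nrm k).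
  move/le_trans; apply; have -> : e = e / 2 * 2 by field.
  rewrite -!mulrA; apply: ler_wpM2l; first exact: ltW.
  rewrite mulrA mulVf // mul1r.
  have m1 : nrm h <= Num.max (nrm h) (nrm k) by rewrite le_max lexx.
  have m2 : nrm k <= Num.max (nrm h) (nrm k) by rewrite le_max lexx orbT.
  by clear -m1 m2; lra.
have Ex : (h, k) + x = (x.1 + h, x.2 + k) by case: (x) => p q; rewrite (addrC _ h) (addrC _ k).
have -> : (f \o shift x - (cst (f x) + lin2 a b a' b')) (h, k) =
    f (x.1 + h, x.2 + k) - (f x + lin2 a b a' b' (h, k)) by rewrite -Ex.
rewrite ge_max.
apply/andP; split; apply: Em.
  apply: le_trans (h1 _ _ hh1 hk1); rewrite le_eqVlt; apply/orP; left; apply/eqP; congr nrm.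
  by rewrite -[LHS]/((f (x.1 + h, x.2 + k)).1 - ((f x).1 + (a * h + b * k))); ring.
apply: le_trans (h2 _ _ hh2 hk2); rewrite le_eqVlt; apply/orP; left; apply/eqP; congr nrm.
by rewrite -[LHS]/((f (x.1 + h, x.2 + k)).2 - ((f x).2 + (a' * h + b' * k))); ring.
Qed.

Implicit Types (F G : C * C -> C) (x : C * C).

Lemma cder2_cst k x : cder2 (fun=> k) x 0 0.
Proof.
move=> e e0; exists 1 => // h k' _ _; rewrite subrr !mul0r !subr0 nrm0.
by rewrite mulr_ge0 ?addr_ge0 ?nrm_ge0 // ltW.
Qed.

Lemma cder2_fst x : cder2 fst x 1 0.
Proof.
move=> e e0; exists 1 => // h k _ _; rewrite /= mul1r mul0r subr0.
have -> : x.1 + h - x.1 - h = 0 by ring.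
by rewrite nrm0 mulr_ge0 ?addr_ge0 ?nrm_ge0 // ltW.
Qed.

Lemma cder2_snd x : cder2 snd x 0 1.
Proof.
move=> e e0; exists 1 => // h k _ _; rewrite /= mul1r mul0r subr0.
have -> : x.2 + k - x.2 - k = 0 by ring.
by rewrite nrm0 mulr_ge0 ?addr_ge0 ?nrm_ge0 // ltW.
Qed.

Lemma cder2_eqd F x a b a' b' : cder2 F x a b -> a = a' -> b = b' -> cder2 F x a' b'.
Proof. by move=> H <- <-. Qed.

Lemma cder2_near F G x a b (r : R) : 0 < r ->
  (forall h k, nrm h < r -> nrm k < r -> F (x.1 + h, x.2 + k) = G (x.1 + h, x.2 + k)) ->
  cder2 F x a b -> cder2 G x a b.
Proof.
move=> r0 FG H e e0; have [dl dl0 h] := H e e0.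
exists (Num.min r dl); first by rewrite lt_min r0 dl0.
move=> p q; rewrite !lt_min => /andP[p1 p2] /andP[q1 q2].
have xE : G x = F x.
  by have := FG 0 0; rewrite nrm0 !addr0 -surjective_pairing => ->.
by rewrite -FG // xE; exact: h.
Qed.

Lemma cder2_lip F x a b : cder2 F x a b -> exists2 dl : R, 0 < dl &
  forall h k : C, nrm h < dl -> nrm k < dl ->
   nrm (F (x.1 + h, x.2 + k) - F x) <= (nrm a + nrm b + 1) * (nrm h + nrm k).
Proof.
move=> H; have [dl dl0 hd] := H 1 ltr01; exists dl => // h k h1 k1.
have := hd h k h1 k1; rewrite mul1r; set T := F _ - F x => HT.
have -> : T = (T - a * h - b * k) + (a * h + b * k) by ring.
apply: le_trans (nrmD _ _) _; apply: le_trans (lerD HT (nrmD _ _)) _.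
rewrite !nrmM; have [[[na nb] nh] nk] := (nrm_ge0 a, nrm_ge0 b, nrm_ge0 h, nrm_ge0 k).
have q1 : 0 <= nrm a * nrm k by exact: mulr_ge0.
have q2 : 0 <= nrm b * nrm h by exact: mulr_ge0.
by clear -q1 q2; lra.
Qed.

Lemma cder2_comp f F x d a b : cder2 F x a b -> cder f (F x) d ->
  cder2 (fun y => f (F y)) x (d * a) (d * b).
Proof.
move=> H1 H2 e e0.
set K := nrm a + nrm b + nrm d + 2.
have [[na nb] nd] := (nrm_ge0 a, nrm_ge0 b, nrm_ge0 d).
have K0 : 0 < K by rewrite /K; clear -na nb nd; lra.
have e2 : 0 < e / (2 * K) by rewrite divr_gt0 // mulr_gt0.
have [d1 d10 h1] := H1 _ e2; have [d2 d20 h2] := H2 _ e2.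
have [d3 d30 h3] := cder2_lip H1.
exists (Num.min d1 (Num.min d3 (d2 / (2 * K)))).
  by rewrite !lt_min d10 d30 divr_gt0 // mulr_gt0.
move=> h k; rewrite !lt_min => /andP[hd1 /andP[hd3 hd4]] /andP[kd1 /andP[kd3 kd4]].
have := h1 _ _ hd1 kd1; have := h3 _ _ hd3 kd3.
set F1 := F (_, _); set B := F1 - F x => k3 k1.
have [nh nk] := (nrm_ge0 h, nrm_ge0 k).
have nB : nrm B < d2.
  apply: le_lt_trans k3 _; apply: le_lt_trans (_ : K * (nrm h + nrm k) < d2).
    by apply: ler_wpM2r; [exact: addr_ge0 | rewrite /K; clear -nd; lra].
  rewrite mulrC -ltr_pdivlMr //.
  have -> : d2 / K = d2 / (2 * K) + d2 / (2 * K) by field; rewrite gt_eqF.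
  by rewrite ltrD.
have := h2 _ nB; rewrite (_ : F x + B = F1); last by rewrite /B; ring.
set T := f F1 - f (F x) => k2.
have -> : T - d * a * h - d * b * k = (T - d * B) + d * (B - a * h - b * k) by ring.
apply: le_trans (nrmD _ _) _; rewrite nrmM.
have t1 : nrm d * nrm (B - a * h - b * k) <= nrm d * (e / (2 * K) * (nrm h + nrm k)).
  by rewrite ler_wpM2l.
have t2 : e / (2 * K) * nrm B <= e / (2 * K) * ((nrm a + nrm b + 1) * (nrm h + nrm k)).
  by rewrite ler_wpM2l // ltW.
apply: le_trans (lerD (le_trans k2 t2) t1) _.
set s := nrm h + nrm k.
have -> : e / (2 * K) * ((nrm a + nrm b + 1) * s) + nrm d * (e / (2 * K) * s) =
  e / (2 * K) * s * (nrm a + nrm b + 1 + nrm d) by ring.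
have -> : e * s = e / (2 * K) * s * (2 * K) by field; rewrite gt_eqF.
apply: ler_wpM2l; first by rewrite mulr_ge0 ?addr_ge0 // ltW.
by rewrite /K; clear -na nb nd; lra.
Qed.

Lemma cder2D F G x a b a' b' : cder2 F x a b -> cder2 G x a' b' ->
  cder2 (fun y => F y + G y) x (a + a') (b + b').
Proof.
move=> H1 H2 e e0; have e2 : 0 < e / 2 by rewrite divr_gt0.
have [d1 d10 h1] := H1 _ e2; have [d2 d20 h2] := H2 _ e2.
exists (Num.min d1 d2); first by rewrite lt_min d10 d20.
move=> h k; rewrite !lt_min => /andP[p1 p2] /andP[q1 q2].
have := lerD (h1 _ _ p1 q1) (h2 _ _ p2 q2).
have -> : e / 2 * (nrm h + nrm k) + e / 2 * (nrm h + nrm k) = e * (nrm h + nrm k) by field.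
apply: le_trans; apply: le_trans (nrmD _ _).
by rewrite le_eqVlt; apply/orP; left; apply/eqP; congr nrm; ring.
Qed.

Lemma cder_sqr z : cder (fun w : C => w ^+ 2) z (2 * z).
Proof.
have H : cder (fun w : C => w ^+ 2) z (1 * z + z * 1) := cderM (cder_id z) (cder_id z).
by apply: cder_eqd H _; ring.
Qed.

Lemma cder2N F x a b : cder2 F x a b -> cder2 (fun y => - F y) x (- a) (- b).
Proof.
move=> H; have := cder2_comp H (cderN (cder_id (F x))).
by move/cder2_eqd; apply; rewrite mulN1r.
Qed.

Lemma cder2B F G x a b a' b' : cder2 F x a b -> cder2 G x a' b' ->
  cder2 (fun y => F y - G y) x (a - a') (b - b').
Proof. by move=> H1 H2; apply: cder2D => //; exact: cder2N. Qed.

(* The product rule follows from the chain rule by polarization. *)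
Lemma cder2M F G x a b a' b' : cder2 F x a b -> cder2 G x a' b' ->
  cder2 (fun y => F y * G y) x (a * G x + F x * a') (b * G x + F x * b').
Proof.
move=> H1 H2.
have P := cder2_comp (cder2D H1 H2) (cder_sqr _).
have M := cder2_comp (cder2B H1 H2) (cder_sqr _).
have q (w : C) : cder (fun w => 4^-1 * w) w (4^-1).
  by apply: cder_eqd (cderM (cder_cst _ w) (cder_id w)) _; rewrite mul0r mulr1 add0r.
have Q := cder2_comp (cder2B P M) (q _).
have nz : (4 : C) != 0 by rewrite pnatr_eq0.
apply: (@cder2_near _ _ x _ _ 1 ltr01 _ (cder2_eqd Q _ _)); try by field.
by move=> h k _ _; field.
Qed.

Lemma cder2V F x a b : cder2 F x a b -> F x != 0 ->
  cder2 (fun y => (F y)^-1) x (- a / F x ^+ 2) (- b / F x ^+ 2).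
Proof.
move=> H Fx; apply: cder2_eqd (cder2_comp H (cder_inv Fx)) _ _; by rewrite !mulNr mulrC.
Qed.

Lemma cder2_disc F (p q : C -> C) z a b d d' : cder2 F (p z, q z) a b ->
  cder p z d -> cder q z d' -> cder (fun w => F (p w, q w)) z (a * d + b * d').
Proof.
move=> H Hp Hq e e0.
set K := nrm d + nrm d' + nrm a + nrm b + 2.
have [[[na nb] nd] nd'] := (nrm_ge0 a, nrm_ge0 b, nrm_ge0 d, nrm_ge0 d').
have K0 : 0 < K by rewrite /K; clear -na nb nd nd'; lra.
have e2 : 0 < e / (2 * K) by rewrite divr_gt0 // mulr_gt0.
have [d0 d00 h0] := H _ e2.
have [d1 d10 h1] := Hp _ e2; have [d2 d20 h2] := Hq _ e2.
have [d3 d30 h3] := cder_lip Hp; have [d4 d40 h4] := cder_lip Hq.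
have [d5 d50 h5] := cder_cont Hp d00; have [d6 d60 h6] := cder_cont Hq d00.
exists (Num.min (Num.min d1 d2) (Num.min (Num.min d3 d4) (Num.min d5 d6))).
  by rewrite !lt_min d10 d20 d30 d40 d50 d60.
move=> h; rewrite !lt_min.
move=> /andP[/andP[i1 i2] /andP[/andP[i3 i4] /andP[i5 i6]]].
have := h0 _ _ (h5 _ i5) (h6 _ i6); have := h1 _ i1; have := h2 _ i2.
have := h3 _ i3; have := h4 _ i4; rewrite !subrKC /=.
set P := p (z + h) - p z; set Q := q (z + h) - q z; set T := F _ - F _.
move=> k4 k3 k2 k1 k0.
have -> : T - (a * d + b * d') * h =
  (T - a * P - b * Q) + (a * (P - d * h) + b * (Q - d' * h)) by ring.
apply: le_trans (nrmD _ _) _.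
apply: le_trans (lerD (lexx _) (nrmD _ _)) _; rewrite !nrmM.
have nh := nrm_ge0 h.
have s0 : 0 <= e / (2 * K) by exact: ltW.
have t0 : nrm (T - a * P - b * Q) <= e / (2 * K) * ((nrm d + 1) * nrm h + (nrm d' + 1) * nrm h).
  by apply: le_trans k0 _; apply: ler_wpM2l => //; exact: lerD.
have t1 : nrm a * nrm (P - d * h) <= nrm a * (e / (2 * K) * nrm h) by rewrite ler_wpM2l.
have t2 : nrm b * nrm (Q - d' * h) <= nrm b * (e / (2 * K) * nrm h) by rewrite ler_wpM2l.
apply: le_trans (lerD t0 (lerD t1 t2)) _.
have -> : e / (2 * K) * ((nrm d + 1) * nrm h + (nrm d' + 1) * nrm h) +
  (nrm a * (e / (2 * K) * nrm h) + nrm b * (e / (2 * K) * nrm h)) =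
  e / (2 * K) * nrm h * (nrm d + 1 + (nrm d' + 1) + nrm a + nrm b) by ring.
have -> : e * nrm h = e / (2 * K) * nrm h * (2 * K) by field; rewrite gt_eqF.
apply: ler_wpM2l; first exact: mulr_ge0.
by rewrite /K; clear -na nb nd nd'; lra.
Qed.
End HolomorphicMaps.

(** * The geometry of G_c *)

Section Geometry.
Variable R : realType.
Local Notation C := R[i].
Implicit Types (a z w d tau : C) (x : C * C) (c : R).

Lemma disc_cder (f : Cx R -> Cx R) : holo_on (@disc R) f -> holD f.
Proof. by move=> h z z1; apply: differentiable_cder; exact: h. Qed.

Lemma unit_conj tau : nrm tau = 1 -> tau * conjc tau = 1.
Proof. by move=> h; rewrite mulc_conj h expr1n. Qed.

(** Precomposition with [mob b], where [b] is the preimage of [0], gives an automorphism fixing [0].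
    Its derivative and that of its inverse have modulus at most [1] and product [1], so the equality
    case of the Schwarz lemma applies. *)
Lemma aut_disc_mob (phi : Cx R -> Cx R) : is_aut (@disc R) phi ->
  exists tau a, [/\ nrm tau = 1, nrm a < 1 & forall z, nrm z < 1 -> phi z = tau * mob a z].
Proof.
move=> [/disc_cder hphi phi1 [g [/disc_cder hg g1 gphi phig]]].
have n0 : nrm (0 : C) < 1 by rewrite nrm0.
pose b : C := g 0.
have b1 : nrm b < 1 by apply: g1.
have nb1 : nrm (- b) < 1 by rewrite nrmN.
pose F z := phi (mob b z); pose G z := mob (- b) (g z).
have mb z : nrm z < 1 -> nrm (mob b z) < 1 by exact: mob_disc.
have hF : holD F.
  move=> z z1; have [d hd] := hphi _ (mb z z1).
  by eexists; apply: cder_comp (cder_mob b1 (ltW z1)) hd.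
have hG : holD G.
  move=> z z1; have [d hd] := hg z z1.
  by eexists; apply: cder_comp hd (cder_mob nb1 (ltW (g1 z z1))).
have F1 z : nrm z < 1 -> nrm (F z) < 1 by move=> z1; exact: (phi1 _ (mb z z1)).
have G1 z : nrm z < 1 -> nrm (G z) < 1 by move=> z1; apply: mob_disc => //; exact: g1.
have F0 : F 0 = 0 by rewrite /F mob0 /b phig.
have G0 : G 0 = 0 by rewrite /G /mob subrr mul0r.
have GF z : nrm z < 1 -> G (F z) = z.
  by move=> z1; rewrite /G /F gphi ?mobK //; exact: mb.
have [d hd] := hF 0 n0; have [e he] := hG 0 n0.
have de : e * d = 1.
  apply: (@cder_uniq _ (fun z => G (F z)) 0).
    by apply: cder_comp hd _; rewrite F0.
  apply: cder_near ltr01 _ (cder_id 0) => w; rewrite subr0 => w1.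
  by rewrite GF.
have d1 : nrm d <= 1 by apply: schwarz_der hF F0 hd _ => z z1; apply: ltW; exact: F1.
have e1 : nrm e <= 1 by apply: schwarz_der hG G0 he _ => z z1; apply: ltW; exact: G1.
have nd : nrm d = 1.
  apply/eqP; rewrite eq_le d1 /= leNgt; apply/negP => dlt.
  have : nrm e * nrm d < 1.
    by apply: le_lt_trans dlt; rewrite ler_piMl // nrm_ge0.
  by rewrite -nrmM de nrm1 ltxx.
have Fd := schwarz_rot hF F0 hd (fun z (h : nrm z < 1) => ltW (F1 z h)) nd.
exists d, (- b); split => // z z1.
rewrite -Fd; last exact: mob_disc.
by rewrite /F mobNK.
Qed.

Lemma mob_unit tau a z : nrm tau = 1 -> nrm a < 1 -> nrm z < 1 ->
  conjc tau * mob (- (a * tau)) (tau * mob a z) = z.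
Proof.
move=> t1 a1 z1; have tt := unit_conj t1.
have E m : mob (- (a * tau)) (tau * m) = tau * mob (- a) m.
  rewrite /mob (_ : tau * m + - (a * tau) = tau * (m + - a)); last by ring.
  rewrite -mulrA; congr (_ * (_ / (1 + _))).
  rewrite !rmorphN rmorphM /=.
  transitivity (- conjc a * (tau * conjc tau) * m); first by ring.
  by rewrite tt mulr1.
by rewrite E mulrA (mulrC (conjc tau)) tt mul1r mobK.
Qed.

Lemma nrm_tau_mob tau a z : nrm tau = 1 -> nrm a < 1 -> nrm z < 1 -> nrm (tau * mob a z) < 1.
Proof. by move=> t1 a1 z1; rewrite nrmM t1 mul1r mob_disc. Qed.

Lemma mob_aut tau a (phi : Cx R -> Cx R) : nrm tau = 1 -> nrm a < 1 ->
  (forall z, nrm z < 1 -> phi z = tau * mob a z) -> is_aut (@disc R) phi.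
Proof.
move=> t1 a1 phiE.
have hol (t b : C) (f : Cx R -> Cx R) : nrm b < 1 -> (forall z, nrm z < 1 -> f z = t * mob b z) ->
    holo_on (@disc R) f.
  move=> b1 fE z z1.
  apply: (@cder_differentiable R f z _).
  have h := cderM (cder_cst t z) (cder_mob b1 (ltW z1)).
  apply: cder_near _ h; last first.
    move=> w wz; rewrite fE //.
    have := nrmD (w - z) z; rewrite subrK => k; apply: le_lt_trans k _.
    by rewrite -ltrBrDr; exact: wz.
  by rewrite subr_gt0.
have t1' : nrm (conjc tau) = 1 by rewrite nrm_conj.
have a1' : nrm (- (a * tau)) < 1 by rewrite nrmN nrmM t1 mulr1.
split; first exact: (hol tau a).
  by move=> z z1; rewrite /disc /= phiE //; exact: nrm_tau_mob.
exists (fun w : C => conjc tau * mob (- (a * tau)) w : C); split.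
- exact: (hol (conjc tau) (- (a * tau))).
- by move=> z z1; exact: nrm_tau_mob.
- by move=> z z1; rewrite phiE // mob_unit.
- move=> z z1; rewrite phiE; last exact: nrm_tau_mob.
  have := mob_unit t1' a1' z1.
  rewrite (_ : conjc (conjc tau) = tau); last by case: (tau) => p q; rewrite /= opprK.
  by rewrite mulNr opprK -mulrA unit_conj // mulr1.
Qed.

Definition Hden a x : C := 1 + conjc a * x.1 + conjc a ^+ 2 * x.2.

(** [H_phi] for [phi = tau * mob a], written as a rational function of [(s, p)]: holomorphy is then
    visible without choosing roots. [Hden a] is the product of the two Moebius denominators. *)
Definition Hm tau a x : C * C :=
  (tau * (x.1 * (1 + a * conjc a) + 2 * conjc a * x.2 + 2 * a) / Hden a x,
   tau ^+ 2 * (x.2 + a * x.1 + a ^+ 2) / Hden a x).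

Lemma HdenE a z w : Hden a (z + w, z * w) = (1 + conjc a * z) * (1 + conjc a * w).
Proof. rewrite /Hden /=; ring. Qed.

Lemma HmE tau a z w : nrm a < 1 -> nrm z < 1 -> nrm w < 1 ->
  Hm tau a (z + w, z * w) =
    (tau * mob a z + tau * mob a w, tau * mob a z * (tau * mob a w)).
Proof.
move=> a1 z1 w1; have d1 := mob_den a1 (ltW z1); have d2 := mob_den a1 (ltW w1).
rewrite /Hm HdenE /mob /=; congr pair; field; by apply/andP.
Qed.

Lemma mobB a z w : nrm a < 1 -> nrm z < 1 -> nrm w < 1 ->
  mob a z - mob a w = (z - w) * (1 - a * conjc a) / ((1 + conjc a * z) * (1 + conjc a * w)).
Proof.
move=> a1 z1 w1; have d1 := mob_den a1 (ltW z1); have d2 := mob_den a1 (ltW w1).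
by rewrite /mob; field; apply/andP.
Qed.

(** This bounds [rho ^+ 2 / (1 - rho ^+ 2)], where [rho] is the pseudohyperbolic distance of [z] and
    [w]; hence the invariance in [tube_mob]. *)
Definition tube c z w : Prop :=
  (c - 1) * nrm (z - w) ^+ 2 < 2 * ((1 - nrm z ^+ 2) * (1 - nrm w ^+ 2)).

Lemma nrm_1B a : nrm a < 1 -> nrm (1 - a * conjc a) = 1 - nrm a ^+ 2.
Proof.
move=> a1; rewrite mulc_conj -[1]/((1%:C)%C) -rmorphB nrm_real ger0_norm //.
by rewrite subr_ge0 expr_le1 ?nrm_ge0 // ltW.
Qed.

Lemma tube_mob c tau a z w : nrm tau = 1 -> nrm a < 1 -> nrm z < 1 -> nrm w < 1 ->
  tube c z w -> tube c (tau * mob a z) (tau * mob a w).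
Proof.
move=> t1 a1 z1 w1; have d1 := mob_den a1 (ltW z1); have d2 := mob_den a1 (ltW w1).
rewrite /tube -mulrBr !(nrmM tau) t1 !mul1r !mob_nrm ?ltW // mobB //.
rewrite (nrmM _ (_^-1)) (nrmM (z - w)) nrmV nrmM nrm_1B //.
rewrite -nrm_gt0 in d1; rewrite -nrm_gt0 in d2.
set D1 := nrm (1 + _ * z) in d1 *; set D2 := nrm (1 + _ * w) in d2 *.
move=> H; rewrite -subr_gt0.
set T := _ - _.
have -> : T = (1 - nrm a ^+ 2) ^+ 2 / (D1 * D2) ^+ 2 *
  (2 * ((1 - nrm z ^+ 2) * (1 - nrm w ^+ 2)) - (c - 1) * nrm (z - w) ^+ 2).
  by rewrite /T; field; rewrite !gt_eqF.
rewrite mulr_gt0 ?subr_gt0 // divr_gt0 // exprn_gt0 ?mulr_gt0 //.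
by rewrite subr_gt0 -nrm_lt1.
Qed.

Lemma nrm_sqr_sum z w : nrm (z - w) ^+ 2 + nrm (z + w) ^+ 2 =
   2 * (nrm z ^+ 2 + nrm w ^+ 2).
Proof. by rewrite !nrm2 !reimE; ring. Qed.

(** The factorization shows that a point of the symmetrized bidisc satisfies
    [|conj s * p - s| < 1 - |p|^2]. This yields the second inequality of [Gc]. *)
Lemma sym_dist z w :
  (1 - nrm (z * w) ^+ 2) ^+ 2 - nrm (conjc (z + w) * (z * w) - (z + w)) ^+ 2
   = (1 - nrm z ^+ 2) * (1 - nrm w ^+ 2) * nrm (1 - conjc z * w) ^+ 2.
Proof. by rewrite !nrmM !exprMn !nrm2 !reimE; ring. Qed.

Lemma GcP c x : Gc c x <-> exists z w, [/\ nrm z < 1, nrm w < 1, x = (z + w, z * w) & tube c z w].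
Proof.
have key z w : (c * nrm ((z + w) ^+ 2 - 4 * (z * w)) + nrm (z + w) ^+ 2 <
    2 * (1 + nrm (z * w) ^+ 2)) = ((c - 1) * nrm (z - w) ^+ 2 < 2 * ((1 - nrm z ^+ 2) * (1 - nrm w ^+ 2))).
  rewrite -subr_gt0 -[RHS]subr_gt0; congr (0 < _).
  rewrite (_ : (z + w) ^+ 2 - 4 * (z * w) = (z - w) ^+ 2); last by ring.
  rewrite nrmX nrmM exprMn.
  have := nrm_sqr_sum z w; set A := nrm (z - w) ^+ 2; set B := nrm (z + w) ^+ 2.
  by move=> h; rewrite (_ : B = 2 * (nrm z ^+ 2 + nrm w ^+ 2) - A); [ring|rewrite -h; ring].
split.
  move=> [[z [w [z1 w1 ->]]] /= h _]; exists z, w; split => //.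
  by move: h; rewrite key.
move=> [z [w [z1 w1 -> h]]]; split; first by exists z, w.
  by rewrite /= key.
rewrite /=.
set p := z * w; set s := z + w.
have p1 : nrm p < 1.
  rewrite nrmM; apply: le_lt_trans z1; rewrite ler_piMr ?nrm_ge0 // ltW //.
(* [conjc s] and [- s] have the same imaginary part, which brings in the quantity of [sym_dist]. *)
have -> : Im (conjc s * p + conjc s) = Im (conjc s * p - s).
  by rewrite !reimE; ring.
rewrite addrC -ltrBrDr; apply: le_lt_trans (ler_norm _) _.
apply: le_lt_trans (Im_le_nrm _) _.
have d0 : 1 + conjc (- z) * w != 0 by apply: mob_den; rewrite ?nrmN ?ltW.
apply: nrm_lt; first by rewrite subr_ge0 expr_le1 ?nrm_ge0 // ltW.
rewrite -subr_gt0 sym_dist.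
have -> : 1 - conjc z * w = 1 + conjc (- z) * w by rewrite rmorphN mulNr.
apply: mulr_gt0; last by rewrite exprn_gt0 // nrm_gt0.
by apply: mulr_gt0; rewrite subr_gt0 -nrm_lt1.
Qed.

Lemma Gc_Hm c tau a x : nrm tau = 1 -> nrm a < 1 -> Gc c x -> Gc c (Hm tau a x).
Proof.
move=> t1 a1 /GcP[z [w [z1 w1 -> h]]]; apply/GcP.
exists (tau * mob a z), (tau * mob a w); rewrite HmE //; split => //.
- exact: nrm_tau_mob.
- exact: nrm_tau_mob.
- exact: tube_mob.
Qed.

Lemma Hm_inv c tau a x : nrm tau = 1 -> nrm a < 1 -> Gc c x ->
  Hm (conjc tau) (- (a * tau)) (Hm tau a x) = x.
Proof.
move=> t1 a1 /GcP[z [w [z1 w1 -> h]]].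
rewrite HmE // HmE ?mob_unit //; try exact: nrm_tau_mob.
by rewrite nrmN nrmM t1 mulr1.
Qed.

Lemma Hm_holo c tau a : nrm a < 1 -> holo_on (Gc c) (Hm tau a : Cx2 R -> Cx2 R).
Proof.
move=> a1 x /GcP[z [w [z1 w1 xE _]]].
have d1 := mob_den a1 (ltW z1); have d2 := mob_den a1 (ltW w1).
have d0 : Hden a x != 0 by rewrite xE HdenE mulf_neq0.
have hD : exists p q, cder2 (Hden a) x p q.
  eexists; eexists; rewrite /Hden.
  apply: cder2D; last by apply: cder2M; [exact: cder2_cst|exact: cder2_snd].
  apply: cder2D; first exact: cder2_cst.
  by apply: cder2M; [exact: cder2_cst|exact: cder2_fst].
have [p [q hD']] := hD.
have [p1 [q1 h1]] : exists p q, cder2 (fun y => (Hm tau a y).1) x p q.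
  eexists; eexists; rewrite /Hm /=.
  apply: cder2M; last by apply: cder2V hD' d0.
  apply: cder2M; first exact: cder2_cst.
  apply: cder2D; last exact: cder2_cst.
  apply: cder2D; apply: cder2M; [exact: cder2_fst|exact: cder2_cst|exact: cder2_cst|exact: cder2_snd].
have [p2 [q2 h2]] : exists p q, cder2 (fun y => (Hm tau a y).2) x p q.
  eexists; eexists; rewrite /Hm /=.
  apply: cder2M; last by apply: cder2V hD' d0.
  apply: cder2M; first exact: cder2_cst.
  apply: cder2D; last exact: cder2_cst.
  by apply: cder2D; [exact: cder2_snd|apply: cder2M; [exact: cder2_cst|exact: cder2_fst]].
exact: cder2_differentiable h1 h2.
Qed.

Lemma Hm_aut c tau a : nrm tau = 1 -> nrm a < 1 -> is_aut (Gc c) (Hm tau a : Cx2 R -> Cx2 R).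
Proof.
move=> t1 a1.
have t1' : nrm (conjc tau) = 1 by rewrite nrm_conj.
have a1' : nrm (- (a * tau)) < 1 by rewrite nrmN nrmM t1 mulr1.
split; [exact: Hm_holo|by move=> x; exact: Gc_Hm|].
exists (Hm (conjc tau) (- (a * tau))); split.
- exact: Hm_holo.
- by move=> x; exact: Gc_Hm.
- by move=> x hx; exact: Hm_inv hx.
- move=> x hx; have := Hm_inv t1' a1' hx.
  rewrite (_ : conjc (conjc tau) = tau); last by case: (tau) => p q; rewrite /= opprK.
  by rewrite mulNr opprK -mulrA unit_conj // mulr1.
Qed.
End Geometry.

(** * The coordinates [u], [v], the leaves and the normal form *)

Section Coordinates.
Variable R : realType.
Local Notation C := R[i].
Implicit Types (a z w d tau : C) (x : C * C).

Definition ucoord x : C := x.1 / 2.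
Definition vcoord x : C := x.1 ^+ 2 / 4 - x.2.

Lemma cE (c r : R) : 0 < r -> 2 * c * r = 1 + r ^+ 2 -> c = (1 + r ^+ 2) / (2 * r).
Proof. by move=> r0 <-; field; rewrite gt_eqF. Qed.

Lemma exists_radius (c : R) : 1 < c -> exists r : R, [/\ 0 < r, r < 1 & 2 * c * r = 1 + r ^+ 2].
Proof.
move=> c1; pose D := c ^+ 2 - 1.
have D0 : 0 < D by rewrite subr_gt0 expr_gt1 //; clear -c1; lra.
pose q := Num.sqrt D.
have q0 : 0 < q by rewrite sqrtr_gt0.
have q2 : q ^+ 2 = c ^+ 2 - 1 by rewrite sqr_sqrtr // ltW.
(* The smaller root of the quadratic equation; the other one is its inverse. *)
exists (c - q); split.
- rewrite subr_gt0 -(@ltr_pXn2r _ 2) ?nnegrE ?q2 ?ltW //; last by clear -c1; lra.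
  by clear; lra.
- rewrite ltrBlDr -ltrBlDl -(@ltr_pXn2r _ 2) ?nnegrE ?q2 ?ltW //; last by clear -c1; lra.
  rewrite -subr_gt0 (_ : _ - _ = 2 * (c - 1)); last by ring.
  by rewrite mulr_gt0 // subr_gt0.
- by rewrite sqrrB q2; ring.
Qed.

Lemma conjNZ (k : R) z : conjc (- ((k%:C)%C * z)) = - ((k%:C)%C * conjc z).
Proof. by apply: complex_ext; rewrite !reimE; ring. Qed.

Lemma nrm2C : nrm (2 : C) = 2.
Proof. by rewrite -[2]/(2%:R) -(rmorph_nat (real_complex R)) nrm_real ger0_norm. Qed.

Lemma two_neq0 : (2 : C) != 0. Proof. by rewrite pnatr_eq0. Qed.

Lemma vcoord_sym z w : vcoord (z + w, z * w) = ((z - w) / 2) ^+ 2.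
Proof. by rewrite /vcoord /=; field. Qed.

Lemma Gc_uv (c : R) x : Gc c x ->
  nrm (ucoord x) ^+ 2 + nrm (vcoord x) < 1 /\
  2 * c * nrm (vcoord x) + 2 * nrm (ucoord x) ^+ 2 < 1 + nrm (ucoord x ^+ 2 - vcoord x) ^+ 2.
Proof.
move=> /GcP[z [w [z1 w1 -> h]]].
rewrite vcoord_sym /ucoord /= (_ : ((z + w) / 2) ^+ 2 - ((z - w) / 2) ^+ 2 = z * w); last by field.
rewrite nrmX !nrmM nrmV nrm2C !exprMn.
have := nrm_sqr_sum z w.
move: h; rewrite /tube; set A := nrm (z - w) ^+ 2; set B := nrm (z + w) ^+ 2.
set p := nrm z ^+ 2; set q := nrm w ^+ 2.
have p1 : p < 1 by rewrite /p -nrm_lt1.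
have q1 : q < 1 by rewrite /q -nrm_lt1.
move=> h1 h2; have -> : B = 2 * (p + q) - A by rewrite -h2; ring.
by split; [clear -p1 q1; lra | clear -h1; lra].
Qed.

Lemma uv_Gc (c : R) (u v : C) : nrm u + Num.sqrt (nrm v) < 1 ->
  2 * c * nrm v + 2 * nrm u ^+ 2 < 1 + nrm (u ^+ 2 - v) ^+ 2 ->
  Gc c (2 * u, u ^+ 2 - v).
Proof.
move=> uv1 h; pose q := sqrtc v.
have q2 : q ^+ 2 = v by exact: sqr_sqrtc.
have nq : nrm q = Num.sqrt (nrm v).
  by rewrite -q2 nrmX sqrtr_sqr ger0_norm // nrm_ge0.
apply/GcP; exists (u + q), (u - q); split.
- by apply: le_lt_trans (nrmD _ _) _; rewrite nq.
- by apply: le_lt_trans (nrmB _ _) _; rewrite nq.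
- by rewrite -q2; congr pair; ring.
have h1 := nrm_sqr_sum (u + q) (u - q).
rewrite /tube; move: h h1.
have -> : u ^+ 2 - v = (u + q) * (u - q) by rewrite -q2; ring.
have -> : u + q - (u - q) = 2 * q by ring.
have -> : u + q + (u - q) = 2 * u by ring.
rewrite -q2 nrmX !nrmM nrm2C.
set A := nrm q; set B := nrm u; set p := nrm (u + q); set r := nrm (u - q).
by clear => h1 h2; lra.
Qed.

Section Fixc.
Variables c r : R.
Hypotheses (r0 : 0 < r) (r1 : r < 1) (cr : 2 * c * r = 1 + r ^+ 2).

(** With [X = |u|^2] and [t = |v|] one gets [X * (1 - t) < 1 - 2 * c * t + t ^+ 2], whose right side
    times [r] is [(r - t) * (1 - r * t)]. Thus [u] is forced to [0] as [|v|] tends to [r]; this is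
    used near the boundary point and again in [leaf_rotation]. *)
Lemma Gc_uv_bound x : Gc c x -> nrm (vcoord x) < r /\
  nrm (ucoord x) ^+ 2 <= (r - nrm (vcoord x)) / (r * (1 - r)).
Proof.
move=> /Gc_uv[]; set v := vcoord x; set u := ucoord x => h1 h2.
set t := nrm v in h1 h2 *; set X := nrm u ^+ 2 in h1 h2 *.
have t0 : 0 <= t by exact: nrm_ge0.
have X0 : 0 <= X by rewrite exprn_ge0 // nrm_ge0.
have h3 : nrm (u ^+ 2 - v) ^+ 2 <= (X + t) ^+ 2.
  rewrite ler_pXn2r ?nnegrE ?addr_ge0 ?nrm_ge0 // /X /t -nrmX; exact: nrmB.
have h4 : X * (2 - 2 * t - X) < 1 - 2 * c * t + t ^+ 2.
  by clear -h2 h3; lra.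
have E : (1 - 2 * c * t + t ^+ 2) * r = (r - t) * (1 - r * t).
  by rewrite mulrDl mulrBl mulrAC cr; ring.
have h5 : 0 <= X * (1 - t).
  by apply: mulr_ge0 => //; clear -h1 X0; lra.
have h6 : X * (1 - t) <= X * (2 - 2 * t - X).
  by apply: ler_wpM2l => //; clear -h1; lra.
have h7 : 0 < (r - t) * (1 - r * t) by rewrite -E mulr_gt0 //; clear -h4 h5 h6; lra.
have rt : r * t < 1.
  apply: le_lt_trans r1; rewrite ler_piMr ?ltW //.
  by apply: le_lt_trans h1; rewrite lerDr.
have rt' : 0 < 1 - r * t by rewrite subr_gt0.
have tr : t < r by move: h7; rewrite pmulr_lgt0 // subr_gt0.
split => //.
rewrite ler_pdivlMr; last by rewrite mulr_gt0 // subr_gt0.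
have h8 : X * (1 - r) <= X * (1 - t) by apply: ler_wpM2l => //; clear -tr; lra.
have h9 : X * (1 - r) * r <= (1 - 2 * c * t + t ^+ 2) * r.
  by rewrite ler_pM2r //; clear -h8 h6 h4; lra.
rewrite mulrA mulrAC; apply: le_trans h9 _; rewrite E.
have : (r - t) * (1 - r * t) <= (r - t) * 1.
  apply: ler_wpM2l; first by rewrite subr_ge0 ltW.
  by rewrite gerBl mulr_ge0 // ltW.
by rewrite mulr1.
Qed.

Lemma leaf_Gc (v : C) : nrm v < r -> Gc c (0, - v).
Proof.
move=> vr; have := @uv_Gc c 0 v; rewrite mulr0 (expr2 (0 : C)) mul0r sub0r nrm0 add0r.
rewrite nrmN (expr2 (0 : R)) mul0r mulr0 addr0; apply.
  by rewrite -(@ltr_pXn2r _ 2) ?nnegrE ?sqrtr_ge0 // sqr_sqrtr ?nrm_ge0 // expr1n (lt_trans vr).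
have t0 := nrm_ge0 v; set t := nrm v in vr t0 *.
rewrite -subr_gt0 -(pmulr_lgt0 _ r0).
have -> : (1 + t ^+ 2 - 2 * c * t) * r = (r - t) * (1 - r * t).
  by rewrite mulrBl (mulrAC _ t) cr; ring.
rewrite mulr_gt0 ?subr_gt0 //.
apply: le_lt_trans r1.
by rewrite ler_piMr ?ltW // (lt_trans vr).
Qed.

Lemma royal_Gc z : nrm z < 1 -> Gc c (2 * z, z ^+ 2).
Proof.
move=> z1; apply/GcP; exists z, z; split => //; first by congr pair; ring.
rewrite /tube subrr nrm0 expr0n mulr0 !mulr_gt0 // subr_gt0 -nrm_lt1 //.
Qed.

(** A Moebius map that takes the hyperbolic midpoint of the two roots to [0] makes them opposite, so
    that their sum vanishes. *)
Lemma normal_form x : Gc c x ->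
  exists a v, [/\ nrm a < 1, nrm v < r & x = Hm 1 a (0, - v)].
Proof.
move=> hx; have /GcP[z [w [z1 w1 xE _]]] := hx.
have nz1 : nrm (- z) < 1 by rewrite nrmN.
have n0 : nrm (0 : C) < 1 by rewrite nrm0.
pose m := mob (- z) w.
have m1 : nrm m < 1 by exact: mob_disc.
(* The point [m / (1 + sqrt (1 - |m|^2))] halves the hyperbolic distance from [0] to [m]. *)
pose q := Num.sqrt (1 - nrm m ^+ 2).
have m20 : 0 < 1 - nrm m ^+ 2 by rewrite subr_gt0 -nrm_lt1.
have q0 : 0 < q by rewrite sqrtr_gt0.
have q2 : q ^+ 2 = 1 - nrm m ^+ 2 by rewrite sqr_sqrtr // ltW.
pose k := (1 + q)^-1.
have k0 : 0 < k by rewrite invr_gt0 addr_gt0.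
have k1 : k < 1 by rewrite invf_lt1 ?addr_gt0 // ltrDl.
pose b : C := (k%:C)%C * m.
have b1 : nrm b < 1.
  rewrite nrmM nrm_real gtr0_norm //; apply: le_lt_trans m1.
  by rewrite ler_piMl ?nrm_ge0 // ltW.
have nb1 : nrm (- b) < 1 by rewrite nrmN.
(* [b] is the hyperbolic midpoint of [0] and [m]. *)
have mid : mob (- b) m = b.
  have d0 := mob_den nb1 (ltW m1).
  rewrite /mob; apply/eqP; rewrite -subr_eq0; apply/eqP.
  suff E : m + - b = b * (1 + conjc (- b) * m) by rewrite E mulfK // subrr.
  have E : b * (1 + conjc (- b) * m) = m * ((k * (1 - k * nrm m ^+ 2))%:C)%C.
    have bc : conjc (- b) = - ((k%:C)%C * conjc m) by exact: conjNZ.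
    have -> : ((k * (1 - k * nrm m ^+ 2))%:C)%C = (k%:C)%C * (1 - (k%:C)%C * (m * conjc m)).
      by rewrite mulc_conj rmorphM rmorphB rmorph1 rmorphM.
    by rewrite bc /b; ring.
  rewrite E (_ : nrm m ^+ 2 = 1 - q ^+ 2); last by rewrite q2; ring.
  rewrite (_ : k * (1 - k * (1 - q ^+ 2)) = 1 - k); last first.
    by rewrite /k; field; rewrite gt_eqF // addr_gt0.
  by rewrite rmorphB /b; ring.
pose phi (y : C) := mob (- b) (mob (- z) y).
pose psi (y : C) := mob z (mob b y).
have psi1 (y : C) : nrm y < 1 -> nrm (psi y) < 1 by move=> y1; do 2 apply: mob_disc => //.
have pz : psi (- b) = z by rewrite /psi mobN mob0.
have pw : psi b = w.
  by rewrite /psi -{2}mid mobNK // /m mobNK.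
(* [psi] is a disc automorphism, hence of the form [tau * mob a']. *)
have psiE : exists tau a, [/\ nrm tau = 1, nrm a < 1 & forall y, nrm y < 1 -> psi y = tau * mob a y].
  apply: (@aut_disc_mob R psi).
  have hol (p s : C) (F : Cx R -> Cx R) : nrm p < 1 -> nrm s < 1 ->
      (forall y, F y = mob p (mob s y)) -> holo_on (@disc R) F.
    move=> p1 s1 FE y y1; have h := cder_comp (cder_mob s1 (ltW y1)) (cder_mob p1 (ltW (mob_disc s1 y1))).
    by apply: (@cder_differentiable R F y _ (cder_near ltr01 (fun t _ => esym (FE t)) h)).
  split; [exact: (hol z b)|exact: psi1|].
  exists (phi : Cx R -> Cx R); split.
  - exact: (hol (- b) (- z)).
  - by move=> y y1; do 2 apply: mob_disc => //.
  - move=> y y1; have y1' : nrm (mob b y) < 1 by exact: mob_disc.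
    by rewrite /phi /psi (mobK z1 y1') mobK.
  - move=> y y1; have y1' : nrm (mob (- z) y) < 1 by exact: mob_disc.
    by rewrite /phi /psi (mobNK b1 y1') mobNK.
have [tau [a [t1 a1 pE]]] := psiE.
have t0 : tau * conjc tau = 1 by exact: unit_conj.
have at1 : nrm (a * tau) < 1 by rewrite nrmM t1 mulr1.
have tb1 (y : C) : nrm y < 1 -> nrm (tau * y) < 1 by move=> y1; rewrite nrmM t1 mul1r.
(* The rotation goes into the leaf parameter: [tau * mob a y = mob (a * tau) (tau * y)]. *)
have pE' (y : C) : nrm y < 1 -> psi y = mob (a * tau) (tau * y).
  move=> y1; rewrite pE // /mob rmorphM.
  rewrite (_ : conjc a * conjc tau * (tau * y) = conjc a * y * (tau * conjc tau)); last by ring.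
  by rewrite t0 mulr1 mulrA; congr (_ / _); ring.
have xH : x = Hm 1 (a * tau) (0, - (tau * b) ^+ 2).
  have -> : ((0, - (tau * b) ^+ 2) : C * C) = (tau * (- b) + tau * b, tau * (- b) * (tau * b)).
    by congr pair; ring.
  rewrite HmE //; try by apply: tb1; rewrite ?nrmN.
  by rewrite !mul1r -!pE' ?nrmN // pz pw.
exists (a * tau), ((tau * b) ^+ 2); split => //.
have nt1 : nrm (1 : C) = 1 by exact: nrm1.
(* The bound by [r] comes from moving [x] back to the central leaf inside [Gc c]. *)
have h := Hm_inv nt1 at1; have hG : Gc c (0, - (tau * b) ^+ 2).
  have z1' : nrm (tau * (- b)) < 1 by apply: tb1; rewrite nrmN.
  have w1' : nrm (tau * b) < 1 by exact: tb1.
  have at1' : nrm (- (a * tau)) < 1 by rewrite nrmN.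
  have := Gc_Hm nt1 at1' hx; rewrite xH.
  have -> : ((0, - (tau * b) ^+ 2) : C * C) = (tau * (- b) + tau * b, tau * (- b) * (tau * b)).
    by congr pair; ring.
  by rewrite HmE // !mul1r HmE ?mob_disc // !mul1r !mobK.
have [hv _] := Gc_uv_bound hG.
by move: hv; rewrite /vcoord /= expr0n /= mul0r sub0r opprK.
Qed.

Lemma Hm_leaf a v : nrm a < 1 -> nrm v < 1 ->
  ucoord (Hm 1 a (0, - v)) = (a - conjc a * v) / (1 - conjc a ^+ 2 * v) /\
  vcoord (Hm 1 a (0, - v)) = v * (1 - a * conjc a) ^+ 2 / (1 - conjc a ^+ 2 * v) ^+ 2.
Proof.
move=> a1 v1.
have d0 : 1 - conjc a ^+ 2 * v != 0.
  have a2 : nrm (- a ^+ 2) < 1 by rewrite nrmN nrmX expr_lt1 // nrm_ge0.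
  by have := mob_den a2 (ltW v1); rewrite rmorphN rmorphXn mulNr.
by rewrite /ucoord /vcoord /Hm /Hden /= !mulr0 addr0 mulrN; split; field; rewrite ?mulr_natl.
Qed.
End Fixc.

End Coordinates.

(** * The boundary point (0, -r) *)

Section BoundaryEstimates.
Variable R : realType.
Local Notation C := R[i].
Implicit Types (a z w d u v t : C).

Lemma nrm_CS a w u v :
  nrm (a * u + w * v) ^+ 2 <= (nrm a ^+ 2 + nrm w ^+ 2) * (nrm u ^+ 2 + nrm v ^+ 2).
Proof.
rewrite -subr_ge0 (_ : _ - _ = nrm (conjc a * v - conjc w * u) ^+ 2).
  by rewrite exprn_ge0 // nrm_ge0.
by rewrite !nrm2 !reimE; ring.
Qed.

(* A Cayley transform turns the Siegel domain [|mu|^2 < Re ze] into a ball. *)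
Lemma siegel_schwarz (ze mu : C -> C) (s0 : R) a b : 0 < s0 ->
  holD ze -> holD mu -> mu 0 = 0 -> ze 0 = (s0%:C)%C -> cder ze 0 a -> cder mu 0 b ->
  (forall z, nrm z < 1 -> nrm (mu z) ^+ 2 <= Re (ze z)) ->
  nrm a ^+ 2 / (4 * s0 ^+ 2) + nrm b ^+ 2 / s0 <= 1.
Proof.
move=> s00 hze hmu mu0 ze0 da db H.
set S := (s0%:C)%C : C in ze0.
have Re0 z : nrm z < 1 -> 0 <= Re (ze z).
  by move=> z1; apply: le_trans (H z z1); rewrite exprn_ge0 // nrm_ge0.
have den z : nrm z < 1 -> ze z + S != 0.
  move=> z1; apply/eqP => h; have := Re0 z z1.
  have : Re (ze z + S) = 0 by rewrite h.
  by rewrite ReD /S ReC; move: s00; clear; lra.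
pose q := Num.sqrt s0.
have q0 : 0 < q by rewrite sqrtr_gt0.
have q2 : q ^+ 2 = s0 by rewrite sqr_sqrtr // ltW.
pose Q := (q%:C)%C : C.
have QS : Q ^+ 2 = S by rewrite /S -q2 rmorphXn.
have Q0 : Q != 0 by rewrite -nrm_gt0 nrm_real gtr0_norm.
pose w1 z := (ze z - S) / (ze z + S); pose w2 z := 2 * Q * mu z / (ze z + S).
have ball z : nrm z < 1 -> nrm (w1 z) ^+ 2 + nrm (w2 z) ^+ 2 <= 1.
  move=> z1; have d0 := den z z1; rewrite -nrm_gt0 in d0.
  rewrite /w1 /w2 (nrmM (ze z - S)) (nrmM (2 * Q * mu z)) nrmV !expr_div_n -mulrDl.
  rewrite ler_pdivrMr ?exprn_gt0 // mul1r !nrmM nrm2C nrm_real gtr0_norm //.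
  rewrite !exprMn q2 !(nrm2 (_ + _)) !reimE.
  by have := H z z1; move: s00; clear => s00 h; nra.
have hw1 z : nrm z < 1 -> exists d, cder w1 z d.
  move=> z1; have [d hd] := hze z z1; eexists.
  by apply: cderM (cderB hd (cder_cst S z)) (cderV (cderD hd (cder_cst S z)) (den z z1)).
have hw2 z : nrm z < 1 -> exists d, cder w2 z d.
  move=> z1; have [d hd] := hze z z1; have [e he] := hmu z z1; eexists.
  by apply: cderM (cderM (cder_cst _ z) he) (cderV (cderD hd (cder_cst S z)) (den z z1)).
have n0 : nrm (0 : C) < 1 by rewrite nrm0.
have S0 : S != 0 by rewrite -QS expf_neq0.
have SS : S + S != 0 by have := den 0 n0; rewrite ze0.
have dw1 : cder w1 0 (a / (2 * S)).
  apply: cder_eqd (cderM (cderB da (cder_cst S 0)) (cderV (cderD da (cder_cst S 0)) (den 0 n0))) _.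
  by rewrite ze0; field; apply/andP; split; [exact: S0|exact: SS].
have dw2 : cder w2 0 (b / Q).
  apply: cder_eqd (cderM (cderM (cder_cst (2 * Q) 0) db) (cderV (cderD da (cder_cst S 0)) (den 0 n0))) _.
  have QQ : Q ^+ 2 + Q ^+ 2 != 0 by rewrite QS.
  by rewrite mu0 ze0 -QS; field; apply/andP; split; [exact: Q0|exact: QQ].
set p := a / (2 * S); set k := b / Q.
have np : nrm p ^+ 2 = nrm a ^+ 2 / (4 * s0 ^+ 2).
  rewrite /p nrmM nrmV nrmM nrm2C nrm_real gtr0_norm //.
  by rewrite exprMn exprVn exprMn; congr (_ / (_ * _)); ring.
have nk : nrm k ^+ 2 = nrm b ^+ 2 / s0.
  by rewrite /k nrmM nrmV nrm_real gtr0_norm // exprMn exprVn q2.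
rewrite -np -nk; set n2 := _ + _.
have n20 : 0 <= n2 by rewrite addr_ge0 // exprn_ge0 // nrm_ge0.
rewrite leNgt; apply/negP => n21.
pose n := Num.sqrt n2.
have nn : n ^+ 2 = n2 by rewrite sqr_sqrtr.
have n_gt1 : 1 < n by rewrite -(@ltr_pXn2r _ 2) ?nnegrE ?sqrtr_ge0 // expr1n nn.
have npos : 0 < n by apply: lt_trans n_gt1.
(* Pairing [(w1, w2)] with the unit vector dual to its derivative gives a self-map of the closed
   disc with derivative [n] at [0], to which the one-variable Schwarz lemma applies. *)
pose al : C := conjc p / (n%:C)%C; pose be : C := conjc k / (n%:C)%C.
have nab : nrm al ^+ 2 + nrm be ^+ 2 = 1.
  rewrite /al /be !nrmM !nrmV !nrm_conj nrm_real gtr0_norm // !exprMn -mulrDl -/n2 -nn.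
  by rewrite exprVn mulfV // expf_neq0 // gt_eqF.
pose f z := al * w1 z + be * w2 z.
have nz : (n%:C)%C != 0 :> C by rewrite -nrm_gt0 nrm_real gtr0_norm.
have fd : cder f 0 ((n%:C)%C).
  apply: cder_eqd (cderD (cderM (cder_cst al 0) dw1) (cderM (cder_cst be 0) dw2)) _.
  rewrite !mul0r !add0r -/p -/k /al /be.
  transitivity ((p * conjc p + k * conjc k) / (n%:C)%C); first by ring.
  by rewrite !mulc_conj -rmorphD -/n2 -nn rmorphXn expr2 mulfK.
have hf : holD f.
  move=> z z1; have [d hd] := hw1 z z1; have [e he] := hw2 z z1; eexists.
  by apply: cderD (cderM (cder_cst al z) hd) (cderM (cder_cst be z) he).
have f0 : f 0 = 0.
  by rewrite /f /w1 /w2 ze0 mu0 subrr !mulr0 !mul0r !mulr0 addr0.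
have f1 z : nrm z < 1 -> nrm (f z) <= 1.
  move=> z1; apply: nrm_le => //; rewrite expr1n /f; apply: le_trans (nrm_CS _ _ _ _) _.
  by rewrite nab mul1r ball.
have := schwarz_der hf f0 fd f1.
by rewrite nrm_real gtr0_norm // leNgt n_gt1.
Qed.

Section Expansion.
Variables c r : R.
Hypotheses (r0 : 0 < r) (r1 : r < 1) (cr : 2 * c * r = 1 + r ^+ 2).

(* At [(0, -r)], with [t = r - v], the domain [G_c] is to second order
   [Re t > kA |u|^2 + kB Re (u^2)], that is [ell u t > 0]. *)
Definition kA : R := 2 * r / (1 - r ^+ 2).
Definition kB : R := 2 * r ^+ 2 / (1 - r ^+ 2).

Lemma r2_lt1 : 0 < 1 - r ^+ 2.
Proof. by rewrite subr_gt0 expr_lt1 // ltW. Qed.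

Lemma kA_gt0 : 0 < kA.
Proof. by rewrite divr_gt0 ?mulr_gt0 // r2_lt1. Qed.

Lemma kB_kA : kB = r * kA.
Proof. by rewrite /kB /kA; field; rewrite gt_eqF // r2_lt1. Qed.

Definition ell u t : R := Re t - kA * nrm u ^+ 2 - kB * Re (u ^+ 2).

(** The inequality of [Gc_uv] reads [2 * c * |v| < N], and squaring removes the root in [|v|]. The
    identity is exact: beyond the [ell] term everything is of order at least two in
    [(|u|^2, |t|)]. *)
Lemma expansion u t (v := (r%:C)%C - t) (N := 1 + nrm (u ^+ 2 - v) ^+ 2 - 2 * nrm u ^+ 2)
   (n1 := - (2 * r * Re t) - 2 * nrm u ^+ 2 - 2 * r * Re (u ^+ 2))
   (n2 := nrm (u ^+ 2 + t) ^+ 2) :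
  [/\ N = 1 + r ^+ 2 + n1 + n2 &
      N ^+ 2 - (2 * c * nrm v) ^+ 2 =
      2 * (1 + r ^+ 2) * ((2 / kA) * ell u t) + 2 * (1 + r ^+ 2) * n2 + (n1 + n2) ^+ 2
       - (1 + r ^+ 2) ^+ 2 / r ^+ 2 * nrm t ^+ 2].
Proof.
have N1 : N = 1 + r ^+ 2 + n1 + n2.
  by rewrite /N /n1 /n2 /v !(nrm2 (_ + _)) !reimE; ring.
split => //.
have v2 : nrm v ^+ 2 = r ^+ 2 - 2 * r * Re t + nrm t ^+ 2.
  by rewrite /v !nrm2 !reimE; ring.
have c2 : 2 * c = (1 + r ^+ 2) / r by rewrite -cr mulfK // gt_eqF.
rewrite exprMn v2 c2 N1 /ell /kB /kA /n1.
have h := r2_lt1.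
field; rewrite !gt_eqF //.
Qed.

(** In [expansion] only [2 * (1 + r ^+ 2) * n2] and [(n1 + n2) ^+ 2] could compensate a negative
    [ell], and both are of order [M ^+ 2]. *)
Lemma outer_est u t (M : R) (v := (r%:C)%C - t) : M <= 1 -> nrm u ^+ 2 <= M -> nrm t <= M ->
  2 * c * nrm v + 2 * nrm u ^+ 2 < 1 + nrm (u ^+ 2 - v) ^+ 2 ->
  - (27 * kA * M ^+ 2) <= ell u t.
Proof.
move=> M1 uM tM h.
have [NE P] := expansion u t.
set N := 1 + _ - _ in NE P; set n1 := - _ - _ - _ in NE P; set n2 := nrm (_ + _) ^+ 2 in NE P.
have M0 : 0 <= M by apply: le_trans tM; exact: nrm_ge0.
have c0 : 0 < c by rewrite (cE r0 cr) divr_gt0 // ?mulr_gt0 // addr_gt0 // exprn_gt0.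
have cv0 : 0 <= 2 * c * nrm v by rewrite !mulr_ge0 ?nrm_ge0 // ltW.
have NP : 0 < N ^+ 2 - (2 * c * nrm v) ^+ 2.
  rewrite subr_gt0 ltr_pXn2r ?nnegrE //; first by rewrite /N -/v; clear -h; lra.
  by rewrite /N -/v; clear -h cv0; lra.
have Ret : `|Re t| <= M by apply: le_trans (Re_le_nrm _) tM.
have Reu : `|Re (u ^+ 2)| <= M by apply: le_trans (Re_le_nrm _) _; rewrite nrmX.
have U0 : 0 <= nrm u ^+ 2 by rewrite exprn_ge0 // nrm_ge0.
have T0 : 0 <= nrm t ^+ 2 by rewrite exprn_ge0 // nrm_ge0.
have n20 : 0 <= n2 by rewrite exprn_ge0 // nrm_ge0.
have n2M : n2 <= 4 * M ^+ 2.
  rewrite (_ : 4 * M ^+ 2 = (M + M) ^+ 2); last by ring.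
  rewrite ler_pXn2r ?nnegrE ?nrm_ge0 ?addr_ge0 //.
  by apply: le_trans (nrmD _ _) _; rewrite nrmX lerD.
have n2M' : n2 <= 4 * M.
  apply: le_trans n2M _; rewrite ler_pM2l // expr2 ler_piMl //.
have [a1 a2] : - M <= Re t /\ Re t <= M by apply/andP; rewrite -ler_norml.
have [b1 b2] : - M <= Re (u ^+ 2) /\ Re (u ^+ 2) <= M by apply/andP; rewrite -ler_norml.
have rt x : - M <= x -> x <= M -> - M <= r * x /\ r * x <= M.
  move=> x1 x2; have : `|r * x| <= M.
    rewrite normrM gtr0_norm //; apply: le_trans (_ : `|x| <= _); last by rewrite ler_norml x1.
    by rewrite ler_piMl // ltW.
  by rewrite ler_norml => /andP.
have [c1 c2] := rt _ a1 a2; have [d1 d2] := rt _ b1 b2.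
have n1M : `|n1 + n2| <= 10 * M.
  by rewrite ler_norml /n1; clear -uM U0 n20 n2M' c1 c2 d1 d2; lra.
have sq : (n1 + n2) ^+ 2 <= 100 * M ^+ 2.
  rewrite (_ : 100 * M ^+ 2 = (10 * M) ^+ 2); last by ring.
  by rewrite -[leLHS]real_normK ?num_real // ler_pXn2r ?nnegrE // mulr_ge0.
set k := 1 + r ^+ 2 in P.
have k1 : 1 <= k by rewrite lerDl exprn_ge0 // ltW.
have T1 : 0 <= k ^+ 2 / r ^+ 2 * nrm t ^+ 2.
  by rewrite mulr_ge0 // divr_ge0 // exprn_ge0 // ltW // (lt_le_trans _ k1).
set L := 2 / kA * ell u t in P.
(* From [n2 <= 4 * M ^+ 2], [(n1 + n2) ^+ 2 <= 100 * M ^+ 2] and [1 <= k]: the constant is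
   [(8 + 100) / 2 = 54]. *)
have kL : - (54 * M ^+ 2) * k <= L * k.
  have : 0 <= (k - 1) * M ^+ 2 by rewrite mulr_ge0 ?subr_ge0 // exprn_ge0.
  have : k * n2 <= k * (4 * M ^+ 2) by rewrite ler_pM2l // (lt_le_trans _ k1).
  by clear -P NP sq T1; rewrite P in NP; lra.
have kp : 0 < k by apply: lt_le_trans k1.
rewrite ler_pM2r // in kL.
have A0 := kA_gt0.
have : - (54 * M ^+ 2) * (kA / 2) <= L * (kA / 2) by rewrite ler_pM2r // divr_gt0.
rewrite {1}(_ : L * (kA / 2) = ell u t); first by apply: le_trans; rewrite le_eqVlt; apply/orP; left; apply/eqP; field.
by rewrite /L; field; rewrite gt_eqF.
Qed.

(** For positive [ell] the single negative term of [expansion] is the one in [|t|^2]. The squaring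
    is undone because [2 * nrm u ^+ 2 < 1] makes [N] nonnegative. *)
Lemma inner_est u t (M : R) (v := (r%:C)%C - t) : 2 * nrm u ^+ 2 < 1 -> nrm t <= M ->
  kA * M ^+ 2 / (2 * r ^+ 2) < ell u t ->
  2 * c * nrm v + 2 * nrm u ^+ 2 < 1 + nrm (u ^+ 2 - v) ^+ 2.
Proof.
move=> u1 tM h.
have [NE P] := expansion u t.
set N := 1 + _ - _ in NE P; set n1 := - _ - _ - _ in NE P; set n2 := nrm (_ + _) ^+ 2 in NE P.
have M0 : 0 <= M by apply: le_trans tM; exact: nrm_ge0.
have c0 : 0 < c by rewrite (cE r0 cr) divr_gt0 // ?mulr_gt0 // addr_gt0 // exprn_gt0.
have cv0 : 0 <= 2 * c * nrm v by rewrite !mulr_ge0 ?nrm_ge0 // ltW.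
have n20 : 0 <= n2 by rewrite exprn_ge0 // nrm_ge0.
have N0 : 0 <= N.
  have : 0 <= nrm (u ^+ 2 - v) ^+ 2 by rewrite exprn_ge0 // nrm_ge0.
  by rewrite /N -/v; clear -u1; lra.
suff : 2 * c * nrm v < N by rewrite /N -/v; clear; lra.
rewrite -(@ltr_pXn2r _ 2) ?nnegrE // -subr_gt0 P.
set k := 1 + r ^+ 2 in P *.
have k1 : 1 <= k by rewrite lerDl exprn_ge0 // ltW.
have k2 : k <= 2 by rewrite /k -lerBrDl (_ : 2 - 1 = 1) ?expr_le1 // ?ltW //; ring.
have kp : 0 < k by apply: lt_le_trans k1.
have A0 := kA_gt0.
have r20 : 0 < r ^+ 2 by rewrite exprn_gt0.
set L := 2 / kA * ell u t.
have L1 : M ^+ 2 / r ^+ 2 < L.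
  have -> : M ^+ 2 / r ^+ 2 = 2 / kA * (kA * M ^+ 2 / (2 * r ^+ 2)).
    by field; rewrite !gt_eqF.
  by rewrite /L ltr_pM2l // divr_gt0.
have t2 : nrm t ^+ 2 <= M ^+ 2 by rewrite ler_pXn2r ?nnegrE // nrm_ge0.
have q1 : k ^+ 2 / r ^+ 2 * nrm t ^+ 2 <= k * 2 * (M ^+ 2 / r ^+ 2).
  rewrite -mulrA (mulrC (_^-1)) expr2 -mulrA -[leRHS]mulrA ler_pM2l //.
  by apply: ler_pM => //; [exact: ltW| rewrite divr_ge0 ?exprn_ge0 ?nrm_ge0 // ltW|rewrite ler_pM2r // invr_gt0].
have q2 : k * 2 * (M ^+ 2 / r ^+ 2) < k * 2 * L by rewrite ltr_pM2l // mulr_gt0.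
have q3 : 0 <= k * n2 by rewrite mulr_ge0 // ltW.
have q4 : 0 <= (n1 + n2) ^+ 2 by exact: sqr_ge0.
by clear -q1 q2 q3 q4; lra.
Qed.
End Expansion.

End BoundaryEstimates.

(** * Tangent vectors near the boundary point *)

Section Metrics.
Variable R : realType.
Local Notation C := R[i].
Implicit Types (a b z w d u v t : C).

Definition discG (c : R) (p q : C -> C) : Prop :=
  [/\ holD p, holD q & forall z, nrm z < 1 -> Gc c (p z, q z)].

Lemma mob_0 z : mob 0 z = z.
Proof. by rewrite /mob addr0 rmorph0 mul0r addr0 divr1. Qed.

(** The hypothesis on [s] describes a pseudohyperbolic ball about [1 - dl]. With fixed radius it
    shrinks to [1] linearly in [dl], which is the localization behind [outer_metric]. *)
Lemma close_to_one w (dl s : R) : 0 < dl -> 0 <= s < 1 ->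
  nrm (w - (1 - dl)%:C%C) <= s * nrm (1 - (1 - dl)%:C%C * w) -> nrm w <= 1 ->
  nrm (1 - w) <= 2 * dl / (1 - s).
Proof.
move=> dl0 /andP[s0 s1] h w1.
have e1 : 1 - w = (dl%:C)%C - (w - (1 - dl)%:C%C) by rewrite rmorphB rmorph1; ring.
have e2 : 1 - (1 - dl)%:C%C * w = (1 - w) + (dl%:C)%C * w by rewrite rmorphB rmorph1; ring.
have h1 : nrm (1 - (1 - dl)%:C%C * w) <= nrm (1 - w) + dl.
  rewrite e2; apply: le_trans (nrmD _ _) _; rewrite lerD2l nrmM nrm_real gtr0_norm //.
  by rewrite ler_piMr // ltW.
have h2 : nrm (1 - w) <= dl + nrm (w - (1 - dl)%:C%C).
  by rewrite e1; apply: le_trans (nrmB _ _) _; rewrite nrm_real gtr0_norm.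
have h3 : s * nrm (1 - (1 - dl)%:C%C * w) <= s * (nrm (1 - w) + dl) by rewrite ler_wpM2l.
rewrite ler_pdivlMr ?subr_gt0 //.
have h4 : s * dl <= dl by rewrite ler_piMl // ltW.
by move: h h2 h3 h4; set X := nrm (1 - w); set Y := nrm _; set Z := nrm _; clear; lra.
Qed.

Lemma holD_scale (f : C -> C) (s : R) : 0 < s < 1 -> holD f ->
  holD (fun z => f ((s%:C)%C * z)).
Proof.
move=> /andP[s0 s1] hf z z1.
have [|d hd] := hf ((s%:C)%C * z).
  by rewrite nrmM nrm_real gtr0_norm // (le_lt_trans _ z1) // ler_piMl ?nrm_ge0 // ltW.
by eexists; apply: (cder_comp (cderM (cder_cst (s%:C)%C z) (cder_id z)) hd).
Qed.

Lemma cder_scale (f : C -> C) (s : R) d : cder f 0 d ->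
  cder (fun z => f ((s%:C)%C * z)) 0 ((s%:C)%C * d).
Proof.
move=> hd; have h := cderM (cder_cst (s%:C)%C 0) (cder_id (0 : C)).
apply: cder_eqd (cder_comp h (_ : cder f _ d)) _; last by ring.
by rewrite mulr0.
Qed.

(** On [|z| <= 1 - eta] the Schwarz-Pick lemma for [v / r] keeps [t] of order [e], and [Gc_uv_bound]
    keeps [|u|^2] of order [e]; the error in [outer_est] is then below [eta * e]. So the shrunken
    disc lies in a Siegel domain and [siegel_schwarz] applies. The factor [1 - eta] is due to the
    shrinking, [1 + eta] to the shifted base point. *)
Lemma outer_metric (c r eta : R) : 0 < r -> r < 1 -> 2 * c * r = 1 + r ^+ 2 -> 0 < eta < 1 -> exists2 e0 : R, 0 < e0 &
  forall e : R, 0 < e < e0 -> forall (p q : C -> C) x y, discG c p q ->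
   p 0 = 0 -> q 0 = - ((r - e)%:C)%C -> cder p 0 (2 * x) -> cder q 0 (- y) ->
   kA r * nrm x ^+ 2 / e + nrm y ^+ 2 / (4 * e ^+ 2) <= ((1 + eta) / (1 - eta)) ^+ 2.
Proof.
move=> r0 r1 cr /andP[eta0 eta1]; have A0 := kA_gt0 r0 r1.
set A := kA r in A0 *; pose B := kB r.
have r1' : 0 < 1 - r by rewrite subr_gt0.
(* [M = k * e] will bound both [|t|] and [|u|^2] on the smaller disc. *)
pose k := 2 / (eta * (r * (1 - r))).
have k0 : 0 < k by rewrite divr_gt0 // !mulr_gt0.
have Ak0 : 0 < 27 * A * k ^+ 2 by apply: mulr_gt0; [exact: mulr_gt0|exact: exprn_gt0].
(* The three bounds give [e < r], [k * e <= 1] and [27 * A * (k * e) ^+ 2 <= eta * e]. *)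
exists (Num.min (Num.min r k^-1) (eta / (27 * A * k ^+ 2))).
  by rewrite !lt_min r0 invr_gt0 k0 divr_gt0.
move=> e; rewrite !lt_min => /andP[e0 /andP[/andP[er ek] eA]].
move=> p q x y [hp hq hG] p0 q0 dp dq.
have n0 : nrm (0 : C) < 1 by rewrite nrm0.
pose u z := p z / 2; pose v z := u z ^+ 2 - q z; pose t z := (r%:C)%C - v z.
have uE z : ucoord (p z, q z) = u z by [].
have vE z : vcoord (p z, q z) = v z.
  by rewrite /vcoord /v /u /=; field.
have du z d : cder p z d -> cder u z (d / 2).
  by move=> h; apply: cder_eqd (cderM h (cder_cst 2^-1 z)) _; ring.
have dv z d d' : cder p z d -> cder q z d' -> cder v z (u z * d - d').
  move=> h h'; apply: cder_eqd (cderB (cder_comp (du _ _ h) (cder_sqr _)) h') _.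
  by field.
have hv : holD v.
  move=> z z1; have [d hd] := hp z z1; have [d' hd'] := hq z z1.
  by eexists; exact: dv hd hd'.
have hu : holD u by move=> z z1; have [d hd] := hp z z1; eexists; exact: du hd.
have u0 : u 0 = 0 by rewrite /u p0 mul0r.
have v0 : v 0 = ((r - e)%:C)%C by rewrite /v u0 q0 expr2 mul0r sub0r opprK.
have bd z : nrm z < 1 -> nrm (v z) < r /\ nrm (u z) ^+ 2 <= (r - nrm (v z)) / (r * (1 - r)).
  by move=> z1; have := Gc_uv_bound r0 r1 cr (hG z z1); rewrite uE vE.
pose s := 1 - eta.
have s0 : 0 < s by rewrite subr_gt0.
have s1 : s < 1 by rewrite /s; clear -eta0; lra.
pose W z := v z / (r%:C)%C.
have nr : nrm ((r%:C)%C : C) = r by rewrite nrm_real gtr0_norm.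
have rC0 : (r%:C)%C != 0 :> C by rewrite -nrm_gt0 nr.
have hW : holD W.
  by move=> z z1; have [d hd] := hv z z1; eexists; apply: cderM hd (cder_cst _ z).
have W1 z : nrm z < 1 -> nrm (W z) < 1.
  by move=> z1; rewrite /W nrmM nrmV nr ltr_pdivrMr // mul1r; case: (bd z z1).
pose dl := e / r.
have dl0 : 0 < dl by rewrite divr_gt0.
have W0 : W 0 = (1 - dl)%:C%C.
  rewrite /W v0; apply: (mulIf rC0); rewrite divfK // -rmorphM /dl.
  by congr (_%:C)%C; field; rewrite gt_eqF.
have tb z : nrm z <= s -> nrm (t z) <= 2 * e / eta.
  move=> zs; have z1 := le_lt_trans zs s1.
  have := schwarz_pick hW W1 z1 n0; rewrite oppr0 mob_0 W0.
  rewrite /mob nrmM nrmV.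
  have nw : nrm (- (1 - dl)%:C%C : C) < 1 by rewrite -W0 nrmN W1.
  have := mob_den nw (ltW (W1 z z1)).
  rewrite (_ : conjc (- (1 - dl)%:C%C) = - (1 - dl)%:C%C); last first.
    by apply: complex_ext; rewrite !reimE ?oppr0.
  rewrite mulNr -nrm_gt0 => d0; rewrite ler_pdivrMr // => h.
  have h2 : nrm (W z - (1 - dl)%:C%C) <= s * nrm (1 - (1 - dl)%:C%C * W z).
    by apply: le_trans h _; rewrite ler_wpM2r // nrm_ge0.
  have s01 : 0 <= s < 1 by rewrite ltW.
  have := close_to_one dl0 s01 h2 (ltW (W1 z z1)).
  have -> : t z = (r%:C)%C * (1 - W z) by rewrite /t /W; field.
  rewrite nrmM nr => h3.
  have -> : 2 * e / eta = r * (2 * dl / (1 - s)).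
    by rewrite /dl /s; field; rewrite !gt_eqF //; clear -eta0; lra.
  by rewrite ler_pM2l.
pose M := k * e.
have M1 : M <= 1 by rewrite /M mulrC -ler_pdivlMr // mul1r ltW.
have rr1 : r * (1 - r) <= 1.
  rewrite -[leRHS]mulr1; apply: ler_pM; rewrite ?ltW //.
  by rewrite gtrBl.
have rr0 : 0 < r * (1 - r) by rewrite mulr_gt0.
have eM : 2 * e / eta <= M * (r * (1 - r)).
  by rewrite /M /k le_eqVlt; apply/orP; left; apply/eqP; field; rewrite !gt_eqF.
have M0 : 0 < M by rewrite mulr_gt0.
have tM z : nrm z <= s -> nrm (t z) <= M.
  move=> zs; apply: le_trans (tb z zs) _; apply: le_trans eM _.
  by rewrite ler_piMr // ltW.
have uM z : nrm z <= s -> nrm (u z) ^+ 2 <= M.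
  move=> zs; have z1 := le_lt_trans zs s1; have [_ h] := bd z z1.
  apply: le_trans h _; rewrite ler_pdivrMr //; apply: le_trans eM.
  apply: le_trans (tb z zs).
  have := nrmD (v z) (t z); rewrite (_ : v z + t z = (r%:C)%C); last by rewrite /t; ring.
  by rewrite nr; clear; lra.
have ellb z : nrm z <= s -> - (27 * A * M ^+ 2) <= ell r (u z) (t z).
  move=> zs; have z1 := le_lt_trans zs s1.
  apply: (outer_est r0 r1 cr M1 (uM z zs) (tM z zs)).
  have [_] := Gc_uv (hG z z1); rewrite uE vE.
  by rewrite (_ : (r%:C)%C - t z = v z) // /t; ring.
have etaM : 27 * A * M ^+ 2 <= eta * e.
  have -> : 27 * A * M ^+ 2 = e * (27 * A * k ^+ 2) * e by rewrite /M; ring.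
  by rewrite ler_pM2r // -ler_pdivlMr // ltW.
pose g := Num.sqrt A.
have g0 : 0 < g by rewrite sqrtr_gt0.
have g2 : g ^+ 2 = A by rewrite sqr_sqrtr // ltW.
(* The holomorphic term [B * u ^+ 2] absorbs [kB * Re (u ^+ 2)] in [ell], and [eta * e] absorbs the
   error of [outer_est]. *)
pose Z z := t z - ((B)%:C)%C * u z ^+ 2 + ((eta * e)%:C)%C.
pose mu z := (g%:C)%C * u z.
have dZ z d d' : cder p z d -> cder q z d' ->
    cder Z z (- (u z * d - d') - ((B)%:C)%C * (2 * u z * (d / 2))).
  move=> h h'; have h1 := dv z d d' h h'; have h2 := cder_comp (du _ _ h) (cder_sqr _).
  apply: cder_eqd (cderD (cderB (cderB (cder_cst _ z) h1) (cderM (cder_cst ((B)%:C)%C z) h2)) (cder_cst _ z)) _.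
  by ring.
have hZ : holD Z.
  move=> z z1; have [d hd] := hp z z1; have [d' hd'] := hq z z1.
  by eexists; exact: dZ hd hd'.
have hmu : holD mu.
  by move=> z z1; have [d hd] := hu z z1; eexists; apply: cderM (cder_cst _ z) hd.
have s01 : 0 < s < 1 by rewrite s0.
have dZ0 : cder Z 0 (- y).
  by apply: cder_eqd (dZ _ _ _ dp dq) _; rewrite u0; ring.
have dmu0 : cder mu 0 ((g%:C)%C * x).
  by apply: cder_eqd (cderM (cder_cst ((g%:C)%C) 0) (du _ _ dp)) _; field.
pose s2 := e * (1 + eta).
have s20 : 0 < s2 by rewrite mulr_gt0 // addr_gt0.
have Z0 : Z ((s%:C)%C * 0) = (s2%:C)%C.
  rewrite mulr0 /Z /t v0 u0 expr2 mul0r mulr0 subr0 -rmorphB -rmorphD /s2.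
  by congr (_%:C)%C; ring.
have mu0 : mu ((s%:C)%C * 0) = 0 by rewrite mulr0 /mu u0 mulr0.
have main := siegel_schwarz s20 (holD_scale s01 hZ) (holD_scale s01 hmu) mu0 Z0
  (cder_scale s dZ0) (cder_scale s dmu0).
have {}main : nrm ((s%:C)%C * - y) ^+ 2 / (4 * s2 ^+ 2) +
    nrm ((s%:C)%C * ((g%:C)%C * x)) ^+ 2 / s2 <= 1.
  apply: main => z z1.
  have zs : nrm ((s%:C)%C * z) <= s.
    by rewrite nrmM nrm_real gtr0_norm // ler_piMr // ltW.
  move: (_ * z) zs => z' zs.
  have := ellb z' zs; rewrite /ell => h.
  have -> : Re (Z z') = Re (t z') - B * Re (u z' ^+ 2) + eta * e.
    by rewrite /Z ReD (ReD (t z')) ReN (ReM (B%:C)%C) !ReC ImC mul0r subr0.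
  rewrite /mu nrmM nrm_real gtr0_norm // exprMn g2; move: h etaM.
  set T := Re (t z'); set X := nrm _ ^+ 2; set Y := Re (u z' ^+ 2).
  rewrite -/A -/B; set M2 := M ^+ 2; move: (A) (B) => A' B' h etaM.
  by clear -h etaM; lra.
rewrite !nrmM nrmN !nrm_real !gtr0_norm // !exprMn g2 in main.
set X := nrm x ^+ 2 in main *; set Y := nrm y ^+ 2 in main *.
have X0 : 0 <= X by rewrite exprn_ge0 // nrm_ge0.
have e1 : 1 < 1 + eta by rewrite ltrDl.
rewrite expr_div_n ler_pdivlMr; last by rewrite exprn_gt0.
have E : s ^+ 2 * Y / (4 * (e ^+ 2 * (1 + eta) ^+ 2)) + s ^+ 2 * (A * X) / (e * (1 + eta)) =
  (s ^+ 2 * Y / (4 * e ^+ 2) + s ^+ 2 * (A * X) / e * (1 + eta)) / (1 + eta) ^+ 2.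
  by field; rewrite !gt_eqF // (lt_trans ltr01).
rewrite /s2 ?exprMn E ler_pdivrMr ?mul1r in main; last by rewrite exprn_gt0 // (lt_trans ltr01).
apply: le_trans main.
rewrite -/s mulrDl addrC; apply: lerD.
  by rewrite le_eqVlt; apply/orP; left; apply/eqP; ring.
rewrite (_ : A * X / e * s ^+ 2 = s ^+ 2 * (A * X) / e * 1); last by ring.
apply: ler_wpM2l; last exact: ltW.
apply: divr_ge0; last exact: ltW.
by apply: mulr_ge0; [apply: exprn_ge0; exact: ltW | apply: mulr_ge0 => //; exact: ltW].
Qed.
End Metrics.

(** * Covectors near the boundary point *)

Section Inner.
Variable R : realType.
Local Notation C := R[i].
Implicit Types (a b z w d u v t : C).

Lemma inv_conj z : z != 0 -> z^-1 = (((nrm z ^+ 2)^-1)%:C)%C * conjc z.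
Proof.
move=> z0; apply: (mulfI z0); rewrite mulfV // mulrCA mulc_conj -rmorphM mulVf //.
by rewrite expf_neq0 // nrm_eq0.
Qed.

Lemma Re_cayley z : 1 - z != 0 ->
  Re ((1 + z) / (1 - z)) = (1 - nrm z ^+ 2) / nrm (1 - z) ^+ 2.
Proof.
move=> z0; rewrite inv_conj //; move: (_^-1) => k.
by rewrite (nrm2 z) !reimE; ring.
Qed.

(** Dual to [outer_metric]: [F] is tested on a nearly extremal disc of [Gc c]. It comes from a
    linear disc of the ball by the inverse Cayley transform, in the direction dual to the
    differential of [F]; shrinking by [1 - eta] makes it fit into [Gc c]. *)
Lemma inner_metric (c r eta : R) : 0 < r -> r < 1 -> 2 * c * r = 1 + r ^+ 2 -> 0 < eta < 1 ->
  exists2 e0 : R, 0 < e0 & forall e : R, 0 < e < e0 ->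
  forall (F : C * C -> C) a b, cder2 F (0, - ((r - e)%:C)%C) a b ->
   F (0, - ((r - e)%:C)%C) = 0 ->
   (forall p q, discG c p q -> holD (fun z => F (p z, q z)) /\
      forall z, nrm z < 1 -> nrm (F (p z, q z)) <= 1) ->
   nrm (2 * a) ^+ 2 * (e / kA r) + 4 * e ^+ 2 * nrm b ^+ 2 <= ((1 - eta)^-1) ^+ 2.
Proof.
move=> r0 r1 cr /andP[eta0 eta1]; have A0 := kA_gt0 r0 r1.
have BA := kB_kA r0 r1.
set A := kA r in A0 BA *; set B := kB r in BA.
have B0 : 0 < B by rewrite BA mulr_gt0.
pose rho := Num.sqrt ((1 + r) / 2).
have rho0 : 0 <= rho by exact: sqrtr_ge0.
have rho1 : rho < 1.
  rewrite -(@ltr_pXn2r _ 2) ?nnegrE // expr1n sqr_sqrtr; first by move: r1; clear; lra.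
  by move: r0; clear; lra.
have q1 : 0 < 1 - rho by rewrite subr_gt0.
have eta2 : 0 < eta ^+ 2 by rewrite exprn_gt0.
have eta4 : 0 < eta ^+ 4 by rewrite exprn_gt0.
have r2 : 0 < r ^+ 2 by rewrite exprn_gt0.
have AE : 0 < A * eta ^+ 2 by exact: mulr_gt0.
have AEE (x : R) : x / A / eta ^+ 2 = x / (A * eta ^+ 2) by field; rewrite !gt_eqF.
(* Below these bounds the disc satisfies, in this order, [2 * |u|^2 < 1], [|u| < 1 - rho],
   [sqrt |v| <= rho], and [ell] is large enough for [inner_est]. *)
pose b1 := A * eta ^+ 2 / 4.
pose b2 := A * eta ^+ 2 * (1 - rho) ^+ 2.
pose b3 := eta ^+ 2 * (1 - r) / 6.
pose b4 := eta * (r ^+ 2 * eta ^+ 4) / (18 * A).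
have b10 : 0 < b1 by apply: divr_gt0 => //; exact: mulr_gt0.
have b20 : 0 < b2 by apply: mulr_gt0; [exact: mulr_gt0 | exact: exprn_gt0].
have b30 : 0 < b3 by apply: divr_gt0 => //; apply: mulr_gt0 => //; rewrite subr_gt0.
have b40 : 0 < b4 by apply: divr_gt0; [apply: mulr_gt0 => //; exact: mulr_gt0 | exact: mulr_gt0].
exists (Num.min (Num.min b1 b2) (Num.min b3 b4)).
  by rewrite !lt_min b10 b20 b30 b40.
move=> e; rewrite !lt_min => /andP[e0 /andP[/andP[eb1 eb2] /andP[eb3 eb4]]].
move=> F a b dF F0 HF.
pose s := 1 - eta.
have s0 : 0 < s by rewrite subr_gt0.
have s1 : s < 1 by rewrite gtrBl.
pose g := Num.sqrt (e / A).
have g0 : 0 < g by rewrite sqrtr_gt0 divr_gt0.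
have g2 : g ^+ 2 = e / A by rewrite sqr_sqrtr // ltW // divr_gt0.
pose A1 : C := 2 * a * (g%:C)%C; pose B1 : C := 2 * (e%:C)%C * b.
pose n2 := nrm A1 ^+ 2 + nrm B1 ^+ 2.
have n2E : nrm (2 * a) ^+ 2 * (e / A) + 4 * e ^+ 2 * nrm b ^+ 2 = n2.
  rewrite /n2 /A1 /B1 (nrmM (2 * a)) (nrmM _ b) (nrmM 2 (_%:C)%C) !nrm_real nrm2C !gtr0_norm //.
  by rewrite exprMn g2 !exprMn; congr (_ + _ * _ * _); ring.
rewrite n2E.
have n20 : 0 <= n2 by rewrite addr_ge0 // exprn_ge0 // nrm_ge0.
have [n2z|n2z] := eqVneq n2 0; first by rewrite n2z exprn_ge0 // invr_ge0 ltW.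
have n2p : 0 < n2 by rewrite lt_neqAle eq_sym n2z.
pose n := Num.sqrt n2.
have np : 0 < n by rewrite sqrtr_gt0.
have nn : n ^+ 2 = n2 by rewrite sqr_sqrtr.
have nC0 : (n%:C)%C != 0 :> C by rewrite -nrm_gt0 nrm_real gtr0_norm.
(* [(o1, o2)] has length [1 - eta] and is dual to [(B1, A1)], the differential of [F] in ball
   coordinates. *)
pose o1 : C := (s%:C)%C * (conjc B1 / (n%:C)%C).
pose o2 : C := (s%:C)%C * (conjc A1 / (n%:C)%C).
have no : nrm o1 ^+ 2 + nrm o2 ^+ 2 = s ^+ 2.
  rewrite /o1 /o2 !nrmM !nrmV !nrm_conj !nrm_real !gtr0_norm // !exprMn -mulrDr -mulrDl.
  by rewrite [nrm B1 ^+ 2 + _]addrC -/n2 -nn exprVn mulfV ?mulr1 // expf_neq0 // gt_eqF.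
have o1s : nrm o1 <= s.
  apply: nrm_le; first exact: ltW.
  by rewrite -no lerDl exprn_ge0 // nrm_ge0.
have o2s : nrm o2 <= s.
  apply: nrm_le; first exact: ltW.
  by rewrite -no lerDr exprn_ge0 // nrm_ge0.
pose den z : C := 1 - o1 * z.
have wz z o : nrm z < 1 -> nrm o <= s -> nrm (o * z) <= s.
  move=> z1 os; rewrite nrmM -[leRHS]mulr1; apply: ler_pM; rewrite ?nrm_ge0 // ltW //.
have den_ge z : nrm z < 1 -> eta <= nrm (den z).
  move=> z1; have := nrmB (den z) (- (o1 * z)).
  rewrite /den opprK subrK nrm1 nrmN; have := wz z o1 z1 o1s.
  by rewrite /s; set X := nrm (o1 * z); set Y := nrm _; clear; lra.
have den0 z : nrm z < 1 -> den z != 0.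
  by move=> z1; rewrite -nrm_gt0; apply: lt_le_trans (den_ge z z1).
pose Z z : C := (e%:C)%C * ((1 + o1 * z) / den z).
pose u z : C := (g%:C)%C * (o2 * z / den z).
pose v z : C := (r%:C)%C - (Z z + (B%:C)%C * u z ^+ 2).
pose p z : C := 2 * u z; pose q z : C := u z ^+ 2 - v z.
have dden z : cder den z (- o1).
  by apply: cder_eqd (cderB (cder_cst 1 z) (cderM (cder_cst o1 z) (cder_id z))) _; ring.
have dZ z : nrm z < 1 -> cder Z z ((e%:C)%C * (2 * o1 / den z ^+ 2)).
  move=> z1; have h := cderD (cder_cst 1 z) (cderM (cder_cst o1 z) (cder_id z)).
  apply: cder_eqd (cderM (cder_cst (e%:C)%C z) (cderM h (cderV (dden z) (den0 z z1)))) _.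
  by rewrite /den in den0 *; field; exact: den0.
have du z : nrm z < 1 -> cder u z ((g%:C)%C * (o2 / den z ^+ 2)).
  move=> z1; have h := cderM (cder_cst o2 z) (cder_id z).
  apply: cder_eqd (cderM (cder_cst (g%:C)%C z) (cderM h (cderV (dden z) (den0 z z1)))) _.
  by rewrite /den in den0 *; field; exact: den0.
have dp z : nrm z < 1 -> cder p z (2 * ((g%:C)%C * (o2 / den z ^+ 2))).
  by move=> z1; apply: cder_eqd (cderM (cder_cst 2 z) (du z z1)) _; ring.
have dq z : nrm z < 1 -> cder q z ((e%:C)%C * (2 * o1 / den z ^+ 2) +
    (1 + (B%:C)%C) * (2 * u z * ((g%:C)%C * (o2 / den z ^+ 2)))).
  move=> z1; have h2 := cder_comp (du z z1) (cder_sqr (u z)).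
  apply: cder_eqd (cderB h2 (cderB (cder_cst (r%:C)%C z) (cderD (dZ z z1) (cderM (cder_cst (B%:C)%C z) h2)))) _.
  by ring.
have n0 : nrm (0 : C) < 1 by rewrite nrm0.
have den00 : den 0 = 1 by rewrite /den mulr0 subr0.
have u0 : u 0 = 0 by rewrite /u mulr0 mul0r mulr0.
have Z0 : Z 0 = (e%:C)%C by rewrite /Z den00 mulr0 addr0 divr1 mulr1.
have p0 : p 0 = 0 by rewrite /p u0 mulr0.
have q0 : q 0 = - ((r - e)%:C)%C.
  by rewrite /q /v u0 Z0 expr2 mul0r mulr0 addr0 sub0r -rmorphB.
have uB z : nrm z < 1 -> nrm (u z) ^+ 2 <= e / A / eta ^+ 2.
  move=> z1; rewrite /u nrmM nrm_real gtr0_norm // exprMn g2.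
  apply: ler_wpM2l; first by apply: ltW; exact: divr_gt0.
  rewrite nrmM nrmV expr_div_n ler_pdivrMr; last first.
    by rewrite exprn_gt0 // nrm_gt0 den0.
  rewrite [leRHS]mulrC ler_pdivlMr // -exprMn.
  rewrite ler_pXn2r ?nnegrE ?mulr_ge0 ?nrm_ge0 //; last exact: ltW.
  apply: le_trans (den_ge z z1).
  rewrite ler_piMl //; first exact: ltW.
  by apply: le_trans (wz z o2 z1 o2s) _; exact: ltW.
have ZB z : nrm z < 1 -> nrm (Z z) <= 2 * e / eta.
  move=> z1; rewrite /Z nrmM nrm_real gtr0_norm // (_ : 2 * e / eta = e * (eta^-1 * 2)); last by ring.
  apply: ler_wpM2l; first exact: ltW.
  rewrite nrmM nrmV [leLHS]mulrC; apply: ler_pM; rewrite ?invr_ge0 ?nrm_ge0 //.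
    rewrite lef_pV2 ?posrE //; first exact: den_ge.
    by rewrite nrm_gt0 den0.
  apply: le_trans (nrmD _ _) _; rewrite nrm1 -[2]/(1 + 1) lerD2l.
  by apply: le_trans (wz z o1 z1 o1s) _; exact: ltW.
pose M := 3 * e / eta ^+ 2.
have tB z : nrm z < 1 -> nrm (Z z + (B%:C)%C * u z ^+ 2) <= M.
  move=> z1; apply: le_trans (nrmD _ _) _.
  have h1 : nrm (Z z) <= 2 * e / eta ^+ 2.
    apply: le_trans (ZB z z1) _; apply: ler_wpM2l; first by rewrite mulr_ge0 // ltW.
    by rewrite lef_pV2 ?posrE // expr2 ler_piMl // ltW.
  have h2 : nrm ((B%:C)%C * u z ^+ 2) <= e / eta ^+ 2.
    rewrite nrmM nrm_real gtr0_norm // nrmX.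
    apply: le_trans (_ : B * (e / A / eta ^+ 2) <= _).
      by rewrite ler_pM2l // uB.
    have -> : B * (e / A / eta ^+ 2) = r * (e / eta ^+ 2).
      by rewrite BA; field; rewrite !gt_eqF.
    by rewrite ler_piMl // ltW // divr_gt0.
  apply: le_trans (lerD h1 h2) _.
  by rewrite /M -mulrDl ler_pM2r ?invr_gt0 //; clear -e0; lra.
have hG : discG c p q.
  split; [by move=> z z1; eexists; exact: dp|by move=> z z1; eexists; exact: dq|].
  move=> z z1; apply: uv_Gc.
    have un : nrm (u z) < 1 - rho.
      apply: nrm_lt; first exact: ltW.
      apply: le_lt_trans (uB z z1) _.
      by rewrite AEE ltr_pdivrMr // mulrC.
    have vn : Num.sqrt (nrm (v z)) <= rho.
      apply: ler_wsqrtr; rewrite /v; apply: le_trans (nrmB _ _) _.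
      rewrite nrm_real gtr0_norm //; have := tB z z1.
      have : M <= (1 - r) / 2.
        rewrite /M ler_pdivrMr //; move: eb3; rewrite /b3; move: (eta ^+ 2) => E2.
        set P1 := (1 - r) / 2 * E2; have -> : E2 * (1 - r) / 6 = P1 / 3 by rewrite /P1; field.
        by clear; lra.
      by set X := nrm _; clear; lra.
    by move: un vn; set X := Num.sqrt _; set Y := nrm _; clear; lra.
  apply: (inner_est r0 r1 cr _ (tB z z1)).
    apply: le_lt_trans (_ : 2 * (e / A / eta ^+ 2) < 1); first by rewrite ler_pM2l // uB.
    rewrite AEE mulrA ltr_pdivrMr // mul1r.
    by move: eb1 AE; rewrite /b1; move: (A * eta ^+ 2) => T; clear; lra.
  have -> : ell r (u z) (Z z + (B%:C)%C * u z ^+ 2) = Re (Z z) - A * nrm (u z) ^+ 2.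
    rewrite /ell -/A -/B ReD (ReM (B%:C)%C) ReC ImC mul0r subr0; ring.
  have dn := den_ge z z1.
  have dn0 : 0 < nrm (den z) by apply: lt_le_trans dn.
  have E : Re (Z z) - A * nrm (u z) ^+ 2 =
      e * (1 - nrm (o1 * z) ^+ 2 - nrm (o2 * z) ^+ 2) / nrm (den z) ^+ 2.
    rewrite /u (nrmM (g%:C)%C) nrm_real gtr0_norm // exprMn g2 (nrmM (o2 * z)) nrmV expr_div_n.
    have -> : Re (Z z) = e * ((1 - nrm (o1 * z) ^+ 2) / nrm (den z) ^+ 2).
      rewrite /Z ReM ReC ImC mul0r subr0; congr (_ * _).
      by apply: Re_cayley; exact: den0.
    by field; rewrite !gt_eqF.
  rewrite E ltr_pdivlMr ?exprn_gt0 //.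
  have dn2 : nrm (den z) <= 2.
    rewrite /den; apply: le_trans (nrmB _ _) _; rewrite nrm1 -[2]/(1 + 1) lerD2l.
    by apply: le_trans (wz z o1 z1 o1s) _; exact: ltW.
  have os : nrm (o1 * z) ^+ 2 + nrm (o2 * z) ^+ 2 <= s ^+ 2.
    rewrite (nrmM o1) (nrmM o2) !exprMn -mulrDl no ler_piMr ?exprn_ge0 // ?ltW //.
    by rewrite -nrm_lt1.
  have se : s ^+ 2 <= 1 - eta.
    by rewrite -/s expr2 ler_piMl // ltW.
  apply: lt_le_trans (_ : e * eta <= _); last first.
    apply: ler_wpM2l; first exact: ltW.
    by move: os se; set X := nrm _ ^+ 2; set Y := nrm _ ^+ 2; clear; lra.
  apply: le_lt_trans (_ : A * M ^+ 2 / (2 * r ^+ 2) * 4 < _).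
    apply: ler_wpM2l.
      apply: divr_ge0; last by apply: mulr_ge0 => //; exact: ltW.
      by apply: mulr_ge0; [exact: ltW | exact: sqr_ge0].
    rewrite (_ : 4 = 2 ^+ 2 :> R); last by ring.
    by rewrite ler_pXn2r ?nnegrE // ltW.
  rewrite (_ : A * M ^+ 2 / (2 * r ^+ 2) * 4 = e * (18 * A * e / (r ^+ 2 * eta ^+ 4))); last first.
    by rewrite /M; field; rewrite !gt_eqF.
  rewrite ltr_pM2l // ltr_pdivrMr; last exact: mulr_gt0.
  move: eb4; rewrite /b4 ltr_pdivlMr; last exact: mulr_gt0.
  by rewrite [e * _]mulrC.
have [hF F1] := HF p q hG.
have dF' : cder2 F (p 0, q 0) a b by rewrite p0 q0.
have dD := cder2_disc dF' (dp 0 n0) (dq 0 n0).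
have fz : F (p 0, q 0) = 0 by rewrite p0 q0.
have := schwarz_der hF fz dD F1.
rewrite den00 u0 expr1n !divr1.
have -> : a * (2 * ((g%:C)%C * o2)) +
    b * ((e%:C)%C * (2 * o1) + (1 + (B%:C)%C) * (2 * 0 * ((g%:C)%C * o2))) =
    A1 * o2 + B1 * o1 by rewrite /A1 /B1; ring.
have -> : A1 * o2 + B1 * o1 = ((s * n)%:C)%C.
  rewrite /o1 /o2.
  transitivity ((s%:C)%C * ((A1 * conjc A1 + B1 * conjc B1) / (n%:C)%C)); first by ring.
  by rewrite !mulc_conj -rmorphD -/n2 -nn rmorphXn expr2 mulfK // -rmorphM.
rewrite nrm_real gtr0_norm ?mulr_gt0 // => h.
rewrite -nn; apply: lerXn2r; rewrite ?nnegrE ?invr_ge0 ?(ltW np) ?(ltW s0) //.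
by rewrite -/s -[leRHS]div1r ler_pdivlMr // mulrC.
Qed.
End Inner.

(** * The orbit of the origin *)

Section Center.
Variable R : realType.
Local Notation C := R[i].
Implicit Types (a b z w d u v t : C) (x : C * C).

(* Up to sign a left inverse of [z |-> (2 z, z ^+ 2)]; composing it with [(s, p) |-> (- s, p)]
   gives a second one, and both take [(0, p)] to [p]. *)
Definition royal_inv x : C := (2 * x.2 - x.1) / (2 - x.1).

Lemma nrm_sum_lt2 z w : nrm z < 1 -> nrm w < 1 -> 2 - (z + w) != 0.
Proof.
move=> z1 w1; apply/eqP => h.
have E : z + w = 2 by rewrite -[LHS]add0r -h; ring.
by have := nrmD z w; rewrite E nrm2C; move: z1 w1; clear; lra.
Qed.

Lemma royal_inv_le1 (c : R) x : Gc c x -> nrm (royal_inv x) <= 1.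
Proof.
move=> /GcP[z [w [z1 w1 -> _]]]; have d0 := nrm_sum_lt2 z1 w1.
rewrite /royal_inv /= nrmM nrmV ler_pdivrMr ?nrm_gt0 // mul1r.
apply: nrm_le; first exact: nrm_ge0.
(* With [X = 1 - |z|^2] and [Y = 1 - |w|^2] the claim becomes
   [X * Y <= X * (1 - Re w) + Y * (1 - Re z)], which follows from [(1 - |y|^2) / 2 <= 1 - Re y]. *)
have E : nrm (2 - (z + w)) ^+ 2 - nrm (2 * (z * w) - (z + w)) ^+ 2 =
   4 * ((1 - nrm z ^+ 2) * (1 - Re w) + (1 - nrm w ^+ 2) * (1 - Re z)
        - (1 - nrm z ^+ 2) * (1 - nrm w ^+ 2)).
  by rewrite -[2]/(1 + 1 : C) !nrm2 !reimE; ring.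
rewrite -subr_ge0 E; apply: mulr_ge0 => //.
have half (y : C) : nrm y < 1 -> (1 - nrm y ^+ 2) / 2 <= 1 - Re y /\ 0 <= 1 - nrm y ^+ 2.
  move=> y1; have := le_trans (ler_norm _) (Re_le_nrm y).
  have q : 0 <= (1 - nrm y) * (1 - nrm y) by rewrite -expr2 sqr_ge0.
  have q2 : nrm y ^+ 2 < 1 by rewrite -nrm_lt1.
  by split; [move: q q2; clear -H; lra | rewrite subr_ge0 ltW].
have [hz1 hz2] := half z z1; have [hw1 hw2] := half w w1.
have p1 := ler_wpM2l hz2 hw1; have p2 := ler_wpM2l hw2 hz1.
move: p1 p2; set X := 1 - nrm z ^+ 2; set Y := 1 - nrm w ^+ 2.
by clear; lra.
Qed.

Lemma Gc_neg (c : R) x : Gc c x -> Gc c (- x.1, x.2).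
Proof.
move=> /GcP[z [w [z1 w1 -> h]]]; apply/GcP; exists (- z), (- w).
rewrite !nrmN; split => //; first by congr pair; rewrite /=; ring.
by move: h; rewrite /tube !nrmN -opprD nrmN.
Qed.

Lemma discG_map (c : R) (f : Cx2 R -> Cx2 R) (p q : C -> C) :
  holo_on (Gc c) f -> (forall x, Gc c x -> Gc c (f x)) -> discG c p q ->
  discG c (fun z => (f (p z, q z)).1) (fun z => (f (p z, q z)).2).
Proof.
move=> hf fG [hp hq hG].
have key z : nrm z < 1 -> exists a b,
    cder (fun z => (f (p z, q z)).1) z a /\ cder (fun z => (f (p z, q z)).2) z b.
  move=> z1; have [a [b [a' [b' [h1 h2]]]]] := differentiable_cder2 (hf _ (hG z z1)).
  have [d hd] := hp z z1; have [e he] := hq z z1.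
  by do 2 eexists; split; [exact: (cder2_disc h1 hd he) | exact: (cder2_disc h2 hd he)].
split.
- by move=> z /key[a [b [ha _]]]; exists a.
- by move=> z /key[a [b [_ hb]]]; exists b.
- by move=> z z1; rewrite -surjective_pairing; apply: fG; exact: hG.
Qed.

Lemma royal_disc (c : R) : discG c (fun z => 2 * z) (fun z => z ^+ 2).
Proof.
split.
- by move=> z _; eexists; exact: cderM (cder_cst 2 z) (cder_id z).
- by move=> z _; eexists; exact: cder_sqr.
- by move=> z; exact: royal_Gc.
Qed.

Lemma leaf_disc (c r : R) : 0 < r -> r < 1 -> 2 * c * r = 1 + r ^+ 2 ->
  discG c (fun=> 0) (fun z => - ((r%:C)%C * z)).
Proof.
move=> r0 r1 cr; split.
- by move=> z _; exists 0; exact: cder_cst.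
- by move=> z _; eexists; exact: cderN (cderM (cder_cst (r%:C)%C z) (cder_id z)).
- move=> z z1; apply: (leaf_Gc r0 r1 cr); rewrite nrmM nrm_real gtr0_norm //.
  by rewrite -[ltRHS]mulr1 ltr_pM2l.
Qed.

(** The sign [s] selects one of the two left inverses of the royal disc. *)
Lemma royal_inv_map (c : R) (g : Cx2 R -> Cx2 R) (s : C) (q : C * C) : s = 1 \/ s = -1 ->
  holo_on (Gc c) g -> (forall x, Gc c x -> Gc c (g x)) ->
  (Gc c q -> exists a b, cder2 (fun x => royal_inv (s * (g x).1, (g x).2)) q a b) /\
  (Gc c q -> nrm (royal_inv (s * (g q).1, (g q).2)) <= 1).
Proof.
move=> s1 hg gG.
have sG x : Gc c x -> Gc c (s * x.1, x.2).
  case: s1 => ->; first by rewrite mul1r -surjective_pairing.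
  by rewrite mulN1r; exact: Gc_neg.
split; last by move=> hq; apply: royal_inv_le1; apply: sG; exact: gG.
move=> hq; have [a [b [a' [b' [h1 h2]]]]] := differentiable_cder2 (hg _ hq).
have d0 : 2 - s * (g q).1 != 0.
  have /GcP[z [w [z1 w1 E _]]] := sG _ (gG _ hq).
  have -> : s * (g q).1 = z + w by case: E.
  exact: nrm_sum_lt2.
have k1 := cder2M (cder2_cst s q) h1.
have k2 := cder2M (cder2_cst 2 q) h2.
do 2 eexists; rewrite /royal_inv /=.
exact: cder2M (cder2B k2 k1) (cder2V (cder2B (cder2_cst 2 q) k1) d0).
Qed.

(** Cauchy-Schwarz for the dual Hermitian norms of [outer_metric] and [inner_metric], after a
    rescaling of the two axes that makes both Euclidean. *)
Lemma dual_CS (A e : R) a b u v : 0 < A -> 0 < e ->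
  nrm (2 * a * u - b * v) ^+ 2 <=
   (nrm (2 * a) ^+ 2 * (e / A) + 4 * e ^+ 2 * nrm b ^+ 2) *
   (A * nrm u ^+ 2 / e + nrm v ^+ 2 / (4 * e ^+ 2)).
Proof.
move=> A0 e0; pose g := Num.sqrt (e / A).
have g0 : 0 < g by rewrite sqrtr_gt0 divr_gt0.
have g2 : g ^+ 2 = e / A by rewrite sqr_sqrtr // ltW // divr_gt0.
have gC : (g%:C)%C != 0 :> C by rewrite -nrm_gt0 nrm_real gtr0_norm.
have eC : (e%:C)%C != 0 :> C by rewrite -nrm_gt0 nrm_real gtr0_norm.
have := nrm_CS (2 * a * (g%:C)%C) (- (2 * (e%:C)%C * b)) (u / (g%:C)%C) (v / (2 * (e%:C)%C)).
have -> : 2 * a * (g%:C)%C * (u / (g%:C)%C) + - (2 * (e%:C)%C * b) * (v / (2 * (e%:C)%C)) =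
   2 * a * u - b * v.
  by field; rewrite gC eC.
rewrite nrmN (nrmM (2 * a)) (nrmM _ b) (nrmM u) (nrmM v) !nrmV !(nrmM 2 (_%:C)%C) !nrm_real nrm2C !gtr0_norm //.
rewrite !exprMn !exprVn !exprMn g2.
congr (_ <= (_ + _) * (_ + _)).
- by ring.
- by field; rewrite !gt_eqF.
- by congr (_ / _); ring.
Qed.

Lemma center_not_near (c r : R) : 0 < r -> r < 1 -> 2 * c * r = 1 + r ^+ 2 ->
  exists2 e0 : R, 0 < e0 & forall e : R, 0 < e < e0 ->
  forall f : Cx2 R -> Cx2 R, is_aut (Gc c) f -> f (0, 0) <> (0, - ((r - e)%:C)%C).
Proof.
(* Small enough that [(1 + 16 * eta) * (1 - eta) ^+ 4] exceeds [(1 + eta) ^+ 2], which is the final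
   contradiction. *)
move=> r0 r1 cr; pose eta := r ^+ 2 / 16.
have r21 : r ^+ 2 < 1 by rewrite expr_lt1 // ltW.
have eta0 : 0 < eta by rewrite divr_gt0 // exprn_gt0.
have eta16 : eta < 1 / 16 by rewrite /eta; move: r21; clear; lra.
have eta1 : eta < 1 by move: eta16; clear; lra.
have etab : 0 < eta < 1 by rewrite eta0.
have [e1 e10 H1] := outer_metric r0 r1 cr etab.
have [e2 e20 H2] := inner_metric r0 r1 cr etab.
exists (Num.min e1 e2); first by rewrite lt_min e10 e20.
move=> e /andP[e0]; rewrite lt_min => /andP[ee1 ee2] f [hf fG [g [hg gG gf fg]]] f0.
have A0 := kA_gt0 r0 r1.
set q0 : C * C := (0, - ((r - e)%:C)%C) in f0.
have n0 : nrm (0 : C) < 1 by rewrite nrm0.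
have G0 : Gc c ((0, 0) : C * C).
  by have := royal_Gc c n0; rewrite mulr0 expr2 mul0r.
have Gq : Gc c q0 by rewrite -f0; exact: fG.
have D1 := discG_map hf fG (royal_disc c).
have D2 := discG_map hf fG (leaf_disc r0 r1 cr).
set P1 := (fun z : C => (f (2 * z, z ^+ 2)).1) in D1.
set Q1 := (fun z : C => (f (2 * z, z ^+ 2)).2) in D1.
set P2 := (fun z : C => (f (0, - ((r%:C)%C * z))).1) in D2.
set Q2 := (fun z : C => (f (0, - ((r%:C)%C * z))).2) in D2.
have c1 : (P1 0, Q1 0) = q0.
  by rewrite /P1 /Q1 mulr0 expr2 mul0r -surjective_pairing.
have c2 : (P2 0, Q2 0) = q0.
  by rewrite /P2 /Q2 mulr0 oppr0 -surjective_pairing.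
have metric (P Q : C -> C) : discG c P Q -> (P 0, Q 0) = q0 -> exists x y : C,
   [/\ cder P 0 (2 * x), cder Q 0 (- y) &
    kA r * nrm x ^+ 2 / e + nrm y ^+ 2 / (4 * e ^+ 2) <= ((1 + eta) / (1 - eta)) ^+ 2].
  move=> D [p0 q0']; have [hP hQ _] := D.
  have [d hd] := hP 0 n0; have [d' hd'] := hQ 0 n0.
  have hx : cder P 0 (2 * (d / 2)) by apply: cder_eqd hd _; field.
  have hy : cder Q 0 (- - d') by rewrite opprK.
  exists (d / 2), (- d'); split => //.
  by apply: (H1 e _ P Q _ _ D p0 q0' hx hy); rewrite e0.
have [x1 [y1 [dx1 dy1 m1]]] := metric _ _ D1 c1.
have [x2 [y2 [dx2 dy2 m2]]] := metric _ _ D2 c2.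
have dual (s : C) : s = 1 \/ s = -1 -> exists a b,
   [/\ 2 * a * x1 - b * y1 = - s, 2 * a * x2 - b * y2 = - (r%:C)%C &
   nrm (2 * a) ^+ 2 * (e / kA r) + 4 * e ^+ 2 * nrm b ^+ 2 <= ((1 - eta)^-1) ^+ 2].
  move=> s1; have ss : s * s = 1 by case: s1 => ->; rewrite ?mulrNN mulr1.
  have [/(_ Gq)[a [b hab]] _] := royal_inv_map q0 s1 hg gG.
  (* The sign [s] shows in the value on the royal disc and disappears in the value [Fl] on the
     leaf. *)
  have Fr z : nrm z < 1 -> royal_inv (s * (g (P1 z, Q1 z)).1, (g (P1 z, Q1 z)).2) = - s * z.
    move=> z1; rewrite -surjective_pairing gf; last exact: royal_Gc.
    have zs : nrm (s * z) < 1 by case: s1 => ->; rewrite ?mul1r ?mulN1r ?nrmN.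
    have d0 := nrm_sum_lt2 zs zs.
    rewrite /royal_inv /=; apply: (mulIf (_ : 2 - s * (2 * z) != 0)).
      by rewrite (_ : s * (2 * z) = s * z + s * z) //; ring.
    rewrite divfK; last by rewrite (_ : s * (2 * z) = s * z + s * z) //; ring.
    transitivity (2 * ((s * s) * z ^+ 2) - s * (2 * z)); first by rewrite ss mul1r.
    by ring.
  have Fl z : nrm z < 1 -> royal_inv (s * (g (P2 z, Q2 z)).1, (g (P2 z, Q2 z)).2) = - (r%:C)%C * z.
    move=> z1; rewrite -surjective_pairing gf; last by have [_ _] := leaf_disc r0 r1 cr; apply.
    by rewrite /royal_inv /= mulr0 !subr0; field.
  have F0 : royal_inv (s * (g q0).1, (g q0).2) = 0.
    by have := Fr 0 n0; rewrite c1 mulr0.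
  have deriv (P Q : C -> C) d d' k : (P 0, Q 0) = q0 -> cder P 0 d -> cder Q 0 d' ->
      (forall z, nrm z < 1 -> royal_inv (s * (g (P z, Q z)).1, (g (P z, Q z)).2) = k * z) ->
      a * d + b * d' = k.
    move=> cq hd hd' E.
    have h : cder2 (fun x => royal_inv (s * (g x).1, (g x).2)) (P 0, Q 0) a b by rewrite cq.
    apply: cder_uniq (cder2_disc h hd hd') _.
    apply: cder_near ltr01 _ (cder_eqd (cderM (cder_cst k 0) (cder_id 0)) _).
      by move=> z; rewrite subr0 => z1; rewrite E.
    by ring.
  exists a, b; split.
  - by rewrite -(deriv _ _ _ _ _ c1 dx1 dy1 Fr); ring.
  - by rewrite -(deriv _ _ _ _ _ c2 dx2 dy2 Fl); ring.
  - apply: (H2 e _ _ _ _ hab F0); first by rewrite e0.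
    move=> p q D; have [hp hq hG] := D; split; last first.
      by move=> z z1; have [_] := royal_inv_map (p z, q z) s1 hg gG; apply; exact: hG.
    move=> z z1; have [/(_ (hG z z1))[a' [b' h]] _] := royal_inv_map (p z, q z) s1 hg gG.
    have [d hd] := hp z z1; have [d' hd'] := hq z z1.
    by eexists; exact: cder2_disc h hd hd'.
have [a [b [ab1 ab2 n1]]] := dual 1 (or_introl erefl).
have [a' [b' [ab1' ab2' n1']]] := dual (-1) (or_intror erefl).
pose N (p q : C) := nrm (2 * p) ^+ 2 * (e / kA r) + 4 * e ^+ 2 * nrm q ^+ 2.
pose K := ((1 + eta) / (1 - eta)) ^+ 2.
have N_ge0 (p q : C) : 0 <= N p q.
  apply: addr_ge0.
    by apply: mulr_ge0; [exact: sqr_ge0 | apply: ltW; exact: divr_gt0].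
  by apply: mulr_ge0; [apply: mulr_ge0 => //; exact: sqr_ge0 | exact: sqr_ge0].
have use : forall (p q x y : C) (m : R), nrm (2 * p * x - q * y) ^+ 2 = m ->
    kA r * nrm x ^+ 2 / e + nrm y ^+ 2 / (4 * e ^+ 2) <= K -> m <= N p q * K.
  move=> p q x y m <- hK; apply: le_trans (dual_CS p q x y A0 e0) _.
  rewrite -/(N p q); exact: (ler_wpM2l (N_ge0 p q) hK).
(* The half difference of the two covectors pairs to [-1] with the royal disc, their half
   sum to [-r] with the leaf. *)
have u1 : 1 <= N ((a - a') / 2) ((b - b') / 2) * K.
  apply: use m1; rewrite (_ : _ - _ = ((2 * a * x1 - b * y1) - (2 * a' * x1 - b' * y1)) / 2); last by field.
  by rewrite ab1 ab1' (_ : (- 1 - - -1) / 2 = - 1 :> C) ?nrmN ?nrm1 ?expr1n //; field.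
have u2 : r ^+ 2 <= N ((a + a') / 2) ((b + b') / 2) * K.
  apply: use m2; rewrite (_ : _ - _ = ((2 * a * x2 - b * y2) + (2 * a' * x2 - b' * y2)) / 2); last by field.
  rewrite ab2 ab2' (_ : (- (r%:C)%C - (r%:C)%C) / 2 = - (r%:C)%C :> C); last by field.
  by rewrite nrmN nrm_real gtr0_norm.
have para : N ((a - a') / 2) ((b - b') / 2) + N ((a + a') / 2) ((b + b') / 2) =
    (N a b + N a' b') / 2.
  have := nrm_sqr_sum a a'; have := nrm_sqr_sum b b'.
  rewrite /N !nrmM !nrmV nrm2C !exprMn !exprVn.
  set X := nrm (a - a') ^+ 2; set Y := nrm (a + a') ^+ 2.
  set X' := nrm (b - b') ^+ 2; set Y' := nrm (b + b') ^+ 2.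
  move=> h1 h2.
  have -> : X = 2 * (nrm a ^+ 2 + nrm a' ^+ 2) - Y by rewrite -h2; ring.
  have -> : X' = 2 * (nrm b ^+ 2 + nrm b' ^+ 2) - Y' by rewrite -h1; ring.
  by field; rewrite gt_eqF.
have K0 : 0 <= K by exact: sqr_ge0.
have fin : 1 + r ^+ 2 <= ((1 - eta)^-1) ^+ 2 * K.
  have : N ((a - a') / 2) ((b - b') / 2) + N ((a + a') / 2) ((b + b') / 2) <= ((1 - eta)^-1) ^+ 2.
    rewrite para ler_pdivrMr //; have := lerD n1 n1'; rewrite -/(N a b) -/(N a' b').
    by move: (_ ^+ 2) => W; clear; lra.
  move/(ler_wpM2r K0); apply: le_trans; rewrite mulrDl; exact: lerD.
have s0 : 0 < 1 - eta by rewrite subr_gt0.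
have E : ((1 - eta)^-1) ^+ 2 * K = (1 + eta) ^+ 2 / (1 - eta) ^+ 4.
  by rewrite /K; field; rewrite gt_eqF.
rewrite E ler_pdivlMr ?exprn_gt0 // in fin.
have r2E : r ^+ 2 = 16 * eta by rewrite /eta; field.
rewrite r2E in fin.
have q1 : 1 - 4 * eta <= (1 - eta) ^+ 4.
  rewrite -subr_ge0 (_ : _ - _ = eta ^+ 2 * ((2 - eta) ^+ 2 + 2)); last by ring.
  by apply: mulr_ge0; [exact: sqr_ge0 | apply: addr_ge0 => //; exact: sqr_ge0].
have q2 : (1 + 16 * eta) * (1 - 4 * eta) <= (1 + eta) ^+ 2.
  apply: le_trans fin; apply: ler_wpM2l => //; first by move: eta0; clear; lra.
have q3 : eta * eta < eta * (1 / 16) by rewrite ltr_pM2l.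
by move: q2 q3 eta0; clear; lra.
Qed.
End Center.

(** * Invariance of the royal disc *)

Section Royal.
Variable R : realType.
Local Notation C := R[i].
Implicit Types (a b z w d u v t : C) (x : C * C).

Lemma is_aut_comp (K : numFieldType) (V : normedModType K) (U : set V) (f g : V -> V) :
  is_aut U f -> is_aut U g -> is_aut U (f \o g).
Proof.
move=> [hf fU [f' [hf' f'U f'f ff']]] [hg gU [g' [hg' g'U g'g gg']]].
split.
- by move=> x Ux; apply: differentiable_comp; [exact: hg | apply: hf; exact: gU].
- by move=> x Ux; apply: fU; exact: gU.
exists (g' \o f'); split.
- by move=> x Ux; apply: differentiable_comp; [exact: hf' | apply: hg'; exact: f'U].
- by move=> x Ux; apply: g'U; exact: f'U.
- by move=> x Ux; rewrite /= f'f ?g'g //; exact: gU.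
- by move=> x Ux; rewrite /= gg' ?ff' //; exact: f'U.
Qed.

Lemma Hm_origin a : nrm a < 1 -> Hm 1 a (0, 0) = (2 * a, a ^+ 2).
Proof.
move=> a1; have n0 : nrm (0 : C) < 1 by rewrite nrm0.
have := HmE 1 a1 n0 n0; rewrite addr0 mulr0 mob0 !mul1r => ->.
by congr pair; ring.
Qed.

Lemma Hm_royal tau a z : nrm a < 1 -> nrm z < 1 ->
  Hm tau a (2 * z, z ^+ 2) = (2 * (tau * mob a z), (tau * mob a z) ^+ 2).
Proof.
move=> a1 z1; have := HmE tau a1 z1 z1.
by rewrite (_ : z + z = 2 * z) -?expr2; [move=> ->; congr pair; ring | ring].
Qed.

Lemma Hm_rot tau v : Hm tau 0 (0, - v) = (0, - (tau ^+ 2 * v)).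
Proof.
have c0 : conjc (0 : C) = 0 by exact: rmorph0.
transitivity ((tau * (0 * (1 + 0 * conjc 0) + 2 * conjc 0 * (- v) + 2 * 0) /
    (1 + conjc 0 * 0 + conjc 0 ^+ 2 * (- v)),
   tau ^+ 2 * (- v + 0 * 0 + 0 ^+ 2) / (1 + conjc 0 * 0 + conjc 0 ^+ 2 * (- v))) : C * C).
  by [].
by rewrite c0 (expr2 (0 : C)) !(mul0r, mulr0, addr0) ?divr1 ?mulr0 mulrN ?divr1.
Qed.

(** Schwarz-Pick read as a lower bound that depends on [F] only through [F 0]. It turns a chain of
    discs into a bound independent of the maps. *)
Lemma sp_low (F : C -> C) z : holD F -> (forall z, nrm z < 1 -> nrm (F z) < 1) -> nrm z < 1 ->
  (1 - nrm z ^+ 2) * (1 - nrm (F 0)) ^+ 2 <= 1 - nrm (F z) ^+ 2.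
Proof.
move=> hF F1 z1; have n0 : nrm (0 : C) < 1 by rewrite nrm0.
have F01 := F1 _ n0; have Fz1 := F1 _ z1.
have nF : nrm (- F 0) < 1 by rewrite nrmN.
have := schwarz_pick hF F1 z1 n0; rewrite oppr0 mob_0 => sp.
have m2 : nrm (mob (- F 0) (F z)) ^+ 2 <= nrm z ^+ 2.
  by rewrite ler_pXn2r ?nnegrE ?nrm_ge0.
have := mob_nrm nF (ltW Fz1).
have d0 := mob_den nF (ltW Fz1); rewrite -nrm_gt0 in d0.
move: (mob _ _) m2 => m m2 E.
have h : (1 - nrm z ^+ 2) * nrm (1 + conjc (- F 0) * F z) ^+ 2 <= 1 - nrm (F z) ^+ 2.
  apply: le_trans (_ : (1 - nrm m ^+ 2) * nrm (1 + conjc (- F 0) * F z) ^+ 2 <= _).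
    by apply: ler_wpM2r; [exact: sqr_ge0 | rewrite lerD2l lerN2].
  rewrite E divfK; last by rewrite expf_neq0 // gt_eqF.
  rewrite ler_piMl //; first by rewrite subr_ge0 expr_le1 ?nrm_ge0 // ltW.
  by rewrite gerBl sqr_ge0.
apply: le_trans h; apply: ler_wpM2l; first by rewrite subr_ge0 expr_le1 ?nrm_ge0 // ltW.
apply: lerXn2r; rewrite ?nnegrE ?nrm_ge0 ?subr_ge0 ?(ltW F01) //.
have := nrmB (1 + conjc (- F 0) * F z) (conjc (- F 0) * F z); rewrite addrK nrm1 nrmM nrm_conj nrmN.
have : nrm (F 0) * nrm (F z) <= nrm (F 0) by rewrite ler_piMr ?nrm_ge0 // ltW.
by clear; lra.
Qed.

(** By [Hm_rot] a rotation multiplies [v] by [tau ^+ 2], so a square root of the phase is needed. *)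
Lemma exists_sqrt_phase v : v != 0 -> exists tau : C, nrm tau = 1 /\ tau ^+ 2 * v = ((nrm v)%:C)%C.
Proof.
move=> v0; exists (sqrtc (((nrm v)%:C)%C / v)).
have nv : 0 < nrm v by rewrite nrm_gt0.
rewrite sqr_sqrtc divfK //; split => //.
have : nrm (sqrtc (((nrm v)%:C)%C / v)) ^+ 2 = 1.
  by rewrite -nrmX sqr_sqrtc nrmM nrmV nrm_real gtr0_norm // mulfV // gt_eqF.
by move/eqP; rewrite sqrp_eq1 ?nrm_ge0 // => /eqP.
Qed.

(** Undoing [Hm 1 a] and rotating [v] to its modulus reduces this to [center_not_near] with
    [e = r - |v|]. What matters is that [e0] is chosen before [f]. *)
Lemma center_bound (c r : R) : 0 < r -> r < 1 -> 2 * c * r = 1 + r ^+ 2 ->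
  exists2 e0 : R, 0 < e0 < r & forall f : Cx2 R -> Cx2 R, is_aut (Gc c) f ->
  forall a v, nrm a < 1 -> nrm v < r -> f (0, 0) = Hm 1 a (0, - v) -> nrm v <= r - e0.
Proof.
move=> r0 r1 cr; have [e1 e10 H] := center_not_near r0 r1 cr.
exists (Num.min e1 r / 2).
  rewrite divr_gt0 ?lt_min ?e10 //=.
  have : Num.min e1 r <= r by rewrite ge_min lexx orbT.
  by move: r0; clear; lra.
move=> f hf a v a1 vr fE; rewrite leNgt; apply/negP => h.
have h2 : r - e1 < nrm v.
  have : Num.min e1 r <= e1 by rewrite ge_min lexx.
  by move: h e10; clear; lra.
have v0 : v != 0.
  rewrite -nrm_gt0; apply: lt_trans h.
  have : Num.min e1 r <= r by rewrite ge_min lexx orbT.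
  by move: r0; clear; lra.
have [tau [t1 tv]] := exists_sqrt_phase v0.
have n1 : nrm (1 : C) = 1 by exact: nrm1.
have n0 : nrm (0 : C) < 1 by rewrite nrm0.
have na : nrm (- a) < 1 by rewrite nrmN.
have A := is_aut_comp (Hm_aut c t1 n0) (is_aut_comp (Hm_aut c n1 na) hf).
apply: (H (r - nrm v) _ _ A).
  by rewrite subr_gt0 vr /=; move: h2; clear; lra.
have G : Gc c (0, - v) by exact: (leaf_Gc r0 r1 cr).
rewrite /= fE; have := Hm_inv n1 a1 G.
rewrite (_ : conjc (1 : C) = 1) ?mulr1; last by rewrite rmorph1.
by move=> ->; rewrite Hm_rot tv; congr (_, - (_%:C)%C); ring.
Qed.

Lemma ucoord_disc (c : R) x : Gc c x -> nrm (ucoord x) < 1.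
Proof.
move=> /Gc_uv[h _]; rewrite nrm_lt1; apply: le_lt_trans h.
by rewrite lerDl nrm_ge0.
Qed.

Lemma holD_coord (c : R) (p q : C -> C) : discG c p q ->
  holD (fun z => ucoord (p z, q z)) /\ holD (fun z => vcoord (p z, q z)).
Proof.
move=> [hp hq _]; split => z z1; have [d hd] := hp z z1; have [d' hd'] := hq z z1.
  by eexists; exact: cderM hd (cder_cst _ z).
by eexists; exact: cderB (cderM (cder_comp hd (cder_sqr _)) (cder_cst _ z)) hd'.
Qed.

Lemma royal_preserved (c : R) (f : Cx2 R -> Cx2 R) : 1 < c -> is_aut (Gc c) f ->
  forall z, nrm z < 1 -> vcoord (f (2 * z, z ^+ 2)) = 0.
Proof.
move=> c1 hf; have [r [r0 r1 cr]] := exists_radius c1.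
have [e0 /andP[e00 e0r] He] := center_bound r0 r1 cr.
have [hof fG [g [hog gG gf fg]]] := hf.
have n0 : nrm (0 : C) < 1 by rewrite nrm0.
have D1 := discG_map hof fG (royal_disc c).
have [_ hv] := holD_coord D1.
have hv' z : nrm z < 1 -> exists d, cder (fun z => vcoord (f (2 * z, z ^+ 2))) z d.
  move=> z1; have [d hd] := hv z z1; exists d.
  by apply: cder_near ltr01 _ hd => w _; rewrite -surjective_pairing.
suff key (k : R) : 0 < k -> forall z, nrm z < 1 -> nrm (vcoord (f (2 * z, z ^+ 2))) <= k.
  move=> z z1; apply/eqP; rewrite -nrm_eq0; apply/eqP/le_anti; rewrite nrm_ge0 andbT.
  by apply/ler_addgt0Pr => k k0; rewrite add0r; exact: key.
move=> k0.
pose w0 := ucoord (g (0, 0)).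
have G0 : Gc c ((0, 0) : C * C).
  by have := royal_Gc c n0; rewrite mulr0 expr2 mul0r.
have w01 : nrm w0 < 1 by apply: ucoord_disc; exact: gG.
(* If [|vcoord|] exceeds [k] at the image of [(2 * l, l ^+ 2)], then [k1], [k2], [k3] are lower
   bounds for one minus the squared modulus of the base point [a] of its leaf, of [F2 a] and of [l].
   Beyond the radius [rho] the last bound fails. *)
pose k1 := k * (1 - r) ^+ 2.
have k10 : 0 < k1 by apply: mulr_gt0 => //; rewrite exprn_gt0 // subr_gt0.
pose k2 := k1 * (1 - nrm w0) ^+ 2.
have k20 : 0 < k2 by apply: mulr_gt0 => //; rewrite exprn_gt0 // subr_gt0.
pose k3 := (1 - ((r - e0) / r) ^+ 2) * (k2 / 2) ^+ 2.
have k30 : 0 < k3.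
  apply: mulr_gt0; last by rewrite exprn_gt0 // divr_gt0.
  have q0 : 0 <= (r - e0) / r by apply: divr_ge0; [rewrite subr_ge0 ltW | exact: ltW].
  by rewrite subr_gt0 expr_lt1 // ltr_pdivrMr // mul1r gtrBl.
pose rho := Num.sqrt (1 - Num.min k3 (1 / 2)).
have m1 : Num.min k3 (1 / 2) <= k3 by rewrite ge_min lexx.
have m2 : Num.min k3 (1 / 2) <= 1 / 2 by rewrite ge_min lexx orbT.
have m0 : 0 < Num.min k3 (1 / 2) by rewrite lt_min k30 divr_gt0.
have rho2 : rho ^+ 2 = 1 - Num.min k3 (1 / 2).
  by rewrite sqr_sqrtr //; move: m2; clear; lra.
have rho01 : 0 < rho < 1.
  apply/andP; split; first by rewrite sqrtr_gt0; move: m2; clear; lra.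
  by rewrite -(@ltr_pXn2r _ 2) ?nnegrE ?sqrtr_ge0 // expr1n rho2 gtrBl.
apply: (@max_boundary _ _ 0 rho k) => //.
- exact: ltW.
- by move=> z z1 _; exact: hv'.
- by have [d /cder_ccont] := hv' 0 n0.
move=> l /andP[rl l1]; rewrite leNgt; apply/negP => big.
have n1 : nrm (1 : C) = 1 by exact: nrm1.
have Gl : Gc c (2 * l, l ^+ 2) by exact: royal_Gc.
have [a [v [a1 vr fE]]] := normal_form r0 r1 cr (fG _ Gl).
(* Uniform in [l], since [center_bound] is applied to the automorphism [f \o Hm 1 l]. *)
have vb : nrm v <= r - e0.
  apply: (He _ (is_aut_comp hf (Hm_aut c n1 l1)) a v) => //.
  by rewrite /= Hm_origin.
have v1 : nrm v < 1 by apply: lt_trans r1.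
have ka : k1 < 1 - nrm a ^+ 2.
  have [_ vE] := Hm_leaf a1 v1.
  move: big; rewrite fE vE nrmM nrmV !nrmX (nrmM v) nrmX nrm_1B //.
  set X := 1 - nrm a ^+ 2.
  have X0 : 0 < X by rewrite subr_gt0 -nrm_lt1.
  have X1 : X <= 1 by rewrite gerBl sqr_ge0.
  have av : nrm (conjc a ^+ 2 * v) <= r.
    rewrite nrmM nrmX nrm_conj; apply: le_trans (ltW vr).
    by rewrite ler_piMl ?nrm_ge0 // expr_le1 ?nrm_ge0 // ltW.
  have dn : 1 - r <= nrm (1 - conjc a ^+ 2 * v).
    have := nrmD (1 - conjc a ^+ 2 * v) (conjc a ^+ 2 * v); rewrite subrK nrm1.
    by move: av; set Y := nrm (_ * v); set W := nrm _; clear; lra.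
  have dn0 : 0 < nrm (1 - conjc a ^+ 2 * v) by apply: lt_le_trans dn; rewrite subr_gt0.
  rewrite ltr_pdivlMr ?exprn_gt0 // => h.
  have h1 : k1 <= k * nrm (1 - conjc a ^+ 2 * v) ^+ 2.
    rewrite /k1 ler_pM2l //; apply: lerXn2r => //; rewrite ?nnegrE ?subr_ge0 ?nrm_ge0 // ltW //.
  apply: le_lt_trans h1 _; apply: lt_le_trans h _.
  rewrite -[leRHS]mul1r; apply: ler_pM; rewrite ?nrm_ge0 ?sqr_ge0 //; first exact: ltW.
  by rewrite expr2 ler_piMl // ltW.
(* A chain of two discs joins [f (2 * l, l ^+ 2)] to the origin: a leaf, then the royal disc. *)
have Da := discG_map (@Hm_holo R c 1 a a1) (fun x => Gc_Hm n1 a1) (leaf_disc r0 r1 cr).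
have E1 := discG_map hog gG Da; have E2 := discG_map hog gG (royal_disc c).
pose F1 z := ucoord (g (Hm 1 a (0, - ((r%:C)%C * z)))).
pose F2 z := ucoord (g (2 * z, z ^+ 2)).
have F1h : holD F1.
  have [h _] := holD_coord E1; move=> z z1; have [d hd] := h z z1; exists d.
  by apply: cder_near ltr01 _ hd => w _; rewrite -!surjective_pairing.
have F2h : holD F2.
  have [h _] := holD_coord E2; move=> z z1; have [d hd] := h z z1; exists d.
  by apply: cder_near ltr01 _ hd => w _; rewrite -!surjective_pairing.
have F11 z : nrm z < 1 -> nrm (F1 z) < 1.
  move=> z1; apply: ucoord_disc; apply: gG; apply: Gc_Hm => //.
  by have [_ _] := leaf_disc r0 r1 cr; apply.
have F21 z : nrm z < 1 -> nrm (F2 z) < 1.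
  by move=> z1; apply: ucoord_disc; apply: gG; exact: royal_Gc.
have F10 : F1 0 = F2 a by rewrite /F1 mulr0 oppr0 Hm_origin.
have F20 : F2 0 = w0 by rewrite /F2 mulr0 expr2 mul0r.
have rC : (r%:C)%C != 0 :> C by rewrite -nrm_gt0 nrm_real gtr0_norm.
have F1v : F1 (v / (r%:C)%C) = l.
  rewrite /F1 (_ : (r%:C)%C * (v / (r%:C)%C) = v); last by field.
  by rewrite -fE gf // /ucoord /=; field.
have nvr : nrm (v / (r%:C)%C) = nrm v / r by rewrite nrmM nrmV nrm_real gtr0_norm.
have vr1 : nrm (v / (r%:C)%C) < 1 by rewrite nvr ltr_pdivrMr // mul1r.
have s2 := sp_low F2h F21 a1; have s1 := sp_low F1h F11 vr1.
rewrite F20 -F10 in s2; rewrite F1v nvr in s1.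
have t2 : k2 < 1 - nrm (F1 0) ^+ 2.
  by apply: lt_le_trans s2; rewrite /k2 ltr_pM2r // exprn_gt0 // subr_gt0.
have t2' : k2 / 2 <= 1 - nrm (F1 0).
  have q : 0 <= (1 - nrm (F1 0)) ^+ 2 by exact: sqr_ge0.
  by move: t2 q; clear; lra.
have t3 : k3 <= 1 - nrm l ^+ 2.
  apply: le_trans s1; rewrite /k3; apply: ler_pM.
  - rewrite subr_ge0 expr_le1 //; first by rewrite ler_pdivrMr // mul1r gerBl ltW.
    by apply: divr_ge0; [rewrite subr_ge0 ltW | exact: ltW].
  - exact: sqr_ge0.
  - rewrite lerD2l lerN2; apply: lerXn2r; rewrite ?nnegrE ?divr_ge0 ?nrm_ge0 ?subr_ge0 ?(ltW r0) ?(ltW e0r) //.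
    by rewrite ler_pM2r ?invr_gt0.
  - apply: lerXn2r => //; rewrite nnegrE ?divr_ge0 ?(ltW k20) // subr_ge0 ltW // F11 //.
have : rho ^+ 2 < nrm l ^+ 2.
  by rewrite ltr_pXn2r ?nnegrE ?nrm_ge0 //; case/andP: rho01 => /ltW.
by rewrite rho2; move: t3 m1; clear; lra.
Qed.
End Royal.

(** * Rigidity *)

Section Rigidity.
Variable R : realType.
Local Notation C := R[i].
Implicit Types (a b z w d u v t : C) (x : C * C).

Definition fixes_royal (f : Cx2 R -> Cx2 R) : Prop :=
  forall z, nrm z < 1 -> f (2 * z, z ^+ 2) = (2 * z, z ^+ 2).

Lemma cder2_vcoord (f : Cx2 R -> Cx2 R) (x : Cx2 R) : differentiable f x ->
  exists a b, cder2 (fun y => vcoord (f y)) x a b.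
Proof.
move=> /differentiable_cder2[a [b [a' [b' [h1 h2]]]]].
do 2 eexists; rewrite /vcoord.
exact: cder2B (cder2M (cder2_comp h1 (cder_sqr _)) (cder2_cst 4^-1 x)) h2.
Qed.

(** [vcoord / r] along the leaf gives self-maps of the disc fixing [0], one for [f] and one for its
    inverse. Their derivatives have modulus at most [1] and product [1], so the equality case of the
    Schwarz lemma applies. *)
Lemma leaf_rotation (c r : R) (f : Cx2 R -> Cx2 R) : 0 < r -> r < 1 ->
  2 * c * r = 1 + r ^+ 2 -> is_aut (Gc c) f -> fixes_royal f ->
  exists2 d, nrm d = 1 & forall v, nrm v < r -> f (0, - v) = (0, - (d * v)).
Proof.
move=> r0 r1 cr [hf fG [g [hg gG gf fg]]] fS.
have gS : fixes_royal g.
  by move=> z z1; rewrite -{1}fS // gf //; exact: royal_Gc.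
have n0 : nrm (0 : C) < 1 by rewrite nrm0.
have rC0 : (r%:C)%C != 0 :> C by rewrite -nrm_gt0 nrm_real gtr0_norm.
have G0 : Gc c ((0, 0) : C * C).
  by have := royal_Gc c n0; rewrite mulr0 expr2 mul0r.
have zero (h : Cx2 R -> Cx2 R) : fixes_royal h -> h (0, 0) = (0, 0).
  by move=> hS; have := hS 0 n0; rewrite mulr0 expr2 mul0r.
have v00 : vcoord ((0, 0) : C * C) = 0.
  by rewrite /vcoord /= expr2 mul0r mul0r subr0.
pose L z : C := - ((r%:C)%C * z).
have LG z : nrm z < 1 -> Gc c (0, L z) by have [_ _] := leaf_disc r0 r1 cr; apply.
have L0 : L 0 = 0 by rewrite /L mulr0 oppr0.
have dL z : cder L z (- (r%:C)%C).
  by apply: cder_eqd (cderN (cderM (cder_cst (r%:C)%C z) (cder_id z))) _; ring.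
pose W (h : Cx2 R -> Cx2 R) z := vcoord (h (0, L z)) / (r%:C)%C.
have Wprop (h : Cx2 R -> Cx2 R) : holo_on (Gc c) h -> (forall x, Gc c x -> Gc c (h x)) ->
    fixes_royal h ->
    [/\ holD (W h), W h 0 = 0 & forall z, nrm z < 1 -> nrm (W h z) < 1].
  move=> hh hG hS; split.
  - move=> z z1; have [a [b hab]] := cder2_vcoord (hh _ (LG z z1)).
    have k := cder2_disc hab (cder_cst 0 z) (dL z).
    by eexists; exact: cderM k (cder_cst _ z).
  - by rewrite /W L0 zero // v00 mul0r.
  - move=> z z1; rewrite /W nrmM nrmV nrm_real gtr0_norm // ltr_pdivrMr // mul1r.
    by have [] := Gc_uv_bound r0 r1 cr (hG _ (LG z z1)).
have [hWf Wf0 Wf1] := Wprop f hf fG fS; have [hWg Wg0 Wg1] := Wprop g hg gG gS.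
have [A [B hAB]] := cder2_vcoord (hg _ G0).
(* [vcoord \o g] vanishes on the royal disc, whose tangent at the origin is the [s]-direction. Hence
   the unknown [s]-component of the derivative of [f] drops out of the chain rule. *)
have A0 : A = 0.
  have k0 : cder (fun z : C => 2 * z) 0 2.
    by apply: cder_eqd (cderM (cder_cst 2 0) (cder_id (0 : C))) _; ring.
  have hAB' : cder2 (fun y => vcoord (g y)) (2 * 0 : C, (0 : C) ^+ 2) A B.
    by rewrite mulr0 expr2 mul0r.
  have k := @cder2_disc R _ (fun z => 2 * z) (fun z => z ^+ 2) 0 A B _ _ hAB' k0 (cder_sqr 0).
  have k' : cder (fun z : C => vcoord (g (2 * z, z ^+ 2))) 0 0.
    apply: cder_near ltr01 _ (cder_cst 0 0) => z; rewrite subr0 => z1.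
    by rewrite gS // /vcoord /=; field.
  have := cder_uniq k k'; rewrite !mulr0 addr0 => /eqP.
  by rewrite mulf_eq0 (negbTE (two_neq0 _)) orbF => /eqP.
have [dg hdg] := hWg 0 n0.
have Bdg : dg = - B.
  have hAB' : cder2 (fun y => vcoord (g y)) (0 : C, L 0) A B by rewrite L0.
  have k := cderM (cder2_disc hAB' (cder_cst 0 0) (dL 0)) (cder_cst (r%:C)%C^-1 0).
  by rewrite (cder_uniq hdg k); field.
have Bn : nrm B <= 1.
  rewrite -nrmN -Bdg; apply: schwarz_der hWg Wg0 hdg _ => z z1; exact/ltW/Wg1.
(* Differentiate [vcoord (g (f (0, L z))) = r * z] at the origin. *)
have [a [b [a' [b' [h1 h2]]]]] := differentiable_cder2 (hf _ G0).
have h1' : cder2 (fun y => (f y).1) (0 : C, L 0) a b by rewrite L0.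
have h2' : cder2 (fun y => (f y).2) (0 : C, L 0) a' b' by rewrite L0.
have P := cder2_disc h1' (cder_cst 0 0) (dL 0); have Q := cder2_disc h2' (cder_cst 0 0) (dL 0).
have f00 := zero f fS.
have hAB2 : cder2 (fun y => vcoord (g y)) ((f (0, L 0)).1, (f (0, L 0)).2) A B.
  by rewrite L0 f00.
have k := cder2_disc hAB2 P Q.
have k' : cder (fun z => vcoord (g ((f (0, L z)).1, (f (0, L z)).2))) 0 ((r%:C)%C).
  apply: cder_near ltr01 _ (cder_eqd (cderN (dL 0)) (opprK _)) => z; rewrite subr0 => z1.
  rewrite -surjective_pairing gf; last exact: LG.
  by rewrite /vcoord /= expr2 mul0r mul0r sub0r.
have E := cder_uniq k k'.
have [df hdf] := hWf 0 n0.
have dfE : df = b'.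
  have q : cder (W f) 0 ((2 * (f (0, L 0)).1 * (a * 0 + b * - (r%:C)%C) / 4 - (a' * 0 + b' * - (r%:C)%C)) / (r%:C)%C).
    apply: cder_eqd (cderM (cderB (cderM (cder_comp P (cder_sqr _)) (cder_cst 4^-1 0)) Q) (cder_cst (r%:C)%C^-1 0)) _.
    by ring.
  by rewrite (cder_uniq hdf q) L0 f00 /=; field.
have Bdf : - B * df = 1.
  rewrite dfE; apply: (mulIf rC0); rewrite mul1r -[RHS]E A0; ring.
have dfn : nrm df <= 1.
  by apply: schwarz_der hWf Wf0 hdf _ => z z1; exact/ltW/Wf1.
have df1 : nrm df = 1.
  apply/eqP; rewrite eq_le dfn /= leNgt; apply/negP => h.
  have : nrm B * nrm df < 1 by apply: le_lt_trans h; rewrite ler_piMl ?nrm_ge0.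
  by rewrite -(nrmN B) -nrmM Bdf nrm1 ltxx.
have Wrot := schwarz_rot hWf Wf0 hdf (fun z (h : nrm z < 1) => ltW (Wf1 z h)) df1.
(* On the image of the leaf [|vcoord| = r * |z|] tends to [r], so [Gc_uv_bound] sends [ucoord] to
   [0] at the circle, and the maximum principle makes it vanish. *)
have Uz z : nrm z < 1 -> ucoord (f (0, L z)) = 0.
  pose U z := ucoord (f (0, L z)).
  have hU : forall z, nrm z < 1 -> exists d, cder U z d.
    move=> t t1; have [p [q [_ [_ [hp _]]]]] := differentiable_cder2 (hf _ (LG t t1)).
    have k3 := cder2_disc hp (cder_cst 0 t) (dL t).
    by eexists; exact: cderM k3 (cder_cst _ t).
  move=> z1; apply/eqP; rewrite -nrm_eq0; apply/eqP/le_anti; rewrite nrm_ge0 andbT.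
  apply/ler_addgt0Pr => e e0; rewrite add0r.
  pose m := Num.min (1 / 2) (e ^+ 2 * (1 - r)).
  have q1 : 0 < 1 - r by rewrite subr_gt0.
  have m0 : 0 < m by rewrite lt_min divr_gt0 //= mulr_gt0 // exprn_gt0.
  have m1 : m <= 1 / 2 by rewrite ge_min lexx.
  have m2 : m <= e ^+ 2 * (1 - r) by rewrite ge_min lexx orbT.
  apply: (@max_boundary _ U 0 (1 - m) e) => //.
  - exact: ltW.
  - by move: m0 m1; clear; lra.
  - by move=> t t1 _; exact: hU.
  - by have [d /cder_ccont] := hU 0 n0.
  move=> t /andP[tm t1].
  have [_] := Gc_uv_bound r0 r1 cr (fG _ (LG t t1)).
  have -> : vcoord (f (0, L t)) = df * t * (r%:C)%C.
    by rewrite -Wrot // /W divfK.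
  rewrite (nrmM (df * t)) (nrmM df) df1 mul1r nrm_real gtr0_norm // => h.
  apply: nrm_le; first exact: ltW.
  apply: le_trans h _.
  rewrite ler_pdivrMr; last exact: mulr_gt0.
  rewrite (_ : e ^+ 2 * (r * (1 - r)) = e ^+ 2 * (1 - r) * r); last by ring.
  rewrite (_ : r - nrm t * r = (1 - nrm t) * r); last by ring.
  by rewrite ler_pM2r //; apply: le_trans m2; move: tm; clear; lra.
exists df => // v vr.
pose z := v / (r%:C)%C.
have z1 : nrm z < 1 by rewrite nrmM nrmV nrm_real gtr0_norm // ltr_pdivrMr // mul1r.
have Lz : L z = - v by rewrite /L /z; congr (- _); field.
have := Uz z z1; have := Wrot z z1; rewrite /W Lz.
case: (f (0, - v)) => s p; rewrite /ucoord /vcoord /= => hv hu.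
have s0 : s = 0.
  by move/eqP: hu; rewrite mulf_eq0 invr_eq0 (negbTE (two_neq0 _)) orbF => /eqP.
rewrite s0 in hv *; congr pair.
have h4 : 0 ^+ 2 / 4 - p = df * z * (r%:C)%C by rewrite -hv divfK.
rewrite expr2 mul0r mul0r sub0r in h4.
by rewrite -[LHS]opprK h4 /z; congr (- _); field.
Qed.

Lemma cder_zero_line (T : C -> C) d (o : C) : nrm o = 1 -> cder T 0 d ->
  (forall x : R, `|x| < 1 -> T ((x%:C)%C * o) = 0) -> d = 0.
Proof.
move=> o1 H T0; apply/eqP; rewrite -nrm_eq0; apply/eqP/le_anti; rewrite nrm_ge0 andbT.
apply/ler_addgt0Pr => e e0; rewrite add0r.
have [dl dl0 h] := H e e0.
have [x [x0 xd x1]] : exists x : R, [/\ 0 < x, x < dl & x < 1].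
  exists (Num.min dl 1 / 2).
  have m0 : 0 < Num.min dl 1 by rewrite lt_min dl0 ltr01.
  have m1 : Num.min dl 1 <= dl by rewrite ge_min lexx.
  have m2 : Num.min dl 1 <= 1 by rewrite ge_min lexx orbT.
  by split; move: m0 m1 m2; clear; lra.
have nx : nrm ((x%:C)%C * o) = x by rewrite nrmM o1 mulr1 nrm_real gtr0_norm.
have := h ((x%:C)%C * o); rewrite nx => /(_ xd).
have T00 : T 0 = 0.
  by have := T0 0; rewrite normr0 => /(_ ltr01); rewrite mul0r.
rewrite add0r T0; last by rewrite gtr0_norm.
by rewrite T00 subrr sub0r nrmN nrmM nx ler_pM2r.
Qed.

Lemma fixes_royal_conj (f : Cx2 R -> Cx2 R) a : nrm a < 1 -> fixes_royal f ->
  fixes_royal (Hm 1 (- a) \o (f \o Hm 1 a)).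
Proof.
move=> a1 fS z z1; have na : nrm (- a) < 1 by rewrite nrmN.
by rewrite /= Hm_royal // !mul1r fS ?mob_disc // Hm_royal ?mob_disc // !mul1r mobK.
Qed.

Lemma Hm1_inv (c : R) a x : nrm a < 1 -> Gc c x -> Hm 1 (- a) (Hm 1 a x) = x.
Proof.
move=> a1 hx; have := Hm_inv (nrm1 R) a1 hx.
by rewrite (_ : conjc (1 : C) = 1) ?mulr1 // rmorph1.
Qed.

Lemma Hm1_inv' (c : R) a x : nrm a < 1 -> Gc c x -> Hm 1 a (Hm 1 (- a) x) = x.
Proof.
by move=> a1 hx; rewrite -{1}(opprK a) (@Hm1_inv c) // nrmN.
Qed.

Lemma leaf_preserved (c r : R) (f : Cx2 R -> Cx2 R) a : 0 < r -> r < 1 ->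
  2 * c * r = 1 + r ^+ 2 -> is_aut (Gc c) f -> fixes_royal f -> nrm a < 1 ->
  exists2 d, nrm d = 1 &
    forall v, nrm v < r -> f (Hm 1 a (0, - v)) = Hm 1 a (0, - (d * v)).
Proof.
move=> r0 r1 cr hf fS a1; have na : nrm (- a) < 1 by rewrite nrmN.
have A := is_aut_comp (Hm_aut c (nrm1 R) na) (is_aut_comp hf (Hm_aut c (nrm1 R) a1)).
have [d d1 h] := leaf_rotation r0 r1 cr A (fixes_royal_conj a1 fS).
exists d => // v vr; rewrite -h //=.
have [_ fG _] := hf.
rewrite (@Hm1_inv' c) //; apply: fG; apply: Gc_Hm => //; first exact: nrm1.
exact: (leaf_Gc r0 r1 cr).
Qed.

Lemma leaf_den a v : nrm a < 1 -> nrm v < 1 -> 1 - conjc a ^+ 2 * v != 0.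
Proof.
move=> a1 v1; have a2 : nrm (- a ^+ 2) < 1 by rewrite nrmN nrmX expr_lt1 // nrm_ge0.
by have := mob_den a2 (ltW v1); rewrite rmorphN rmorphXn mulNr.
Qed.

Lemma Hm_leafE a v : Hm 1 a (0, - v) =
  ((2 * a - 2 * conjc a * v) / (1 - conjc a ^+ 2 * v), (a ^+ 2 - v) / (1 - conjc a ^+ 2 * v)).
Proof.
rewrite /Hm /Hden -[(0, - v).1]/(0 : C) -[(0, - v).2]/(- v).
by congr pair; congr (_ / _); ring.
Qed.

(* On the leaf through [a], [(s, p)] satisfies [s (1 + a^2) = 2 a (1 + p)] for real [a] and
   [s (1 - a^2) = 2 a (1 - p)] for imaginary [a]; here [k = 1] or [k = -1] and [conj a = k a]. *)
Lemma leaf_equation a v k : k * k = 1 -> conjc a = k * a -> nrm a < 1 -> nrm v < 1 ->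
  (Hm 1 a (0, - v)).1 * (1 + k * a ^+ 2) = 2 * a * (1 + k * (Hm 1 a (0, - v)).2).
Proof.
move=> kk ak a1 v1; have d0 := leaf_den a1 v1.
rewrite Hm_leafE [(_, _).1]/= [(_, _).2]/=.
have k2 : conjc a ^+ 2 = a ^+ 2 by rewrite ak exprMn expr2 kk mul1r.
rewrite k2 in d0 *; rewrite ak.
apply: (mulIf d0); rewrite mulrAC divfK //.
transitivity (2 * a * ((1 - a ^+ 2 * v) + k * (a ^+ 2 - v))); last by field.
transitivity (2 * a * (1 + k * a ^+ 2 - k * v - k * k * v * a ^+ 2)); first by ring.
by rewrite kk; ring.
Qed.

(** The rotation of the leaf through [z] depends on [z] in an unknown way, so it cannot be
    differentiated. But [leaf_equation] holds on the whole leaf and does not see it. Its derivative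
    at [0] relates [a], the [s]-derivative of the first component of [f], to [d]; the two signs of
    [k] force [a = d = 1]. *)
Lemma leaf_fixed (c r : R) (f : Cx2 R -> Cx2 R) : 0 < r -> r < 1 ->
  2 * c * r = 1 + r ^+ 2 -> is_aut (Gc c) f -> fixes_royal f ->
  forall v, nrm v < r -> f (0, - v) = (0, - v).
Proof.
move=> r0 r1 cr hf fS.
have [d d1 fd] := leaf_rotation r0 r1 cr hf fS.
suff de : d = 1 by move=> v vr; rewrite fd // de mul1r.
pose w : C := ((r / 2)%:C)%C.
have r20 : 0 < r / 2 by rewrite divr_gt0.
have nw : nrm w = r / 2 by rewrite nrm_real gtr0_norm.
have wr : nrm w < r by rewrite nw; move: r0; clear; lra.
have w1 : nrm w < 1 by exact: lt_trans r1.
have w0 : w != 0 by rewrite -nrm_gt0 nw.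
have [hof fG _] := hf.
have [a [b [a' [b' [h1 h2]]]]] := differentiable_cder2 (hof _ (leaf_Gc r0 r1 cr wr)).
have n0 : nrm (0 : C) < 1 by rewrite nrm0.
(* Differentiate [leaf_equation] at [0] along the real ([k = 1]) and the imaginary
   ([k = -1]) axis. *)
suff side (k o : C) : k * k = 1 -> nrm o = 1 -> (forall x : R, conjc ((x%:C)%C * o) = k * ((x%:C)%C * o)) ->
    a * (1 - k * w) = 1 - k * (d * w).
  have i1 : nrm (Complex (0 : R) 1) = 1 by rewrite /= expr0n expr1n add0r sqrtr1.
  have Ii : Im (Complex (0 : R) 1) = 1 by [].
  have e1 : a * (1 - 1 * w) = 1 - 1 * (d * w).
    apply: (side 1 1) => [||x]; [exact: mulr1|exact: nrm1|].
    by rewrite !mulr1 mul1r; apply: complex_ext; rewrite !reimE ?oppr0.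
  have e2 : a * (1 - -1 * w) = 1 - -1 * (d * w).
    apply: (side (-1) (Complex 0 1)) => [||x]; [by rewrite mulrNN mulr1|exact: i1|].
    apply: complex_ext; rewrite !reimE ?Ii ?(mulr0, mul0r, mulr1, subr0, addr0, oppr0, mulN1r, add0r) //; exact: addr0.
  have a1 : a = 1.
    have : a * 2 = 2.
      transitivity (a * (1 - 1 * w) + a * (1 - -1 * w)); first by ring.
      by rewrite e1 e2; ring.
    by move=> h; apply: (mulIf (two_neq0 R)); rewrite h mul1r.
  rewrite a1 !mul1r in e1; apply: (mulIf w0); rewrite mul1r.
  by rewrite -[LHS](subKr 1) -e1; ring.
move=> kk o1 ko.
(* The point [Hm 1 z (0, - w)] is not holomorphic in [z]; on the line where [conjc z = k * z] it
   coincides with the holomorphic curve [(S, P)]. *)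
pose S z : C := 2 * z * (1 - k * w) / (1 - z ^+ 2 * w).
pose P z : C := (z ^+ 2 - w) / (1 - z ^+ 2 * w).
have den0 : 1 - (0 : C) ^+ 2 * w != 0 by rewrite expr2 !mul0r subr0 oner_eq0.
have dden : cder (fun z : C => 1 - z ^+ 2 * w) 0 0.
  by apply: cder_eqd (cderB (cder_cst 1 0) (cderM (cder_sqr 0) (cder_cst w 0))) _; ring.
have dS : cder S 0 (2 * (1 - k * w)).
  apply: cder_eqd (cderM (cderM (cderM (cder_cst 2 0) (cder_id (0 : C))) (cder_cst (1 - k * w) 0)) (cderV dden den0)) _.
  by rewrite expr2 !mul0r subr0; field.
have dP : cder P 0 0.
  apply: cder_eqd (cderM (cderB (cder_sqr 0) (cder_cst w 0)) (cderV dden den0)) _.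
  by rewrite expr2 !mul0r subr0; field.
have S0 : S 0 = 0 by rewrite /S mulr0 !mul0r.
have P0 : P 0 = - w by rewrite /P expr2 !mul0r subr0 sub0r divr1.
have h1' : cder2 (fun y => (f y).1) (S 0, P 0) a b by rewrite S0 P0.
have h2' : cder2 (fun y => (f y).2) (S 0, P 0) a' b' by rewrite S0 P0.
have fS0 : f (S 0, P 0) = (0, - (d * w)) by rewrite S0 P0 fd.
have D1 := cder2_disc h1' dS dP; have D2 := cder2_disc h2' dS dP.
pose T z : C := (f (S z, P z)).1 * (1 + k * z ^+ 2) - 2 * z * (1 + k * (f (S z, P z)).2).
have dT : cder T 0 (a * (2 * (1 - k * w)) - 2 * (1 - k * (d * w))).
  apply: cder_eqd (cderB (cderM D1 (cderD (cder_cst 1 0) (cderM (cder_cst k 0) (cder_sqr 0))))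
    (cderM (cderM (cder_cst 2 0) (cder_id (0 : C))) (cderD (cder_cst 1 0) (cderM (cder_cst k 0) D2)))) _.
  by rewrite fS0 [(_, _).1]/= [(_, _).2]/= expr2 !mul0r; ring.
have : a * (2 * (1 - k * w)) - 2 * (1 - k * (d * w)) = 0.
  apply: (cder_zero_line o1 dT) => x x1.
  have := ko x; set z := _ * o => zk.
  have z1 : nrm z < 1 by rewrite nrmM o1 mulr1 nrm_real.
  have z2 : conjc z ^+ 2 = z ^+ 2 by rewrite zk exprMn expr2 kk mul1r.
  have E : (S z, P z) = Hm 1 z (0, - w).
    rewrite Hm_leafE z2 zk; congr pair; rewrite /S; congr (_ / _); ring.
  have [e e1 he] := leaf_preserved r0 r1 cr hf fS z1.
  rewrite /T E he //.
  have ew : nrm (e * w) < 1 by rewrite nrmM e1 mul1r.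
  by rewrite (leaf_equation kk zk z1 ew) subrr.
move=> h; apply: (mulIf (two_neq0 R)); apply/eqP; rewrite -subr_eq0 -[X in _ == X]h.
by apply/eqP; ring.
Qed.

(** Conjugation by [Hm 1 a] moves the leaf through [a] to the central one, which [leaf_fixed]
    handles. *)
Lemma rigidity (c : R) (f : Cx2 R -> Cx2 R) : 1 < c -> is_aut (Gc c) f -> fixes_royal f ->
  forall x, Gc c x -> f x = x.
Proof.
move=> c1 hf fS x hx; have [r [r0 r1 cr]] := exists_radius c1.
have [a [v [a1 vr ->]]] := normal_form r0 r1 cr hx.
have na : nrm (- a) < 1 by rewrite nrmN.
have A := is_aut_comp (Hm_aut c (nrm1 R) na) (is_aut_comp hf (Hm_aut c (nrm1 R) a1)).
have := leaf_fixed r0 r1 cr A (fixes_royal_conj a1 fS) vr.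
have [_ fG _] := hf; rewrite /= => E.
rewrite -[in RHS]E (@Hm1_inv' c) //; apply: fG; apply: Gc_Hm => //; first exact: nrm1.
exact: (leaf_Gc r0 r1 cr).
Qed.

(** Invariance of the royal disc under [f] and its inverse makes [be f] an automorphism of the disc.
    It determines the [Hm] whose inverse, composed with [f], falls under [rigidity]. *)
Lemma aut_Gc_Hm (c : R) (f : Cx2 R -> Cx2 R) : 1 < c -> is_aut (Gc c) f ->
  exists tau a, [/\ nrm tau = 1, nrm a < 1 & forall x, Gc c x -> f x = Hm tau a x].
Proof.
move=> c1 hf; have [hof fG [g [hog gG gf fg]]] := hf.
have hg : is_aut (Gc c) g by split => //; exists f; split.
have fR := royal_preserved c1 hf; have gR := royal_preserved c1 hg.
pose be (h : Cx2 R -> Cx2 R) (z : C) : C := ucoord (h (2 * z, z ^+ 2)).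
have hbe (h : Cx2 R -> Cx2 R) : holo_on (Gc c) h -> (forall x, Gc c x -> Gc c (h x)) ->
    (forall z, nrm z < 1 -> vcoord (h (2 * z, z ^+ 2)) = 0) ->
    [/\ holo_on (@disc R) (be h : Cx R -> Cx R), forall z, nrm z < 1 -> nrm (be h z) < 1 &
        forall z, nrm z < 1 -> h (2 * z, z ^+ 2) = (2 * be h z, be h z ^+ 2)].
  move=> hh hG hR; split.
  - move=> z z1; have [k _] := holD_coord (discG_map hh hG (royal_disc c)).
    have [d hd] := k z z1; apply: (@cder_differentiable R (be h) z d).
    by apply: cder_near ltr01 _ hd => w _; rewrite -surjective_pairing.
  - by move=> z z1; apply: ucoord_disc; apply: hG; exact: royal_Gc.
  - move=> z z1; have := hR z z1; rewrite /be /ucoord /vcoord.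
    case: (h _) => s p /= /eqP; rewrite subr_eq0 => /eqP <-.
    by congr pair; field.
have [f1 f2 f3] := hbe f hof fG fR; have [g1 g2 g3] := hbe g hog gG gR.
have uroyal z : ucoord (2 * z, z ^+ 2) = z by rewrite /ucoord /=; field.
have bA : is_aut (@disc R) (be f : Cx R -> Cx R).
  split => //; exists (be g : Cx R -> Cx R); split => //.
  - by move=> z z1; rewrite /be -f3 // gf ?uroyal //; exact: royal_Gc.
  - by move=> z z1; rewrite /be -g3 // fg ?uroyal //; exact: royal_Gc.
have [tau [a [t1 a1 bE]]] := aut_disc_mob bA.
exists tau, a; split => //.
have t1' : nrm (conjc tau) = 1 by rewrite nrm_conj.
have a1' : nrm (- (a * tau)) < 1 by rewrite nrmN nrmM t1 mulr1.
have A := is_aut_comp (Hm_aut c t1' a1') hf.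
have hS : fixes_royal (Hm (conjc tau) (- (a * tau)) \o f).
  move=> z z1; rewrite /= f3 // bE // Hm_royal ?mob_unit //.
  exact: nrm_tau_mob.
move=> x hx; have := rigidity c1 A hS hx => /= E.
rewrite -[in RHS]E; have := Hm_inv t1' a1' (fG _ hx).
rewrite (_ : conjc (conjc tau) = tau); last by case: (tau) => p q; rewrite /= opprK.
by rewrite mulNr opprK -mulrA unit_conj // mulr1 => ->.
Qed.

(** Differentiability at a point looks at a neighbourhood, so openness is what lets agreement on [U]
    transfer it. *)
Lemma is_aut_eq (U : set (Cx2 R)) (f g : Cx2 R -> Cx2 R) : open U ->
  (forall x, U x -> f x = g x) -> is_aut U g -> is_aut U f.
Proof.
move=> oU fg [hg gU [h [hh hU hgK ghK]]]; split.
- move=> x Ux; have /nbhsC2P[d d0 hd] : nbhs x U by exact: open_nbhs_nbhs.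
  have [a [b [a' [b' [h1 h2]]]]] := differentiable_cder2 (hg _ Ux).
  apply: (@cder2_differentiable R f x a b a' b').
    by apply: cder2_near d0 _ h1 => p q hp hq; rewrite fg //; exact: hd.
  by apply: cder2_near d0 _ h2 => p q hp hq; rewrite fg //; exact: hd.
- by move=> x Ux; rewrite fg //; exact: gU.
exists h; split => //.
- by move=> x Ux; rewrite fg // hgK.
- by move=> x Ux; rewrite fg ?ghK //; exact: hU.
Qed.

(** The right side avoids the roots, so openness follows by continuity. For the converse, the second
    inequality makes [(1 - |z|^2) * (1 - |w|^2)] positive, and the first one, [|z|^2 + |w|^2 < 2],
    excludes that both factors are negative. *)
Lemma Gc_uvP (c : R) x : 1 < c -> (Gc c x <->
  nrm (ucoord x) ^+ 2 + nrm (vcoord x) < 1 /\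
  2 * c * nrm (vcoord x) + 2 * nrm (ucoord x) ^+ 2 < 1 + nrm x.2 ^+ 2).
Proof.
move=> c1.
have E : ucoord x ^+ 2 - vcoord x = x.2 by rewrite /ucoord /vcoord; field.
split; first by move=> /Gc_uv; rewrite E.
move=> [h1 h2]; pose u := ucoord x; pose q := sqrtc (vcoord x).
have q2 : q ^+ 2 = vcoord x by exact: sqr_sqrtc.
rewrite -/u -q2 nrmX in h1 h2.
have xE : x = ((u + q) + (u - q), (u + q) * (u - q)).
  rewrite [LHS]surjective_pairing -E -q2 -/u; congr pair; last by ring.
  by rewrite /u /ucoord; field.
have p1 := nrm_sqr_sum (u + q) (u - q).
rewrite (_ : u + q - (u - q) = 2 * q) in p1; last by ring.
rewrite (_ : u + q + (u - q) = 2 * u) in p1; last by ring.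
rewrite (nrmM 2 q) (nrmM 2 u) nrm2C !exprMn in p1.
have x2 : nrm x.2 = nrm (u + q) * nrm (u - q) by rewrite xE nrmM.
rewrite x2 exprMn in h2.
have tq : 0 <= (c - 1) * nrm q ^+ 2 by apply: mulr_ge0; [rewrite subr_ge0 ltW | exact: sqr_ge0].
have key : 2 * ((c - 1) * nrm q ^+ 2) < (1 - nrm (u + q) ^+ 2) * (1 - nrm (u - q) ^+ 2).
  by move: p1 h2; set X := nrm (u + q) ^+ 2; set Y := nrm (u - q) ^+ 2; clear; lra.
have pos : 0 < (1 - nrm (u + q) ^+ 2) * (1 - nrm (u - q) ^+ 2).
  by apply: le_lt_trans key; exact: mulr_ge0.
have both : nrm (u + q) ^+ 2 < 1 /\ nrm (u - q) ^+ 2 < 1.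
  move: p1 h1 pos; set X := nrm (u + q) ^+ 2; set Y := nrm (u - q) ^+ 2.
  move=> p1 h1 pos; have XY : X + Y < 2 by move: p1 h1; clear; lra.
  have [X1|X1] := ltP X 1; first by split => //; move: pos; rewrite pmulr_rgt0 subr_gt0.
  have Y1 : 0 < 1 - Y by move: X1 XY; clear; lra.
  by move: pos; rewrite pmulr_lgt0 // subr_gt0 ltNge X1.
apply/GcP; exists (u + q), (u - q); split => //; rewrite ?nrm_lt1; try by case: both.
rewrite /tube (_ : u + q - (u - q) = 2 * q); last by ring.
rewrite nrmM nrm2C exprMn.
by move: key; set W := _ * (1 - _); clear; lra.
Qed.

Lemma nrm_near (F : C * C -> C) x a b (e : R) : cder2 F x a b -> 0 < e ->
  exists2 d : R, 0 < d & forall h k, nrm h < d -> nrm k < d ->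
    `|nrm (F (x.1 + h, x.2 + k)) - nrm (F x)| < e.
Proof.
move=> /cder2_lip[dl dl0 H] e0; set K := nrm a + nrm b + 1 in H.
have K0 : 0 < K by rewrite /K; have := nrm_ge0 a; have := nrm_ge0 b; clear; lra.
exists (Num.min dl (e / (2 * K))); first by rewrite lt_min dl0 divr_gt0 // mulr_gt0.
move=> h k; rewrite !lt_min => /andP[h1 h2] /andP[k1 k2].
have hk : K * (nrm h + nrm k) < e.
  rewrite mulrC -ltr_pdivlMr //.
  have -> : e / K = e / (2 * K) + e / (2 * K) by field; rewrite gt_eqF.
  exact: ltrD.
have := H h k h1 k1; set X := F _; set Y := F _ => HT.
have l1 := nrmD (X - Y) Y; have l2 := nrmD (Y - X) X.
rewrite !subrK in l1 l2; rewrite (nrmBC Y) in l2.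
by rewrite ltr_norml; move: HT hk l1 l2; set T := K * _; clear; lra.
Qed.

Lemma nrm_cont (F : Cx2 R -> C) (x : Cx2 R) a b : cder2 F x a b ->
  {for x, continuous (fun y => nrm (F y))}.
Proof.
move=> H; apply/cvgrPdist_lt => e e0; have [d d0 hd] := nrm_near H e0.
by apply/nbhsC2P; exists d => // h k hh hk; rewrite distrC; exact: hd.
Qed.

Lemma Gc_open (c : R) : 1 < c -> open (Gc c : set (Cx2 R)).
Proof.
move=> c1; rewrite openE => x hx; rewrite /interior.
have /(Gc_uvP _ c1)[h1 h2] := hx.
have cu : exists a b, cder2 (@ucoord R) x a b.
  by do 2 eexists; exact: cder2M (cder2_fst x) (cder2_cst 2^-1 x).
have cv : exists a b, cder2 (@vcoord R) x a b.
  do 2 eexists.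
  exact: cder2B (cder2M (cder2_comp (cder2_fst x) (cder_sqr _)) (cder2_cst 4^-1 x)) (cder2_snd x).
have [a [b /nrm_cont Cu]] := cu; have [a' [b' /nrm_cont Cv]] := cv.
have Cp := nrm_cont (cder2_snd x).
have sq (F : Cx2 R -> R) : {for x, continuous F} -> {for x, continuous (fun y => F y ^+ 2)}.
  by move=> hF; apply: continuousM.
have C1 : {for x, continuous (fun y : Cx2 R => nrm (ucoord y) ^+ 2 + nrm (vcoord y))}.
  by apply: continuousD => //; exact: sq.
have C2 : {for x, continuous (fun y : Cx2 R => (1 + nrm y.2 ^+ 2) - (2 * c * nrm (vcoord y) + 2 * nrm (ucoord y) ^+ 2))}.
  apply: continuousB; first by apply: continuousD; [exact: cst_continuous | exact: sq].
  apply: continuousD; apply: continuousM; [exact: cst_continuous|exact: Cv|exact: cst_continuous|exact: sq].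
have N1 : nbhs x (fun y : Cx2 R => nrm (ucoord y) ^+ 2 + nrm (vcoord y) < 1).
  by apply: (cvgr_lt _ C1).
have N2 : nbhs x (fun y : Cx2 R => 0 < (1 + nrm y.2 ^+ 2) - (2 * c * nrm (vcoord y) + 2 * nrm (ucoord y) ^+ 2)).
  by apply: (cvgr_gt _ C2); rewrite subr_gt0.
by apply: filterS2 N1 N2 => y N1y; rewrite subr_gt0 => N2y; apply/(Gc_uvP _ c1).
Qed.

Lemma symbidisc_bigcup : @symbidisc R = \bigcup_(c in [set c : R | 1 < c]) Gc c.
Proof.
apply/seteqP; split => x; last by move=> [c _ []].
move=> [z [w [z1 w1 ->]]].
have {}z1 : nrm z < 1 := z1; have {}w1 : nrm w < 1 := w1.
pose p := (1 - nrm z ^+ 2) * (1 - nrm w ^+ 2).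
have p0 : 0 < p by apply: mulr_gt0; rewrite subr_gt0 -nrm_lt1.
(* Since [|z - w|^2 < 4], this choice of [c] gives [(c - 1) * |z - w|^2 < p]. *)
exists (1 + p / 4); first by rewrite /= ltrDl divr_gt0.
apply/GcP; exists z, w; split => //.
rewrite /tube -/p (_ : 1 + p / 4 - 1 = p / 4); last by ring.
have : nrm (z - w) ^+ 2 < 2 ^+ 2.
  rewrite ltr_pXn2r ?nnegrE ?nrm_ge0 //; apply: le_lt_trans (nrmB _ _) _.
  by move: z1 w1; clear; lra.
move: (nrm _ ^+ 2) => X X4.
have : p * X < p * 2 ^+ 2 by rewrite ltr_pM2l.
by move: p0; clear; lra.
Qed.
End Rigidity.

Theorem theorem4p2 (R : realType) :
  (forall c : R, 1 < c ->
     [/\ open (Gc c),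
         (* Aut(G_c) = { H_phi restricted to G_c : phi in Aut(D) } *)
         (forall f : Cx2 R -> Cx2 R,
            is_aut (Gc c) f <->
            exists phi : Cx R -> Cx R, is_aut (@disc R) phi /\ agrees_with_H (Gc c) phi f) &
         (* phi |-> H_phi|_{G_c} is injective, so Aut(G_c) ~ Aut(D) *)
         (forall phi1 phi2 : Cx R -> Cx R,
            is_aut (@disc R) phi1 -> is_aut (@disc R) phi2 ->
            (forall z1 z2 : Cx R, disc z1 -> disc z2 -> Gc c (z1 + z2, z1 * z2) ->
               (phi1 z1 + phi1 z2, phi1 z1 * phi1 z2)
               = (phi2 z1 + phi2 z2, phi2 z1 * phi2 z2) :> Cx2 R) ->
            forall z, disc z -> phi1 z = phi2 z)]) /\
  @symbidisc R = \bigcup_(c in [set c : R | 1 < c]) Gc c.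
Proof.
split; last exact: symbidisc_bigcup.
move=> c c1; split; first exact: Gc_open.
- move=> f; split=> [hf|[phi [hphi fphi]]].
    have [tau [a [t1 a1 fE]]] := aut_Gc_Hm c1 hf.
    exists (fun z => tau * mob a z); split; first exact: (mob_aut t1 a1).
    by move=> z w z1 w1 zw; rewrite fE // HmE.
  have [tau [a [t1 a1 phiE]]] := aut_disc_mob hphi.
  apply: (is_aut_eq (Gc_open c1) _ (Hm_aut c t1 a1)) => x xG.
  have /GcP[z [w [z1 w1 xE _]]] := xG.
  have xG' : Gc c (z + w, z * w) by rewrite -xE.
  by rewrite xE HmE // fphi // !phiE.
- move=> phi1 phi2 _ _ phi12 z z1.
  (* On the diagonal, that is on the royal disc, the first components already read
     [2 * phi1 z = 2 * phi2 z]. *)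
  have zG : Gc c ((z : R[i]) + z, (z : R[i]) * z).
    by rewrite -expr2 (_ : z + z = 2 * z); [exact: royal_Gc|by ring].
  have [E _] := phi12 z z z1 z1 zG.
  apply: (mulfI (two_neq0 R)).
  by rewrite !mulr2n !mulrDl !mul1r.
Qed.
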